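(* Let $a\in\mathbb{A}$ with $a>5$, let $b\ne 1$ be odd with $\gcd(a,b)=1$, and let $G=G_{a,b}$. For the natural $8$-dimensional representation of $G$ on $\mathbb{R}^8$ the only nontrivial isotropy type is generically symmetry breaking. Systems that are symmetric with respect to this representation generically have nontrivial symmetry breaking branches of steady states that are hyperbolic within the fixed point spaces. That is, there is an open and dense subset $\mathcal{U}\subset\mathcal{V}_0(\mathbb{R}^8,G)$ such that every $f\in\mathcal{U}$ has a branch of nontrivial zeros emanating from $(0,0)\in\mathbb{R}^8\times\mathbb{R}$ whose isotropy subgroup $K$ belongs to the only nontrivial isotropy type and which is hyperbolic within $\mathrm{Fix}(K)$.
   Context: Let $\mathbb{A}$ be the set of all finite products $\prod_{i=1}^r a_i^{s_i}$ with $r\ge1$, $s_i\ge1$ and primes $a_i\equiv 1 \bmod 4$. For each $a\in\mathbb{A}$ fix (once and for all) an odd $\rho\in\{0,\dots,a-1\}$ with $\rho^2\equiv -1\bmod a$ (such $\rho$ exists). Let $\mathbf{r}(\psi)=\begin{pmatrix}\cos\psi&-\sin\psi\\ \sin\psi&\cos\psi\end{pmatrix}$ and $$c=\begin{pmatrix}\mathbf{r}(\pi/a)&0\\0&\mathbf{r}(\pi/a)\end{pmatrix},\quad d=\begin{pmatrix}\mathbf{r}(-\pi/b)&0\\0&\mathbf{r}(\pi/b)\end{pmatrix},$$ $$q=\begin{pmatrix}0&0&1&0\\0&0&0&1\\-1&0&0&0\\0&-1&0&0\end{pmatrix},\quad s=\begin{pmatrix}0&0&-1&0\\0&0&0&1\\1&0&0&0\\0&-1&0&0\end{pmatrix}.$$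 For $a\in\mathbb{A}$ and odd $b\ge3$ with $\gcd(a,b)=1$ define, in $4\times4$ blocks, $$C=\begin{pmatrix}c&0\\0&c^\rho\end{pmatrix},\ D=\begin{pmatrix}d&0\\0&d\end{pmatrix},\ Q=\begin{pmatrix}q&0\\0&-q\end{pmatrix},\ S=\begin{pmatrix}s&0\\0&s\end{pmatrix},\ V=\begin{pmatrix}0&\mathbf{1}_4\\ s&0\end{pmatrix},$$ and $G_{a,b}=\langle C,D,Q,S,V\rangle$, a finite subgroup of $\mathrm{O}(8)$ acting absolutely irreducibly on $\mathbb{R}^8$. The isotropy subgroup of $x$ is its stabilizer; an isotropy type is a conjugacy class of isotropy subgroups, nontrivial if its members are neither trivial nor the whole group. $G_{a,b}$ has precisely one nontrivial isotropy type, namely the conjugacy class of $\langle QS\rangle$. $\mathrm{Fix}(K)=\{x:kx=x\ \forall k\in K\}$. Normalized bifurcation problems: $\mathcal{V}_0(\mathbb{R}^8,G)$ is the set of smooth maps $f:\mathbb{R}^8\times\mathbb{R}\to\mathbb{R}^8$ with $f(gx,\lambda)=gf(x,\lambda)$ for all $g\in G$ and $D_xf(0,\lambda)=\lambda\,\mathbf{1}_8$ for all $\lambda\in\mathbb{R}$, equipped with the topology induced by the $C^\infty$-topology. Write $f_\lambda=f(\cdot,\lambda)$. One always has $f(0,\lambda)=0$ (trivial zeros). A branch of nontrivial zeros of $f$ emanating from $(0,0)$ with isotropy subgroup $K$ is a $C^1$ curve $t\mapsto(x(t),\lambda(t))\in\mathbb{R}^8\times\mathbb{R}$, $t\in[0,\varepsilon)$,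 with $(x(0),\lambda(0))=(0,0)$ and, for $t>0$, $x(t)\ne0$, $f(x(t),\lambda(t))=0$ and the isotropy subgroup of $x(t)$ equal to $K$. It is hyperbolic within $\mathrm{Fix}(K)$ if for all sufficiently small $t>0$ the derivative of the restriction $f_{\lambda(t)}|_{\mathrm{Fix}(K)}:\mathrm{Fix}(K)\to\mathrm{Fix}(K)$ at $x(t)$ has no eigenvalue with zero real part. An isotropy type $\tau$ is generically symmetry breaking if for all $f$ in some open and dense subset of $\mathcal{V}_0(\mathbb{R}^8,G)$ there is a branch of nontrivial zeros emanating from $(0,0)$ with isotropy subgroup in $\tau$. *)

(* Defs.v *)
From HB Require Import structures.
From mathcomp Require Import all_boot all_order all_algebra.
From mathcomp Require Import all_classical all_reals all_analysis.
From mathcomp Require Import complex.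

Set Implicit Arguments.
Unset Strict Implicit.
Unset Printing Implicit Defensive.

Import Order.TTheory GRing.Theory Num.Theory.
Import numFieldNormedType.Exports.

Local Open Scope classical_set_scope.
Local Open Scope ring_scope.

(* The set of products of powers of primes congruent to 1 mod 4; a list of
   pairs (p, e) stands for the product of the p ^ e. *)
Definition AA (a : nat) : Prop :=
  exists s : seq (nat * nat),
    [/\ (1 <= size s)%N,
        all (fun pe => [&& prime pe.1, pe.1 %% 4 == 1 & 1 <= pe.2]%N) s &
        a = (\prod_(pe <- s) pe.1 ^ pe.2)%N].

Definition odd_root_of_m1 (a rho : nat) : Prop :=
  [/\ odd rho, (rho < a)%N & (rho%:Z ^+ 2 = -1 %[mod a%:Z])%Z].

Section Group.
Variable R : realType.

Definition mx_of_rows n (rows : seq (seq R)) : 'M[R]_n :=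
  \matrix_(i < n, j < n) (nth [::] rows i)`_j.

Definition rot (psi : R) : 'M[R]_2 :=
  mx_of_rows 2 [:: [:: cos psi; - sin psi]; [:: sin psi; cos psi]].

Definition c_mx (a : nat) : 'M[R]_4 :=
  block_mx (rot (pi / a%:R)) 0 0 (rot (pi / a%:R)).

Definition d_mx (b : nat) : 'M[R]_4 :=
  block_mx (rot (- (pi / b%:R))) 0 0 (rot (pi / b%:R)).

Definition q_mx : 'M[R]_4 :=
  mx_of_rows 4 [:: [:: 0; 0; 1; 0];
                   [:: 0; 0; 0; 1];
                   [:: -1; 0; 0; 0];
                   [:: 0; -1; 0; 0]].

Definition s_mx : 'M[R]_4 :=
  mx_of_rows 4 [:: [:: 0; 0; -1; 0];
                   [:: 0; 0; 0; 1];
                   [:: 1; 0; 0; 0];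
                   [:: 0; -1; 0; 0]].

Definition C_mx (a rho : nat) : 'M[R]_8 :=
  block_mx (c_mx a) 0 0 (c_mx a ^+ rho).
Definition D_mx (b : nat) : 'M[R]_8 := block_mx (d_mx b) 0 0 (d_mx b).
Definition Q_mx : 'M[R]_8 := block_mx q_mx 0 0 (- q_mx).
Definition S_mx : 'M[R]_8 := block_mx s_mx 0 0 s_mx.
Definition V_mx : 'M[R]_8 := block_mx 0 (1%:M : 'M[R]_4) s_mx 0.

Definition is_mx_group n (H : set 'M[R]_n) : Prop :=
  [/\ H 1%:M,
      forall g h, H g -> H h -> H (g *m h) &
      forall g, H g -> g \in unitmx /\ H (invmx g)].

Definition generated_mx_group n (A : set 'M[R]_n) : set 'M[R]_n :=
  smallest (@is_mx_group n) A.

Definition Gab (a b rho : nat) : set 'M[R]_8 :=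
  generated_mx_group
    [set g | g \in [:: C_mx a rho; D_mx b; Q_mx; S_mx; V_mx]].

Definition isotropy n (G : set 'M[R]_n) (x : 'cV[R]_n) : set 'M[R]_n :=
  [set g | G g /\ g *m x = x].

Definition Fix n (K : set 'M[R]_n) : set 'cV[R]_n :=
  [set x | forall k, K k -> k *m x = x].

Definition mx_conjugate n (g : 'M[R]_n) (K : set 'M[R]_n) : set 'M[R]_n :=
  [set g *m k *m invmx g | k in K].

Definition conjugacy_class n (G K : set 'M[R]_n) : set (set 'M[R]_n) :=
  [set mx_conjugate g K | g in G].

Definition isotropy_type n (G : set 'M[R]_n) (tau : set (set 'M[R]_n)) : Prop :=
  exists x, tau = conjugacy_class G (isotropy G x).

Definition nontrivial_isotropy_type n (G : set 'M[R]_n)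
    (tau : set (set 'M[R]_n)) : Prop :=
  isotropy_type G tau /\
  forall K, tau K -> K <> [set 1%:M] /\ K <> G.

End Group.

Section Smooth.
Variables (R : realType) (U V : normedModType R).

(* The iterated directional derivative along v_1, ..., v_k. *)
Definition iter_derive (vs : seq U) (f : U -> V) : U -> V :=
  foldr (fun v g => 'D_v g) f vs.

Definition smooth (f : U -> V) : Prop :=
  forall vs : seq U,
    continuous (iter_derive vs f) /\
    forall p v, derivable (iter_derive vs f) p v.

(* The topology of uniform convergence on compact sets of all iterated
   derivatives. The carrier consists of all functions; only the topology that
   it induces on sets of smooth maps is meaningful. *)
Definition all_derivatives (f : U -> V) :
    {ptws seq U -> {family compact, U -> V}} :=
  fun vs => iter_derive vs f.

Definition Cinfty_space : Type := initial_topology all_derivatives.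

HB.instance Definition _ :=
  Topological.copy Cinfty_space (initial_topology all_derivatives).

End Smooth.

Section Bifurcation.
Variables (R : realType) (n : nat).
Implicit Types (G K : set 'M[R]_n) (f : 'cV[R]_n * R^o -> 'cV[R]_n).

Definition V0 G : set (Cinfty_space ('cV[R]_n * R^o)%type 'cV[R]_n) :=
  [set f | [/\ smooth f,
    forall g, G g -> forall (x : 'cV[R]_n) (l : R),
      f (g *m x, l) = g *m f (x, l) &
    forall (l : R) (v : 'cV[R]_n),
      'd (fun x => f (x, l)) (0 : 'cV[R]_n) v = l *: v]].

(* The derivatives at the end point 0 are one-sided. *)
Definition C1_curve (W : normedModType R) (eps : R) (x : R -> W) : Prop :=
  exists dx : R -> W,
    {within `[0, eps[, continuous dx} /\
    forall t, t \in `[0, eps[ ->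
      (s - t)^-1 *: (x s - x t) @[s --> within `[0, eps[ t^'] --> dx t.

Definition zero_branch G f K (eps : R) (x : R -> 'cV[R]_n) (l : R -> R^o) :
    Prop :=
  [/\ 0 < eps, C1_curve eps x, C1_curve eps l, (x 0, l 0) = (0, 0) &
      forall t, t \in `]0, eps[ ->
        [/\ x t != 0, f (x t, l t) = 0 & isotropy G (x t) = K]].

(* mu is an eigenvalue, with eigenvector u + iv, of the complexification of the
   restriction of L to W, where W is a subspace invariant under L. *)
Definition complex_eigenvalue_on (W : set 'cV[R]_n) (L : 'cV[R]_n -> 'cV[R]_n)
    (mu : R[i]) : Prop :=
  exists u v : 'cV[R]_n,
    [/\ W u, W v, (u, v) <> (0, 0),
        L u = complex.Re mu *: u - complex.Im mu *: v &
        L v = complex.Im mu *: u + complex.Re mu *: v].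

(* Since f (., l) maps the linear subspace Fix K to itself, the derivative of
   its restriction is the restriction of its derivative. *)
Definition hyperbolic_within_Fix f K (x : R -> 'cV[R]_n) (l : R -> R^o) : Prop :=
  \forall t \near 0^'+, forall mu : R[i],
    complex_eigenvalue_on (Fix K) ('d (fun y => f (y, l t)) (x t)) mu ->
    complex.Re mu != 0.

Definition generically_symmetry_breaking G (tau : set (set 'M[R]_n)) : Prop :=
  exists U : set (V0 G), [/\ open U, dense U &
    forall phi : V0 G, U phi -> exists K eps x l,
      tau K /\ zero_branch G (set_val phi) K eps x l].

Definition generically_hyperbolic_branching G (tau : set (set 'M[R]_n)) : Prop :=
  exists U : set (V0 G), [/\ open U, dense U &
    forall phi : V0 G, U phi -> exists K eps x l,
      [/\ tau K, zero_branch G (set_val phi) K eps x l &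
          hyperbolic_within_Fix (set_val phi) K x l]].

End Bifurcation.

(* Main.v *)
Require Import Defs.
From HB Require Import structures.
From mathcomp Require Import all_boot all_order all_algebra.
From mathcomp Require Import all_classical all_reals all_analysis.
From mathcomp Require Import complex.
From mathcomp Require Import ring lra zify.

Set Implicit Arguments.
Unset Strict Implicit.
Unset Printing Implicit Defensive.

Import Order.TTheory GRing.Theory Num.Theory.
Import numFieldNormedType.Exports.

Local Open Scope classical_set_scope.
Local Open Scope ring_scope.

(** Write f for a normalized equivariant map and identify R^8 with C^4, so that
    the generators C and D act diagonally with eigenvalues roots of unity, while
    Q, S and V permute the coordinates up to sign and complex conjugation.

    Isotropy. Every group element is C^m D^n Q^i V^j with i < 2 and j < 4
    (normal_form_reduced). Following a fixed vector around the coordinates shows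
    that only torus elements C^m D^n and elements C^m D^n QS can fix a nonzero
    vector (fixed_reflection). A torus element with a fixed vector is trivial, as
    a and b are odd and coprime (torus_fixed), and every involution C^m D^n QS is
    conjugate to QS (reflection_conj). Hence the isotropy group of a nonzero
    vector is trivial or conjugate to {1, QS}, which gives unique_isotropy_type.

    Reduction. The fixed space of QS is four-dimensional, with one real line in
    each complex coordinate, and f maps it to itself. Let T be the third
    derivative of f at the origin and e0, ..., e3 the basis of the fixed space.
    T intertwines the actions of C and D on the coordinates, and because
    rho^2 = -1 modulo a and a > 5 the characters of these actions allow T(e0, e0, ej)
    to have a component along ek only for k = j (no_resonance and weight_vanish). So
    T(e0, e0, ej) = 2 beta_j ej. Since -1 is in the group there are no quadratic
    terms, and with alpha = beta_0 / 3 the restriction of f to the fixed space is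
    h(y, l) = l y + C(y) + higher order terms, where C is a cubic with
    C(e0) = alpha e0 and DC(e0) = diag(beta_j) (reduced_germ).

    Branching. Suppose alpha and all beta_j - alpha with j > 0 are nonzero. In the
    chart y = t (e0 + w - w_0 e0), l = t^2 w_0, the map t^-3 h has a limit as t
    tends to 0 whose zero w = - alpha e0 is nondegenerate; a Newton iteration with the
    derivative of the limit finds a zero for every small t (newton_solution). That
    the zeros form a continuously differentiable curve up to t = 0 follows from the
    estimates that come with the contraction (C1_curve_branch). Along the curve the
    derivative of h is t^2 diag(beta_j - alpha) up to smaller terms, with first
    entry 2 alpha t^2, so it has no eigenvalue on the imaginary axis
    (no_imaginary_eigenvalue and hyperbolic_branch).

    Genericity. The numbers alpha and beta_j are continuous functions of f for the
    topology of smooth convergence on compact sets, so nondegeneracy is open.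
    The map with coordinates z_k |z_k|^2 is equivariant, and adding s times this
    map to f shifts alpha by s and fixes beta_j for j > 0, so
    nondegeneracy is also dense (dense_nondegenerate). *)

(** * Calculus along lines *)

(** Completeness of matrices as normed modules, which the fixed point theorem asks for. *)
HB.instance Definition _ (R : realType) (m n : nat) := Complete.on 'M[R]_(m, n).

Section Calculus.
Variable R : realType.

Lemma mx_norm_entry m n (M : 'M[R]_(m, n)) i j : `|M i j| <= `|M|.
Proof.
rewrite [leRHS]/Num.Def.normr/= mx_normrE.
exact: (le_bigmax _ (fun ij => `|M ij.1 ij.2|) (i, j)).
Qed.

Lemma mx_norm_leP m n (M : 'M[R]_(m, n)) e : 0 <= e ->
  (forall i j, `|M i j| <= e) -> `|M| <= e.
Proof.
by move=> e0 Me; rewrite /Num.Def.normr/= mx_normrE (bigmax_le _ e0)//= => i _.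
Qed.

Section Generic.
Context {U V : normedModType R}.
Implicit Types (f : U -> V) (p v : U).

(** The estimate form of the directional derivative: it includes the point h = 0 and involves
    no division, so that estimates can be composed without filters. *)
Lemma is_deriveP p v f l : is_derive p v f l <->
  forall e, 0 < e -> exists2 d, 0 < d &
    forall h, `|h| < d -> `|f (p + h *: v) - f p - h *: l| <= e * `|h|.
Proof.
have E h : h != 0 -> `|l - h^-1 *: ((f \o shift p) (h *: v) - f p)| =
    `|h|^-1 * `|f (p + h *: v) - f p - h *: l|.
  move=> h0; rewrite -normfV -normrZ distrC -[X in `|_ - X|](scalerK h0).
  by rewrite -scalerBr /= [h *: v + p]addrC.
split=> [[/cvg_ex[/= l' cl] dl] e e0|H].
  have El : l' = l by rewrite -dl; apply/esym/cvg_lim.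
  subst l'; move/cvgrPdist_le : cl => /(_ _ e0).
  move=> /nbhs_ballP[d/= d0 dH]; exists d => // h hd.
  have [->|h0] := eqVneq h 0.
    by rewrite scale0r addr0 subrr scale0r subr0 !normr0 mulr0.
  rewrite -ler_pdivrMr ?normr_gt0// mulrC -E//; apply: dH => //.
  by rewrite /ball/= sub0r normrN.
suff cl : (fun h => h^-1 *: ((f \o shift p) (h *: v) - f p)) @ 0^' --> l.
  by split; [apply/cvg_ex; exists l|apply/cvg_lim].
apply/cvgrPdist_le => e /H[d d0 dH]; near=> h.
have h0 : h != 0 by near: h; exact: nbhs_dnbhs_neq.
rewrite E// ler_pdivrMl ?normr_gt0// mulrC dH//.
by near: h; exact: dnbhs0_lt.
Unshelve. all: by end_near. Qed.

Lemma is_derive_scale p v f l k : is_derive p v f l ->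
  is_derive p (k *: v) f (k *: l).
Proof.
move=> /is_deriveP H; apply/is_deriveP => e e0.
have k1 : 0 < `|k| + 1 by rewrite ltr_wpDl.
have [d d0 dH] := H _ (divr_gt0 e0 k1).
exists (d / (`|k| + 1)) => [|h hd]; first exact: divr_gt0.
rewrite !scalerA; have le_hk : `|h * k| <= `|h| * (`|k| + 1).
  by rewrite normrM ler_wpM2l// lerDl.
apply: (le_trans (dH _ _)).
  by rewrite (le_lt_trans le_hk)// -ltr_pdivlMr.
rewrite mulrAC ler_pdivrMr// -mulrA ler_wpM2l//; exact: ltW.
Qed.

End Generic.

Section Lines.
Context {U V : normedModType R}.
Implicit Types (f : U -> V) (p v : U).

Lemma is_derive_line p v f l t : is_derive (p + t *: v) v f l ->
  is_derive t 1 (fun s : R => f (p + s *: v)) l.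
Proof.
move=> /is_deriveP H; apply/is_deriveP => e /H[d d0 dH].
exists d => // h hd; rewrite [h *: 1]mulr1 scalerDl addrA; exact: dH.
Qed.

Lemma is_derive_lineE p v f t : derivable f (p + t *: v) v ->
  is_derive t 1 (fun s : R => f (p + s *: v)) ('D_v f (p + t *: v)).
Proof. by move=> /derivableP; exact: is_derive_line. Qed.

End Lines.

Lemma is_derive_pow k (s : R) :
  is_derive s 1 (fun s : R => s ^+ k.+1) (k.+1%:R * s ^+ k).
Proof.
split; first exact: exprn_derivable.
by rewrite exp_derive /= /GRing.scale/= mulr1.
Qed.

Section MeanValue.
Variables m n : nat.
Implicit Types phi dphi : R -> 'M[R]_(m, n).

Lemma is_derive_entry (W : normedModType R) (f : W -> 'M[R]_(m, n)) p v l i j :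
  is_derive p v f l -> is_derive p v (fun x => f x i j) (l i j).
Proof.
move=> /is_deriveP H; apply/is_deriveP => e /H[d d0 dH].
exists d => // h hd; apply: le_trans (dH _ hd).
apply: le_trans (mx_norm_entry _ i j); by rewrite !mxE.
Qed.

(** The real mean value theorem applied to each entry of phi t - t *: c; the norm of a matrix
    is the maximum of its entries, so the entrywise bounds give the bound on the norm. *)
Lemma mean_value phi dphi (a b e : R) c : a <= b ->
  (forall t, a <= t <= b -> is_derive t 1 phi (dphi t)) ->
  (forall t, a <= t <= b -> `|dphi t - c| <= e) ->
  `|phi b - phi a - (b - a) *: c| <= e * (b - a).
Proof.
move=> ab der bnd.
have e0 : 0 <= e by apply: le_trans (bnd a _); rewrite ?lexx.
apply: mx_norm_leP => [|i j]; first by rewrite mulr_ge0// subr_ge0.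
pose g := fun t => phi t i j - t * c i j.
have dg t : a <= t <= b -> is_derive t 1 g (dphi t i j - c i j).
  move=> tab; have := is_derive_entry i j (der _ tab) => ?.
  rewrite /g; apply: is_deriveB.
  have := is_deriveZ (c i j) (is_derive_id t 1).
  rewrite [_ *: 1]mulr1; congr is_derive; apply/funext => s /=.
  by rewrite mulrC.
have [t tab E] : exists2 t, t \in `[a, b]%R & g b - g a =
    (dphi t i j - c i j) * (b - a).
  apply: (MVT_segment ab) => [t /[!in_itv]/= /andP[at_ tb]|].
    by apply: dg; rewrite !ltW.
  apply: derivable_within_continuous => t /[!in_itv]/= tab.
  by have [] := dg _ tab.
have -> : (phi b - phi a - (b - a) *: c) i j = g b - g a.
  by rewrite !mxE /g; ring.
rewrite E normrM [`|b - a|]ger0_norm ?subr_ge0// ler_wpM2r ?subr_ge0//.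
apply: le_trans (bnd t tab); have := mx_norm_entry (dphi t - c) i j.
by rewrite !mxE.
Qed.

(** Integrated form of the mean value inequality: an expansion of the derivative at order k
    yields one of the function at order k.+1. This is how the Taylor expansions below are
    obtained, one derivative at a time and without a Taylor formula. *)
Lemma mean_value_pow phi dphi k c (e t : R) : 0 <= t -> phi 0 = 0 ->
  (forall s, 0 <= s <= t -> is_derive s 1 phi (dphi s)) ->
  (forall s, 0 <= s <= t -> `|dphi s - s ^+ k *: c| <= e * s ^+ k) ->
  `|phi t - t ^+ k.+1 *: (k.+1%:R^-1 *: c)| <= e * t ^+ k.+1.
Proof.
move=> t0 phi0 der bnd.
have e0 : 0 <= e * t ^+ k by apply: le_trans (bnd t _); rewrite ?t0 ?lexx.
pose psi s := phi s - s ^+ k.+1 *: (k.+1%:R^-1 *: c).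
have dpsi s : 0 <= s <= t -> is_derive s 1 psi (dphi s - s ^+ k *: c).
  move=> st; apply: is_deriveB; first exact: der.
  have /is_deriveP H' := is_derive_pow k s; apply/is_deriveP => e1 e10.
  have c1 : 0 < `|k.+1%:R^-1 *: c| + 1 by rewrite ltr_wpDl.
  have [d d0 dH] := H' _ (divr_gt0 e10 c1).
  exists d => // h /dH; rewrite [h *: 1]mulr1 => hh.
  have -> : h *: (s ^+ k *: c) =
      (h * (k.+1%:R * s ^+ k)) *: (k.+1%:R^-1 *: c).
    rewrite !scalerA; congr (_ *: _); rewrite -mulrA; congr (_ * _).
    by rewrite mulrAC divff ?mul1r// pnatr_eq0.
  rewrite -!scalerBl normrZ.
  apply: le_trans (ler_wpM2r _ hh) _ => //.
  rewrite mulrAC ler_wpM2r// mulrAC ler_pdivrMr// ler_wpM2l ?(ltW e10)//.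
  by rewrite lerDl.
have := mean_value t0 dpsi (c := 0) (e := e * t ^+ k).
rewrite scaler0 subr0 subr0 /psi phi0 expr0n /= scale0r !subr0 -mulrA -exprSr.
apply=> s /andP[s0 st]; rewrite subr0; apply: le_trans (bnd s _) _.
  by rewrite s0.
have : 0 <= t ^+ k by exact: exprn_ge0.
rewrite le_eqVlt => /predU1P[tk0|tk].
  suff -> : s ^+ k = t ^+ k by [].
  case: k {e0 psi dpsi bnd} tk0 => [|k]; first by rewrite !expr0.
  move=> /esym/eqP; rewrite expf_eq0/= => /eqP tE.
  by have -> : s = t by apply/eqP; rewrite eq_le st tE.
rewrite ler_wpM2l//; first by rewrite -(pmulr_lge0 _ tk).
by rewrite lerXn2r// nnegrE.
Qed.

End MeanValue.
End Calculus.

(** * Directional derivatives of smooth maps *)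

Section Directional.
Local Opaque derive.
Variable R : realType.
Context {U : normedModType R} {m n : nat}.
Implicit Types (f : U -> 'M[R]_(m, n)) (p v w : U).

Lemma zmod_telescope (Z : zmodType) (a b c x y : Z) :
  a - c - (x + y) = (a - b - y) + (b - c - x).
Proof. by rewrite addrACA subrKA -opprD [y + x]addrC. Qed.

(** Additivity in the direction needs continuity of one of the two derivatives: go along v,
    then along w from the displaced point, where the mean value inequality applies. *)
Lemma is_derive_dirD f p v w :
  (forall q, derivable f q v) -> (forall q, derivable f q w) ->
  {for p, continuous ('D_w f)} ->
  is_derive p (v + w) f ('D_v f p + 'D_w f p).
Proof.
move=> fv fw cw; apply/is_deriveP => e e0.
have e20 : 0 < e / 2 by rewrite divr_gt0.
have [d1 d10 H1] := (is_deriveP _ _ _ _).1 (derivableP (fv p)) _ e20.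
move: cw => /cvgrPdistC_le/(_ _ e20)/nbhs_ballP[d2/= d20 H2].
have N0 : 0 < `|v| + `|w| + 1 by rewrite ltr_wpDl// addr_ge0.
exists (Num.min d1 (d2 / (`|v| + `|w| + 1))).
  by rewrite lt_min d10 divr_gt0.
move=> h; rewrite lt_min => /andP[hd1 hd2].
have := H1 h hd1; set X := (X in `|X| <= _) => HX.
pose phi s := f (p + h *: v + s *: (h *: w)).
pose dphi s := h *: 'D_w f (p + h *: v + s *: (h *: w)).
have : `|phi 1 - phi 0 - (1 - 0) *: (h *: 'D_w f p)| <= e / 2 * `|h| * (1 - 0).
  apply: (@mean_value R m n phi dphi 0 1 _ _ ler01) => t /andP[t0 t1].
    by apply: is_derive_line; apply: is_derive_scale; apply/derivableP; exact: fw.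
  rewrite -scalerBr normrZ mulrC ler_wpM2r//; apply: H2.
  rewrite -ball_normE /ball_/= opprD addrA opprD addrA subrr add0r -opprD normrN.
  apply: le_lt_trans (ler_normD _ _) _.
  rewrite !normrZ mulrCA -mulrDr.
  move: hd2; rewrite ltr_pdivlMr// => /(le_lt_trans _); apply.
  rewrite ler_wpM2l// ler_wpDr// lerD2l ger0_norm//.
  by rewrite ler_piMl.
rewrite subr0 scale1r mulr1; set Y := (X in `|X| <= _) => HY.
have -> : f (p + h *: (v + w)) - f p - h *: ('D_v f p + 'D_w f p) = Y + X.
  rewrite /Y /X /phi scale0r scale1r addr0 scalerDr addrA.
  rewrite scalerDr; exact: zmod_telescope.
apply: le_trans (ler_normD _ _) _.
have -> : e * `|h| = e / 2 * `|h| + e / 2 * `|h| by rewrite -mulrDl -splitr. 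
exact: (lerD HY HX).
Qed.

Section SmoothGeneric.
Variables (f : U -> 'M[R]_(m, n)).
Hypothesis sf : smooth f.

Lemma smooth_derive v : smooth ('D_v f).
Proof.
move=> vs; have := sf (rcons vs v).
by rewrite /iter_derive foldr_rcons.
Qed.

Lemma smooth_continuous : continuous f.
Proof. by have [] := sf [::]. Qed.

Lemma smooth_derivable p v : derivable f p v.
Proof. by have [_ ] := sf [::]; exact. Qed.

End SmoothGeneric.

Lemma smooth_deriveD f p v w : smooth f ->
  'D_(v + w) f p = 'D_v f p + 'D_w f p.
Proof.
move=> sf; apply: derive_val; apply: is_derive_dirD.
- by move=> q; exact: smooth_derivable.
- by move=> q; exact: smooth_derivable.
- exact: (smooth_continuous (smooth_derive sf w)).
Qed.

Lemma smooth_deriveZ f p (k : R) v : smooth f -> 'D_(k *: v) f p = k *: 'D_v f p.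
Proof.
move=> sf; apply: derive_val; apply: is_derive_scale.
exact/derivableP/smooth_derivable.
Qed.

Lemma smooth_derive_sum f p (I : Type) (r : seq I) (c : I -> R) (v : I -> U) :
  smooth f ->
  'D_(\sum_(i <- r) c i *: v i) f p = \sum_(i <- r) c i *: 'D_(v i) f p.
Proof.
move=> sf; elim: r => [|i r IH]; first by rewrite !big_nil derive0.
by rewrite !big_cons smooth_deriveD// smooth_deriveZ// IH.
Qed.

End Directional.

Arguments smooth_continuous {R U m n f} sf x [t] _.
Arguments smooth_derive {R U m n f} sf v vs.

(** * Smooth maps on the product of the state space and the parameter line *)

Section SumLimits.
Context {K : numFieldType} {W : normedModType K} {T : Type}.

Lemma cvg_bigsum (F : set_system T) (FF : Filter F) (I : Type) (r : seq I)
    (f : I -> T -> W) (l : I -> W) :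
  (forall i, f i @ F --> l i) ->
  (fun x => \sum_(i <- r) f i x) @ F --> \sum_(i <- r) l i.
Proof.
move=> fl; elim: r => [|i r IH].
  rewrite big_nil; under eq_fun do rewrite big_nil; exact: cvg_cst.
rewrite big_cons; under eq_fun do rewrite big_cons.
exact: (cvgD (fl i) IH).
Qed.

End SumLimits.

Section Lincomb.
Variables (R : realType) (U W : normedModType R).

Lemma is_derive_lincomb (I : Type) (r : seq I) (c : I -> R)
    (g : I -> U -> W) (dg : I -> W) p v :
  (forall i, is_derive p v (g i) (dg i)) ->
  is_derive p v (fun x => \sum_(i <- r) c i *: g i x)
    (\sum_(i <- r) c i *: dg i).
Proof.
move=> H; elim: r => [|i r IH].
  rewrite big_nil; under eq_fun do rewrite big_nil; exact: is_derive_cst.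
rewrite big_cons; under eq_fun do rewrite big_cons.
exact: (is_deriveD (is_deriveZ (c i) (H i)) IH).
Qed.

End Lincomb.

Section ParameterSpace.
Variable R : realType.
Context {m k l : nat}.
Local Opaque derive.
Local Notation U := ('cV[R]_m * R^o)%type.
Implicit Types (f g : U -> 'M[R]_(k, l)) (p q v w : U).

(* The coordinate frame of U: the parameter direction has index 0 and the
   i-th state direction has index i + 1. *)
Definition axis (i : 'I_m) : U := (delta_mx i 0, 0).
Definition par : U := (0, 1).
Definition frame (i : 'I_m.+1) : U :=
  if unlift ord0 i is Some j then axis j else par.
Definition coord (i : 'I_m.+1) (p : U) : R :=
  if unlift ord0 i is Some j then p.1 j 0 else p.2.

Lemma frame_expand p : p = \sum_i coord i p *: frame i.
Proof.
rewrite big_ord_recl /coord /frame unlift_none.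
under eq_bigr do rewrite liftK.
case: p => x a; apply/pair_equal_spec; split => /=.
  rewrite (big_morph fst (id1 := 0) (op1 := +%R))//= scaler0 add0r.
  by rewrite [LHS]matrix_sum_delta; apply: eq_bigr => i _; rewrite big_ord1.
rewrite (big_morph snd (id1 := 0) (op1 := +%R))//= big1 => [|i _].
  by rewrite addr0 /GRing.scale/= mulr1.
exact: scaler0.
Qed.

Lemma derive_expand f p v : smooth f ->
  'D_v f p = \sum_i coord i v *: 'D_(frame i) f p.
Proof.
by move=> sf; rewrite [in LHS](frame_expand v) smooth_derive_sum.
Qed.

Lemma norm_fst p : `|p.1| <= `|p|.
Proof. by rewrite prod_normE le_max lexx. Qed.

Lemma norm_snd p : `|p.2| <= `|p|.
Proof. by rewrite prod_normE le_max lexx orbT. Qed.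

Lemma norm_coord i p : `|coord i p| <= `|p|.
Proof.
rewrite /coord; case: unlift => [j|]; last exact: norm_snd.
exact: le_trans (mx_norm_entry _ _ _) (norm_fst p).
Qed.

Lemma coord_cvg i p : coord i @ p --> coord i p.
Proof.
case: p => x a; rewrite /coord; case: unlift => [j|]; last exact: cvg_snd.
have c0 : (fun M : 'cV[R]_m => M j 0) @ x --> x j 0 by exact: coord_continuous.
have cfst : (fun y : U => y.1) @ (x, a) --> x by exact: cvg_fst.
exact: (cvg_comp _ _ cfst c0).
Qed.

(** Joint continuity in the point and the direction, from the expansion in the coordinate frame. *)
Lemma derive_continuous_joint f q v : smooth f ->
  'D_z.2 f z.1 @[z --> (q, v)] --> 'D_v f q.
Proof.
move=> sf; rewrite (derive_expand _ _ sf).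
under eq_fun do rewrite (derive_expand _ _ sf).
have cfst : (fun y : U * U => y.1) @ (q, v) --> q by exact: cvg_fst.
have csnd : (fun y : U * U => y.2) @ (q, v) --> v by exact: cvg_snd.
have cD w : 'D_w f y.1 @[y --> (q, v)] --> 'D_w f q.
  exact: (cvg_comp _ _ cfst (smooth_continuous (smooth_derive sf w) q)).
apply: cvg_bigsum => i; apply: (cvgZ _ (cD (frame i))).
exact: (cvg_comp _ _ csnd (@coord_cvg i v)).
Qed.

Lemma derive2_expand f p v w : smooth f ->
  'D_w ('D_v f) p = \sum_i coord i v *: 'D_w ('D_(frame i) f) p.
Proof.
move=> sf; have H F : F = (fun p => \sum_i coord i v *: 'D_(frame i) f p) ->
    'D_w F p = \sum_i coord i v *: 'D_w ('D_(frame i) f) p.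
  move=> ->; apply: derive_val; apply: is_derive_lincomb => i.
  by apply: derivableP; exact: (smooth_derivable (smooth_derive sf _)).
by apply: H; apply/funext => x; exact: derive_expand.
Qed.

Lemma derive2_continuous_joint f q v : smooth f ->
  'D_z.2 ('D_z.2 f) z.1 @[z --> (q, v)] --> 'D_v ('D_v f) q.
Proof.
move=> sf; rewrite [X in _ --> X](derive2_expand q v v sf).
under eq_fun => z do rewrite (derive2_expand z.1 z.2 z.2 sf).
have csnd : (fun y : U * U => y.2) @ (q, v) --> v by exact: cvg_snd.
apply: cvg_bigsum => i.
apply: cvgZ; first exact: (cvg_comp _ _ csnd (@coord_cvg i v)).
by apply: derive_continuous_joint; exact: smooth_derive.
Qed.

(** The derivative is a combination of finitely many continuous partial derivatives, whose
    coefficients are bounded by the norm of the direction. *)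
Lemma derive_uniform f p (e : R) : smooth f -> 0 < e ->
  exists2 d, 0 < d & forall q v, `|q - p| < d ->
    `|'D_v f q - 'D_v f p| <= e * `|v|.
Proof.
move=> sf e0; have e'0 : 0 < e / m.+1%:R by rewrite divr_gt0.
have near_dir v : \forall q \near p, `|'D_v f q - 'D_v f p| <= e / m.+1%:R.
  have c : 'D_v f q @[q --> p] --> 'D_v f p.
    exact: (smooth_continuous (smooth_derive sf v) p).
  by move: c => /cvgrPdistC_le/(_ _ e'0).
have near_axes : \forall q \near p, forall i,
    `|'D_(frame i) f q - 'D_(frame i) f p| <= e / m.+1%:R.
  exact: (@filter_forall U _ (fun i q => `|'D_(frame i) f q - 'D_(frame i) f p|
    <= e / m.+1%:R) (nbhs p) _ (fun i => near_dir (frame i))).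
have /nbhs_ballP[d/= d0 H] := near_axes.
exists d => // q v qd.
have Ha : forall i, `|'D_(frame i) f q - 'D_(frame i) f p| <= e / m.+1%:R.
  by apply: H; rewrite -ball_normE /ball_/= distrC.
rewrite !(derive_expand _ v sf) -sumrB.
apply: le_trans (ler_norm_sum _ _ _) _.
apply: (@le_trans _ _ (\sum_(i < m.+1) e / m.+1%:R * `|v|)).
  apply: ler_sum => i _; rewrite -scalerBr normrZ mulrC.
  by apply: ler_pM => //; exact: norm_coord.
by rewrite sumr_const card_ord -[leLHS]mulr_natr mulrAC divfK ?pnatr_eq0.
Qed.

(** A smooth map is Frechet differentiable: along each segment the mean value inequality
    compares the increment with the derivative at the base point, uniformly in the direction. *)
Lemma smooth_frechet f p (e : R) : smooth f -> 0 < e ->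
  exists2 d, 0 < d & forall v, `|v| < d ->
    `|f (p + v) - f p - 'D_v f p| <= e * `|v|.
Proof.
move=> sf e0; have [d d0 H] := derive_uniform p sf e0.
exists d => // v vd.
pose phi t := f (p + t *: v); pose dphi t := 'D_v f (p + t *: v).
have : `|phi 1 - phi 0 - (1 - 0) *: 'D_v f p| <= e * `|v| * (1 - 0).
  apply: (@mean_value R k l phi dphi 0 1 _ _ ler01) => t /andP[t0 t1].
    by apply: is_derive_lineE; exact: smooth_derivable.
  apply: H; rewrite addrC addKr normrZ; apply: le_lt_trans vd.
  by rewrite ger0_norm// ler_piMl.
by rewrite /phi subr0 scale1r scale0r addr0 mulr1 scale1r.
Qed.

End ParameterSpace.

Arguments axis {R m}.
Arguments par {R m}.
Arguments frame {R m}.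
Arguments coord {R m}.

(** * Asymptotics of cubic germs *)

Section Branching.
Variables (R : realType) (m : nat).
Local Opaque derive.
Local Notation V := 'cV[R]_m.+1.
Local Notation U := (V * R^o)%type.

Definition unitv (j : 'I_m.+1) : V := delta_mx j 0.
Local Notation e0 := (unitv ord0).

Lemma norm_unitv j : `|unitv j| <= 1.
Proof.
apply: mx_norm_leP => // i k; rewrite mxE.
by case: (_ && _); rewrite ?normr1 ?normr0.
Qed.

(** A jointly continuous function of a point and a direction stays near its value at the
    origin along all rays whose direction is close to v0, uniformly in the parameter. *)
Lemma ray_joint_limit k l (G : U * U -> 'M[R]_(k, l)) (v0 : V) L (e : R) :
  G z @[z --> ((0, 0), (v0, 0))] --> L -> `|v0| <= 1 -> 0 < e ->
  exists2 d, 0 < d & forall s v a, 0 <= s < d -> `|v - v0| < d -> `|a| < d ->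
    `|G ((0, a) + s *: (v, 0), (v, 0)) - L| <= e.
Proof.
move=> GL v01 e_gt0.
move: GL => /cvgrPdistC_le/(_ _ e_gt0)/nbhs_ballP[d/= d0 H].
exists (Num.min 1 (d / 2)) => [|s v a]; first by rewrite lt_min ltr01 divr_gt0.
rewrite !lt_min => /and3P[s0 s1 sd] /andP[v1 vd] /andP[a1 ad].
have d2 : d / 2 < d by rewrite ltr_pdivrMr// ltr_pMr// ltr1n.
have vn : `|v| <= 2.
  rewrite -(subrK v0 v); apply: le_trans (ler_normD _ _) _.
  have -> : 2 = 1 + 1 :> R by [].
  by rewrite lerD// ltW.
apply: H; rewrite -ball_normE /ball_/=.
have -> : ((0, 0), (v0, 0)) - ((0, a) + s *: (v, 0), (v, 0)) =
    ((- (s *: v), - a), (v0 - v, 0)) :> U * U.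
  apply/pair_equal_spec; split => /=; apply/pair_equal_spec; split;
    by rewrite /= 5?(scaler0, add0r, addr0, subr0, oppr0).
rewrite prod_normE/= !prod_normE/= !gt_max !normrN normr0 d0 andbT.
rewrite (lt_trans ad d2) distrC (lt_trans vd d2) !andbT.
rewrite normrZ (ger0_norm s0); apply: (@le_lt_trans _ _ (s * 2)).
  by rewrite ler_wpM2l.
by rewrite -ltr_pdivlMr.
Qed.

(** The normal form h(y, a) = a y + C(y) + higher order terms with a cubic C such that
    C(e0) = alpha e0 and DC(e0) is diagonal with entries beta j. The entry for e0 is 3 alpha
    by the Euler identity for the homogeneous map C. The third derivatives of h are twice the
    derivative of C, whence the factor 2 in germ_cubic. *)
Record cubic_germ (h : U -> V) (alpha : R) (beta : 'I_m.+1 -> R) : Prop :=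
  CubicGerm {
    germ_smooth : smooth h;
    germ_zero : forall a, h (0, a) = 0;
    germ_linear : forall a v, 'D_(v, 0) h (0, a) = a *: v;
    germ_quadratic : forall a v w, 'D_(v, 0) ('D_(w, 0) h) (0, a) = 0;
    germ_cubic : forall j,
      'D_(e0, 0) ('D_(e0, 0) ('D_(unitv j, 0) h)) (0, 0) =
      (2 * beta j) *: unitv j;
    germ_beta0 : beta ord0 = 3 * alpha }.

Variables (h : U -> V) (alpha : R) (beta : 'I_m.+1 -> R).
Hypothesis hg : cubic_germ h alpha beta.
Let sh := germ_smooth hg.
Let h_0 := germ_zero hg.
Let h_1 := germ_linear hg.
Let h_2 := germ_quadratic hg.
Let h_3 := germ_cubic hg.
Let beta0 := germ_beta0 hg.

Lemma rayE (a s : R) (v : V) : (0, a) + s *: (v, 0) = (s *: v, a) :> U.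
Proof. apply/pair_equal_spec; split; by rewrite /= 5?(scaler0, add0r, addr0). Qed.

(** Two integrations of the third derivative along the ray through v, starting from the linear
    and quadratic terms of the germ at the trivial zero. *)
Lemma jacobian_expansion j (e : R) : 0 < e -> exists2 d, 0 < d &
  forall t v a, 0 <= t < d -> `|v - e0| < d -> `|a| < d ->
  `|'D_(unitv j, 0) h (t *: v, a) - a *: unitv j -
    t ^+ 2 *: (beta j *: unitv j)| <= e * t ^+ 2.
Proof.
move=> e_gt0; pose g := 'D_(unitv j, 0) h.
have sg : smooth g by exact: smooth_derive.
have [d d0 H] := ray_joint_limit
  (@derive2_continuous_joint _ _ _ _ g (0, 0) (e0, 0) sg) (norm_unitv _) e_gt0.
exists d => // t v a /andP[t0 td] vd ad.
have sd s : 0 <= s <= t -> 0 <= s < d.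
  by move=> /andP[s0 st]; rewrite s0 (le_lt_trans st td).
pose psi s := 'D_(v, 0) g ((0, a) + s *: (v, 0)).
have bpsi s : 0 <= s <= t ->
    `|psi s - s ^+ 1 *: (1%:R^-1 *: ((2 * beta j) *: unitv j))| <= e * s ^+ 1.
  move=> st; have s0 : 0 <= s by case/andP: st.
  apply: (@mean_value_pow R m.+1 1 psi
     (fun s => 'D_(v, 0) ('D_(v, 0) g) ((0, a) + s *: (v, 0))) 0 _ e s s0).
  - by rewrite /psi scale0r addr0; exact: h_2.
  - move=> r _; apply: is_derive_lineE.
    exact: (smooth_derivable (smooth_derive sg _)).
  - move=> r /andP[r0 rs]; rewrite expr0 scale1r mulr1 -h_3.
    apply: H => //; apply: sd; rewrite r0/=.
    by apply: le_trans rs _; case/andP: st.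
pose phi s := g ((0, a) + s *: (v, 0)) - a *: unitv j.
have E : 1.+1%:R^-1 *: (1%:R^-1 *: ((2 * beta j) *: unitv j)) =
    beta j *: unitv j :> V.
  by rewrite invr1 scale1r scalerA mulKf// pnatr_eq0.
suff : `|phi t - t ^+ 2 *: (beta j *: unitv j)| <= e * t ^+ 2.
  by rewrite /phi rayE.
rewrite -E; apply: (@mean_value_pow R m.+1 1 phi psi 1 _ e t t0).
- by rewrite /phi scale0r addr0 /g h_1 subrr.
- move=> s _; rewrite -[psi s]subr0; apply: is_deriveB.
  by apply: is_derive_lineE; exact: (smooth_derivable sg).
- exact: bpsi.
Qed.

(** Integration of the expansion of the derivative along e0; the coefficient alpha is a third of
    the one in beta. *)
Lemma value_expansion (e : R) : 0 < e -> exists2 d, 0 < d &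
  forall t a, 0 <= t < d -> `|a| < d ->
  `|h (t *: e0, a) - (t * a) *: e0 - t ^+ 3 *: (alpha *: e0)| <= e * t ^+ 3.
Proof.
move=> e_gt0; have [d d0 H] := jacobian_expansion ord0 e_gt0.
exists d => // t a /andP[t0 td] ad.
pose phi s := h ((0, a) + s *: (e0, 0)) - s *: (a *: e0).
have E : 2.+1%:R^-1 *: (beta 0 *: e0) = alpha *: e0 :> V.
  by rewrite beta0 scalerA mulKf// pnatr_eq0.
suff : `|phi t - t ^+ 3 *: (alpha *: e0)| <= e * t ^+ 3.
  by rewrite /phi rayE scalerA.
rewrite -E; apply: (@mean_value_pow R m.+1 1 phi
  (fun s => 'D_(e0, 0) h ((0, a) + s *: (e0, 0)) - a *: e0) 2 _ e t t0).
- by rewrite /phi !scale0r addr0 h_0 subrr.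
- move=> s _; apply: is_deriveB.
    by apply: is_derive_lineE; exact: (smooth_derivable sh).
  have /is_deriveP D := is_derive_id s (1 : R).
  apply/is_deriveP => e1 e10; exists 1 => // r _.
  rewrite [r *: 1]mulr1 -!scalerBl addrAC addrK subrr scale0r normr0.
  by rewrite mulr_ge0// ltW.
- move=> s /andP[s0 st]; rewrite rayE; apply: H => //.
  + by rewrite s0 (le_lt_trans st td).
  + by rewrite subrr normr0.
Qed.

Lemma derive_par_0 a : 'D_par h (0, a) = 0.
Proof.
apply: derive_val; apply/is_deriveP => e e_gt0; exists 1 => // s _.
have -> : (0, a) + s *: par = (0, a + s) :> U.
  by apply/pair_equal_spec; split; rewrite /= ?scaler0 ?addr0// [s *: 1]mulr1.
by rewrite !h_0 scaler0 !subr0 normr0 mulr_ge0// ltW.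
Qed.

(** The mixed derivative is the derivative of a |-> a e0. Without symmetry of second derivatives,
    it is read off from the second difference h(t e0, t) - h(t e0, 0), which is computed
    both from value_expansion and by integrating first in the parameter and then in t. *)
Lemma derive_mixed : 'D_(e0, 0) ('D_par h) (0, 0) = e0.
Proof.
set c := LHS; have sp : smooth ('D_par h) by exact: smooth_derive.
suff H e : 0 < e -> `|c - e0| <= 3 * e.
  apply/eqP; rewrite -subr_eq0 -normr_le0; apply/ler_addgt0Pr => e e_gt0.
  have := H (e / 3); rewrite divr_gt0// add0r => /(_ isT) cE.
  by rewrite (le_trans cE)// mulrC divfK// pnatr_eq0.
move=> e_gt0; have [d1 d10 H1] := value_expansion e_gt0.
have [d2 d20 H2] : exists2 d, 0 < d & forall s v a, 0 <= s < d ->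
    `|v - e0| < d -> `|a| < d ->
    `|'D_(v, 0) ('D_par h) ((0, a) + s *: (v, 0)) - c| <= e.
  apply: (@ray_joint_limit _ _ (fun z : U * U => 'D_z.2 ('D_par h) z.1) e0 c e
    (@derive_continuous_joint _ _ _ _ _ (0, 0) (e0, 0) sp) (norm_unitv _) e_gt0).
pose t := Num.min (1 / 2) (Num.min (d1 / 2) (d2 / 2)).
have t0 : 0 < t by rewrite !lt_min !divr_gt0.
have t1 : t <= 1 by rewrite ge_min ler_pdivrMr// mul1r ler1n.
have td1 : t < d1.
  apply: (@le_lt_trans _ _ (d1 / 2)); first by rewrite !ge_min lexx orbT.
  by rewrite ltr_pdivrMr// ltr_pMr// ltr1n.
have td2 : t < d2.
  apply: (@le_lt_trans _ _ (d2 / 2)); first by rewrite !ge_min lexx !orbT.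
  by rewrite ltr_pdivrMr// ltr_pMr// ltr1n.
have tt : 0 <= t by exact: ltW.
have Dpar a : 0 <= a <= t ->
    `|'D_par h ((t *: e0, 0) + a *: par) - t *: c| <= e * t.
  move=> /andP[a0 at_].
  have -> : (t *: e0, 0) + a *: par = (0, a) + t *: (e0, 0) :> U.
    apply/pair_equal_spec; split => /=; rewrite ?scaler0 ?addr0 ?add0r//.
    by rewrite [a *: 1]mulr1.
  have := @mean_value_pow R m.+1 1 (fun s => 'D_par h ((0, a) + s *: (e0, 0)))
    (fun s => 'D_(e0, 0) ('D_par h) ((0, a) + s *: (e0, 0))) 0 c e t tt.
  rewrite invr1 scale1r expr1; apply.
  - by rewrite scale0r addr0 derive_par_0.
  - by move=> s _; apply: is_derive_lineE; exact: (smooth_derivable sp).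
  - move=> s /andP[s0 st]; rewrite expr0 ?scale1r mulr1; apply: H2.
    + by rewrite s0 (le_lt_trans st td2).
    + by rewrite subrr normr0.
    + by rewrite ger0_norm// (le_lt_trans at_ td2).
have Q : `|h (t *: e0, t) - h (t *: e0, 0) - t *: (t *: c)| <= e * t * t.
  have := @mean_value R m.+1 1 (fun a => h ((t *: e0, 0) + a *: par))
    (fun a => 'D_par h ((t *: e0, 0) + a *: par)) 0 t (e * t) (t *: c) tt.
  rewrite scale0r addr0 subr0.
  have -> : (t *: e0, 0) + t *: par = (t *: e0, t) :> U.
    by apply/pair_equal_spec; split; rewrite /= ?scaler0 ?addr0 ?add0r//
      [t *: 1]mulr1.
  apply=> [a _|a at_]; last exact: Dpar.
  by apply: is_derive_lineE; exact: (smooth_derivable sh).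
have P1 := H1 t t; have P2 := H1 t 0.
rewrite !tt td1 !(ger0_norm tt) td1 normr0 d10 mulr0 scale0r subr0 in P1 P2.
have {}P1 := P1 isT isT; have {}P2 := P2 isT isT.
move: P1 P2 Q.
set x := h (t *: e0, t); set y := h (t *: e0, 0).
set w := t ^+ 3 *: _ => P1 P2 Q.
have E : (t * t) *: (c - e0) = (x - (t * t) *: e0 - w) - (y - w)
    - (x - y - t *: (t *: c)).
  by rewrite scalerBr scalerA; apply/matrixP => i j; rewrite !mxE; ring.
have t20 : 0 < t * t by rewrite mulr_gt0.
rewrite -(ler_pM2l t20) -[X in X * `|_|](ger0_norm (ltW t20)) -normrZ E.
apply: le_trans (ler_normB _ _) _.
apply: le_trans (lerD (ler_normB _ _) Q) _.
apply: le_trans (lerD (lerD P1 P2) (lexx _)) _.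
have t3 : t ^+ 3 <= t * t by rewrite exprS expr2 ler_piMl// ltW.
have : e * t ^+ 3 <= e * (t * t) by rewrite ler_pM2l.
lra.
Qed.

(** Integration of the mixed derivative along the ray through v. *)
Lemma parameter_expansion (e : R) : 0 < e -> exists2 d, 0 < d &
  forall t v a, 0 <= t < d -> `|v - e0| < d -> `|a| < d ->
  `|'D_par h (t *: v, a) - t *: e0| <= e * t.
Proof.
move=> e_gt0; have sp : smooth ('D_par h) by exact: smooth_derive.
have [d d0 H] : exists2 d, 0 < d & forall s v a, 0 <= s < d ->
    `|v - e0| < d -> `|a| < d ->
    `|'D_(v, 0) ('D_par h) ((0, a) + s *: (v, 0)) - e0| <= e.
  have H := @ray_joint_limit _ _ (fun z : U * U => 'D_z.2 ('D_par h) z.1) e0 _ e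
    (@derive_continuous_joint _ _ _ _ _ (0, 0) (e0, 0) sp) (norm_unitv _) e_gt0.
  by rewrite /= derive_mixed in H.
exists d => // t v a /andP[t0 td] vd ad.
pose phi s := 'D_par h ((0, a) + s *: (v, 0)).
have E : t ^+ 1 *: (1%:R^-1 *: e0) = t *: e0 :> V by rewrite invr1 scale1r expr1.
suff : `|phi t - t *: e0| <= e * t ^+ 1 by rewrite /phi rayE expr1.
rewrite -E; apply: (@mean_value_pow R m.+1 1 phi
  (fun s => 'D_(v, 0) ('D_par h) ((0, a) + s *: (v, 0))) 0 e0 e t t0).
- by rewrite /phi scale0r addr0 derive_par_0.
- by move=> s _; apply: is_derive_lineE; exact: (smooth_derivable sp).
- move=> s /andP[s0 st]; rewrite expr0 ?scale1r mulr1; apply: H => //.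
  by rewrite s0 (le_lt_trans st td).
Qed.

End Branching.

(** * Rescaling and Newton iteration *)

Section Rescaling.
Variables (R : realType) (m : nat).
Local Opaque derive.
Local Notation V := 'cV[R]_m.+1.
Local Notation U := (V * R^o)%type.
Local Notation e0 := (@unitv R m ord0).
Variables (h : U -> V) (alpha : R) (beta : 'I_m.+1 -> R).
Hypothesis hg : cubic_germ h alpha beta.
Hypothesis nondeg : forall j, j != ord0 -> beta j != alpha.
Let sh := germ_smooth hg.

Definition transverse (w : V) : V := w - w ord0 0 *: e0.
(** The blow-up chart y = t (e0 + w - w_0 e0), a = t^2 w_0: the e0-coordinate of w carries the
    rescaled parameter and the other coordinates carry the transverse part of the state. *)
Definition scaled_point (t : R) (w : V) : U :=
  (t *: (e0 + transverse w), t ^+ 2 * w ord0 0).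
Definition scaled_dir (j : 'I_m.+1) : U :=
  if j == ord0 then par else (unitv R j, 0).
(** Derivatives of h in the parameter have size t, those in the state have size t^2. *)
Definition scaled_coef (t : R) (j : 'I_m.+1) : R :=
  if j == ord0 then t^-1 else (t ^+ 2)^-1.
Definition scaled_col (p : U) (t : R) (j : 'I_m.+1) : V :=
  scaled_coef t j *: 'D_(scaled_dir j) h p.
(** Up to t^-3 this is the derivative of h in the coordinates w of the chart. *)
Definition scaled_jacobian (p : U) (t : R) (q : V) : V :=
  \sum_j q j 0 *: scaled_col p t j.
Definition limit_coef (j : 'I_m.+1) : R :=
  if j == ord0 then 1 else beta j - alpha.
(** The zero of the limit problem: w_0 = - alpha with vanishing transverse part. *)
Definition limit_point : V := - alpha *: e0.

Lemma unitv_entry (j i : 'I_m.+1) : unitv R j i 0 = (i == j)%:R :> R.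
Proof. by rewrite mxE andbT. Qed.

Lemma transverse_entry w j :
  transverse w j 0 = if j == ord0 then 0 else w j 0.
Proof.
rewrite !mxE andbT; have [->|_] := eqVneq j ord0; first by rewrite mulr1 subrr.
by rewrite mulr0 subr0.
Qed.

Lemma transverse_linear a (w q : V) :
  transverse (w + a *: q) = transverse w + a *: transverse q.
Proof.
apply/matrixP => i j; rewrite ord1 !mxE; ring.
Qed.

Lemma norm_transverse w : `|transverse w| <= `|w|.
Proof.
apply: mx_norm_leP => // i j; rewrite ord1 transverse_entry.
by case: ifP => _; rewrite ?normr0// mx_norm_entry.
Qed.

Lemma transverse_e0 a : transverse (a *: e0) = 0.
Proof.
apply/matrixP => i j; rewrite ord1 transverse_entry !mxE andbT.
by case: eqVneq => //; rewrite mulr0.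
Qed.

Lemma transverse_sum q :
  transverse q = \sum_(j | j != ord0) q j 0 *: unitv R j.
Proof.
apply/matrixP => i j; rewrite ord1 transverse_entry summxE.
have [->|i0] := eqVneq i ord0.
  rewrite big1// => k k0; rewrite mxE unitv_entry eq_sym (negbTE k0) mulr0//.
rewrite (bigD1 i)//= mxE unitv_entry eqxx mulr1 big1 ?addr0// => k /andP[_ ki].
by rewrite mxE unitv_entry eq_sym (negbTE ki) mulr0.
Qed.

Lemma scaled_direction t q : t != 0 -> (t *: transverse q, t ^+ 2 * q ord0 0) =
  \sum_j (t ^+ 3 * (q j 0 * scaled_coef t j)) *: scaled_dir j :> U.
Proof.
move=> t0; rewrite (bigD1 ord0)//= /scaled_dir /scaled_coef eqxx.
apply/pair_equal_spec; split => /=.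
  rewrite scaler0 add0r (big_morph fst (id1 := 0) (op1 := +%R))//.
  rewrite transverse_sum scaler_sumr; apply: eq_bigr => j /negbTE ->/=.
  by rewrite scalerA; congr (_ *: _); field.
rewrite (big_morph snd (id1 := 0) (op1 := +%R))// big1 => [|j /negbTE ->/=].
  rewrite addr0 [_ *: 1]mulr1; by field.
exact: scaler0.
Qed.

Lemma scaled_jacobianE p t q : t != 0 ->
  'D_(t *: transverse q, t ^+ 2 * q ord0 0) h p = t ^+ 3 *: scaled_jacobian p t q.
Proof.
move=> t0; rewrite scaled_direction// smooth_derive_sum//.
rewrite /scaled_jacobian scaler_sumr; apply: eq_bigr => j _.
by rewrite /scaled_col !scalerA !mulrA.
Qed.

Lemma scaled_point_line t w s q : scaled_point t (w + s *: q) =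
  scaled_point t w + s *: (t *: transverse q, t ^+ 2 * q ord0 0).
Proof.
rewrite /scaled_point transverse_linear; apply/pair_equal_spec; split => /=.
  by rewrite addrA scalerDr !scalerA mulrC.
by rewrite !mxE [s *: _]mulrCA mulrDr.
Qed.

Lemma limit_point0 : limit_point ord0 0 = - alpha.
Proof. by rewrite /limit_point mxE unitv_entry eqxx mulr1. Qed.

Lemma limit_coef_neq0 j : limit_coef j != 0.
Proof.
rewrite /limit_coef; case: (eqVneq j ord0) => [_|j0]; first exact: oner_neq0.
by rewrite subr_eq0 nondeg.
Qed.

Lemma scaled_point_near (b : R) : 0 < b -> exists2 d, 0 < d & forall t w,
  0 < t < d -> `|w - limit_point| < d ->
  [/\ t < b, `|e0 + transverse w - e0| < b, `|t ^+ 2 * w ord0 0| < b &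
      `|w ord0 0 + alpha| < b].
Proof.
move=> b0; have a1 : 0 < `|alpha| + 1 by rewrite ltr_wpDl.
exists (Num.min 1 (b / (`|alpha| + 1))) => [|t w].
  by rewrite lt_min ltr01 divr_gt0.
have bb : b / (`|alpha| + 1) <= b.
  by rewrite ler_pdivrMr// ler_peMr ?lerDr// ltW.
rewrite !lt_min => /and3P[t0 t1 ta] /andP[w1 wa].
have wb := lt_le_trans wa bb.
have w0 : `|w ord0 0 + alpha| <= `|w - limit_point|.
  have <- : (w - limit_point) ord0 0 = w ord0 0 + alpha.
    by rewrite mxE [X in _ + X = _]mxE limit_point0 opprK.
  exact: mx_norm_entry.
split; last exact: le_lt_trans w0 wb.
- exact: lt_le_trans ta bb.
- apply: le_lt_trans wb; rewrite addrC addKr.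
  apply: le_trans _ (norm_transverse _).
  suff -> : transverse (w - limit_point) = transverse w by [].
  by rewrite -[- limit_point]scaleN1r transverse_linear transverse_e0 scaler0 addr0.
- rewrite normrM ger0_norm ?exprn_ge0 ?(ltW t0)//.
  move: ta; rewrite ltr_pdivlMr//; apply: le_lt_trans.
  apply: ler_pM => //; first by rewrite exprn_ge0// ltW.
    by rewrite expr2 ler_piMl// ltW.
  rewrite -[w _ _](addrK alpha); apply: le_trans (ler_normB _ _) _.
  by rewrite addrC lerD2l (le_trans w0)// ltW.
Qed.

(** In the chart a is close to - alpha t^2, so a + beta j t^2 becomes (beta j - alpha) t^2. *)
Lemma state_col_limit j (e : R) : 0 < e -> exists2 d, 0 < d & forall t w,
  0 < t < d -> `|w - limit_point| < d ->
  `|(t ^+ 2)^-1 *: 'D_(unitv R j, 0) h (scaled_point t w) -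
    (beta j - alpha) *: unitv R j| <= e.
Proof.
move=> e_gt0; have e20 : 0 < e / 2 by rewrite divr_gt0.
have [d1 d10 H1] := jacobian_expansion hg j e20.
have b0 : 0 < Num.min (e / 2) d1 by rewrite lt_min e20.
have [d d0 H] := scaled_point_near b0.
exists d => // t w td wd; have [] := H t w td wd.
rewrite !lt_min => /andP[_ td1] /andP[_ vd1] /andP[_ ad1] /andP[we _].
have t0 : 0 < t by case/andP: td.
have t2 : 0 < t ^+ 2 by rewrite exprn_gt0.
have := H1 t (e0 + transverse w) (t ^+ 2 * w ord0 0).
rewrite (ltW t0) td1 => /(_ isT vd1 ad1) {}H.
rewrite -(ler_pM2l t2) -{1}(ger0_norm (ltW t2)) -normrZ scalerBr scalerA.
rewrite divff ?gt_eqF// scale1r.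
set X := 'D_ _ _ _ in H *.
have -> : X - t ^+ 2 *: ((beta j - alpha) *: unitv R j) =
    (X - (t ^+ 2 * w ord0 0) *: unitv R j - t ^+ 2 *: (beta j *: unitv R j))
    + (t ^+ 2 * (w ord0 0 + alpha)) *: unitv R j.
  by rewrite !scalerA mulrBr mulrDr scalerBl scalerDl;
     apply/matrixP => i k; rewrite !mxE; ring.
apply: le_trans (ler_normD _ _) _.
have -> : t ^+ 2 * e = e / 2 * t ^+ 2 + t ^+ 2 * (e / 2) by field.
apply: lerD; first exact: H.
rewrite normrZ normrM (ger0_norm (ltW t2)) -mulrA ler_wpM2l ?(ltW t2)//.
apply: le_trans (_ : `|w ord0 0 + alpha| * 1 <= _).
  by rewrite ler_wpM2l// norm_unitv.
by rewrite mulr1 ltW.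
Qed.

(** The rescaled derivative tends to an invertible diagonal matrix, with diagonal limit_coef. *)
Lemma scaled_col_limit j (e : R) : 0 < e -> exists2 d, 0 < d & forall t w,
  0 < t < d -> `|w - limit_point| < d ->
  `|scaled_col (scaled_point t w) t j - limit_coef j *: unitv R j| <= e.
Proof.
move=> e_gt0; rewrite /scaled_col /scaled_coef /scaled_dir /limit_coef.
case: (eqVneq j ord0) => [->|j0]; last exact: state_col_limit.
have [d1 d10 H1] := parameter_expansion hg e_gt0.
have [d d0 H] := scaled_point_near d10.
exists d => // t w td wd; have [td1 vd1 ad1 _] := H t w td wd.
have t0 : 0 < t by case/andP: td.
have := H1 t (e0 + transverse w) (t ^+ 2 * w ord0 0).
rewrite (ltW t0) td1 => /(_ isT vd1 ad1) {}H.
rewrite -(ler_pM2l t0) -{1}(ger0_norm (ltW t0)) -normrZ scalerBr scalerA.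
by rewrite divff ?gt_eqF// !scale1r mulrC.
Qed.

(** Finitely many radii admit a common positive lower bound. *)
Lemma common_radius (P : 'I_m.+1 -> R -> Prop) :
  (forall j d d', d' <= d -> P j d -> P j d') ->
  (forall j, exists2 d, 0 < d & P j d) -> exists2 d, 0 < d & forall j, P j d.
Proof.
move=> mono H.
have /choice[f fP] : forall j, exists d, 0 < d /\ P j d.
  by move=> j; have [d d0 Pd] := H j; exists d.
exists (\big[Num.min/1]_j f j) => [|j].
  elim/big_ind : _ => // [x y x0 y0|j _]; first by rewrite lt_min x0.
  by have [] := fP j.
by apply: mono (fP j).2; exact: bigmin_le.
Qed.

(** The inverse of the limit of the scaled derivative. *)
Definition normalize (v : V) : V := \col_j ((limit_coef j)^-1 * v j 0).

Lemma normalize_linear a v w : normalize (v + a *: w) = normalize v + a *: normalize w.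
Proof. by apply/matrixP => i j; rewrite !mxE; ring. Qed.

Lemma normalizeZ a v : normalize (a *: v) = a *: normalize v.
Proof. by apply/matrixP => i j; rewrite !mxE mulrCA. Qed.

Lemma normalizeB v w : normalize (v - w) = normalize v - normalize w.
Proof. by rewrite -scaleN1r normalize_linear scaleN1r. Qed.

Lemma normalize_bounded : exists2 k, 0 < k & forall v, `|normalize v| <= k * `|v|.
Proof.
exists (\sum_j `|(limit_coef j)^-1| + 1) => [|v].
  by rewrite ltr_wpDl// sumr_ge0.
apply: mx_norm_leP => [|i j].
  by rewrite mulr_ge0// addr_ge0// sumr_ge0.
rewrite mxE normrM; apply: ler_pM => //; last exact: mx_norm_entry.
by rewrite (bigD1 i)//= -addrA lerDl addr_ge0// sumr_ge0.
Qed.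

Lemma normalize_limit (q : V) :
  normalize (\sum_j q j 0 *: (limit_coef j *: unitv R j)) = q.
Proof.
apply/matrixP => i j; rewrite ord1 mxE summxE (bigD1 i)//= big1 ?addr0.
  by rewrite !mxE !eqxx mulr1 mulrCA mulVf ?mulr1// limit_coef_neq0.
by move=> k ki; rewrite !mxE andbT eq_sym (negbTE ki) !mulr0.
Qed.

(** After normalization the scaled derivative is within 1/2 of the identity near the limit
    point, for all small positive t. *)
Lemma normalized_jacobian : exists2 d, 0 < d & forall t w q, 0 < t < d ->
  `|w - limit_point| < d ->
  `|normalize (scaled_jacobian (scaled_point t w) t q) - q| <= 2^-1 * `|q|.
Proof.
have [k k0 kP] := normalize_bounded.
(* Each of the m.+1 columns contributes at most k e |q|, in total |q| / 2. *)
pose e := (2 * k * m.+1%:R)^-1.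
have e0' : 0 < e by rewrite invr_gt0 !mulr_gt0.
have [d d0 H] := @common_radius (fun j d => forall t w,
  0 < t < d -> `|w - limit_point| < d ->
  `|scaled_col (scaled_point t w) t j - limit_coef j *: unitv R j| <= e)
  ltac:(by move=> j d d' dd H t w /andP[t0 td] wd; apply: H;
        rewrite ?t0 ?(lt_le_trans _ dd)) (fun j => scaled_col_limit j e0').
exists d => // t w q td wd.
rewrite -[X in _ - X](normalize_limit q) -normalizeB.
apply: le_trans (kP _) _.
rewrite /scaled_jacobian -sumrB.
have -> : 2^-1 * `|q| = k * (m.+1%:R * (e * `|q|)).
  have mn : m.+1%:R != 0 :> R by rewrite pnatr_eq0.
  rewrite /e; move: (m.+1%:R : R) mn => N N0.
  by field; rewrite N0 gt_eqF.
rewrite ler_pM2l//; apply: le_trans (ler_norm_sum _ _ _) _.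
rewrite mulr_natl -[X in _ *+ X](card_ord m.+1) -sumr_const ler_sum// => j _.
rewrite -scalerBr normrZ mulrC; apply: ler_pM => //; last exact: mx_norm_entry.
exact: H.
Qed.

Definition scaled_value t w : V := (t ^+ 3)^-1 *: h (scaled_point t w).

Lemma scaled_value_limit (e : R) : 0 < e -> exists2 d, 0 < d &
  forall t, 0 < t < d -> `|scaled_value t limit_point| <= e.
Proof.
move=> e_gt0; have [d d0 H] := value_expansion hg e_gt0.
have a1 : 0 < `|alpha| + 1 by rewrite ltr_wpDl.
exists (Num.min 1 (d / (`|alpha| + 1))) => [|t].
  by rewrite lt_min ltr01 divr_gt0.
rewrite lt_min => /and3P[t0 t1 td].
have td' : t < d.
  apply: lt_le_trans td _; rewrite ler_pdivrMr// ler_peMr ?lerDr//.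
  exact: ltW.
have t3 : 0 < t ^+ 3 by rewrite exprn_gt0.
have := H t (t ^+ 2 * - alpha); rewrite (ltW t0) td' => /(_ isT).
have -> : `|t ^+ 2 * - alpha| < d.
  rewrite normrM normrN ger0_norm ?exprn_ge0 ?(ltW t0)//.
  move: td; rewrite ltr_pdivlMr//; apply: le_lt_trans.
  apply: ler_pM => //; first by rewrite exprn_ge0// ltW.
    by rewrite expr2 ler_piMl// ltW.
  by rewrite lerDl.
move=> /(_ isT) {}H.
rewrite /scaled_value /scaled_point limit_point0 /limit_point transverse_e0 addr0.
rewrite -(ler_pM2l t3) -{1}(ger0_norm (ltW t3)) -normrZ scalerA divff ?gt_eqF//.
rewrite scale1r [leRHS]mulrC; apply: le_trans H.
rewrite -addrA scalerA -opprD -scalerDl.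
have -> : t * (t ^+ 2 * - alpha) + t ^+ 3 * alpha = 0 by ring.
by rewrite scale0r subr0.
Qed.

Lemma is_derive_normalize (W : normedModType R) (f : W -> V) p v l :
  is_derive p v f l -> is_derive p v (fun x => normalize (f x)) (normalize l).
Proof.
move=> /is_deriveP H; have [k k0 kP] := normalize_bounded.
apply/is_deriveP => e e_gt0; have [d d0 dH] := H _ (divr_gt0 e_gt0 k0).
exists d => // x /dH; rewrite -normalizeZ -!normalizeB => dx.
by apply: le_trans (kP _) _; rewrite -ler_pdivlMl// mulrA [k^-1 * e]mulrC.
Qed.

(** Simplified Newton step with the limit derivative; for t != 0 its fixed points are the zeros of h in the chart. *)
Definition newton t w : V := w - normalize (scaled_value t w).

(** The derivative of the Newton step has norm at most 1/2; integrate it along the segment. *)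
Lemma newton_lipschitz : exists2 d, 0 < d & forall t w w', 0 < t < d ->
  `|w - limit_point| < d -> `|w' - limit_point| < d ->
  `|newton t w - newton t w'| <= 2^-1 * `|w - w'|.
Proof.
have [d d0 H] := normalized_jacobian; exists d => // t w w' td wd wd'.
have t0 : t != 0 by rewrite gt_eqF//; case/andP: td.
pose q := w - w'.
pose dn s := q - normalize (scaled_jacobian (scaled_point t (w' + s *: q)) t q).
pose phi s := newton t (w' + s *: q).
have := @mean_value R m.+1 1 phi dn 0 1 (2^-1 * `|q|) 0 ler01.
rewrite scaler0 subr0 subr0 mulr1 /phi scale0r addr0 scale1r.
rewrite [w' + q]addrC subrK; apply => s /andP[s0 s1].
  apply: is_deriveB.
    apply/is_deriveP => e e_gt0; exists 1 => // x _.
    rewrite [x *: 1]mulr1 opprD addrACA subrr add0r -!scalerBl addrAC addrK subrr.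
    by rewrite scale0r normr0 mulr_ge0// ltW.
  apply: is_derive_normalize.
  have -> : scaled_jacobian (scaled_point t (w' + s *: q)) t q = (t ^+ 3)^-1 *:
      'D_(t *: transverse q, t ^+ 2 * q ord0 0) h (scaled_point t (w' + s *: q)).
    by rewrite scaled_jacobianE// scalerA mulVf ?scale1r// expf_neq0.
  rewrite /scaled_value; apply: is_deriveZ.
  under eq_fun do rewrite scaled_point_line.
  rewrite scaled_point_line; apply: is_derive_lineE.
  exact: (smooth_derivable sh).
rewrite subr0 /dn distrC; apply: H => //.
have -> : w' + s *: q - limit_point =
    (1 - s) *: (w' - limit_point) + s *: (w - limit_point).
  by rewrite /q; move: limit_point => c; apply/matrixP => i j; rewrite !mxE; ring.
apply: le_lt_trans (ler_normD _ _) _.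
rewrite !normrZ (ger0_norm s0) ger0_norm ?subr_ge0//.
set M := Num.max `|w' - limit_point| `|w - limit_point|.
have Md : M < d by rewrite gt_max wd'.
have aM : `|w' - limit_point| <= M by rewrite le_max lexx.
have bM : `|w - limit_point| <= M by rewrite le_max lexx orbT.
have s1' : 0 <= 1 - s by rewrite subr_ge0.
apply: le_lt_trans (lerD (ler_wpM2l s1' aM) (ler_wpM2l s0 bM)) _.
by rewrite -mulrDl subrK mul1r.
Qed.

(** The Newton step is a contraction of a fixed ball for every small t, and its fixed point
    solves the equation. The last clause keeps what the regularity of the solution in t
    needs: the residual controls the distance to the solution, and the scaled derivative
    is bounded below. *)
Lemma newton_solution : exists2 r, 0 < r & exists2 d, 0 < d &
  exists W : R -> V, forall t, 0 < t < d ->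
    [/\ `|W t - limit_point| < r, h (scaled_point t (W t)) = 0 &
     forall w, `|w - limit_point| < r ->
       `|w - W t| <= 2 * `|normalize (scaled_value t w)| /\
       forall q, `|q| <=
         2 * `|normalize (scaled_jacobian (scaled_point t w) t q)|].
Proof.
have [d1 d10 H1] := newton_lipschitz.
have [d2 d20 H2] := normalized_jacobian.
have [k k0 kP] := normalize_bounded.
pose r := Num.min d1 d2.
have r0 : 0 < r by rewrite lt_min d10.
have [rd1 rd2] : r <= d1 /\ r <= d2 by rewrite /r !ge_min !lexx orbT.
(* The center of the ball of radius r / 2 moves by at most r / 4, and the contraction adds at most
   another r / 4, so the ball is mapped to itself. *)
have e0' : 0 < r / 4 / k by rewrite !divr_gt0.
have [d3 d30 H3] := scaled_value_limit e0'.
exists r => //; exists (Num.min r d3); first by rewrite lt_min r0.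
suff /choice[W WP] : forall t, exists w, 0 < t < Num.min r d3 ->
    [/\ `|w - limit_point| < r, h (scaled_point t w) = 0 &
     forall w', `|w' - limit_point| < r ->
       `|w' - w| <= 2 * `|normalize (scaled_value t w')| /\
       forall q, `|q| <=
         2 * `|normalize (scaled_jacobian (scaled_point t w') t q)|].
  by exists W.
move=> t; have [td|tN] := boolP (0 < t < Num.min r d3); last by exists 0.
move: td; rewrite lt_min => /and3P[t0 tr td3].
have tn0 : t != 0 by rewrite gt_eqF.
have t01 : 0 < t < d1 by rewrite t0 (lt_le_trans tr).
have t02 : 0 < t < d2 by rewrite t0 (lt_le_trans tr).
have r2 : r / 2 < r by rewrite ltr_pdivrMr// ltr_pMr// ltr1n.
pose B := closed_ball limit_point (r / 2).
have BE w : B w <-> `|w - limit_point| <= r / 2.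
  by rewrite /B closed_ballE ?divr_gt0// /closed_ball_ /= distrC.
have B1 w : B w -> `|w - limit_point| < d1.
  by move=> /BE wr; apply: le_lt_trans wr (lt_le_trans r2 rd1).
have k4 : k * (r / 4 / k) = r / 4 by rewrite mulrC divfK// gt_eqF.
have nt_lp : `|newton t limit_point - limit_point| <= r / 4.
  rewrite /newton addrC addKr normrN (le_trans (kP _))// -k4 ler_pM2l// H3//.
  by rewrite t0.
have lp1 : `|limit_point - limit_point| < d1 by rewrite subrr normr0.
have NB : {homo newton t : w / B w >-> B w}.
  move=> w Bw; apply/BE; rewrite -(subrKA (newton t limit_point)).
  apply: le_trans (ler_normD _ _) _.
  have n1 := H1 t w limit_point t01 (B1 _ Bw) lp1.
  apply: le_trans (lerD n1 nt_lp) _; move/BE : Bw => Bw; lra.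
have [w Bw wE] : exists2 w, B w & w = newton t w.
  apply: (@banach_fixed_point _ _ B (mkfun_fun NB)).
  - exists (2^-1)%:nng; split => //=; first by rewrite invf_lt1// ltr1n.
    by move=> [x y] [/= Bx By]; apply: H1; rewrite ?B1.
  - exact: closed_ball_closed.
  - by exists limit_point; apply/BE; rewrite subrr normr0 divr_ge0// ltW.
exists w => _; split.
- by move/BE : Bw => /le_lt_trans; apply.
- have /matrixP n0 : normalize (scaled_value t w) = 0.
    by apply: (addrI (- w)); rewrite addr0 [in RHS]wE /newton opprB [LHS]addrC.
  have : scaled_value t w = 0.
    apply/matrixP => i j; have := n0 i 0; rewrite ord1 !mxE => /eqP.
    by rewrite mulf_eq0 invr_eq0 (negbTE (limit_coef_neq0 _))/= => /eqP.
  move/eqP; rewrite scaler_eq0 invr_eq0 expf_eq0/= (negbTE tn0) => /eqP.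
  by [].
- move=> w' w'r; split=> [|q].
    have n1 := H1 t w' w t01 (lt_le_trans w'r rd1) (B1 _ Bw).
    rewrite -wE /newton in n1.
    have := ler_normD (w' - normalize (scaled_value t w') - w)
      (normalize (scaled_value t w')).
    rewrite addrAC subrK => n2; lra.
  have n1 := H2 t w' q t02 (lt_le_trans w'r rd2).
  have := ler_normB (normalize (scaled_jacobian (scaled_point t w') t q))
    (normalize (scaled_jacobian (scaled_point t w') t q) - q).
  rewrite opprB addrC subrK => n2; lra.
Qed.

End Rescaling.

(** * The branch as a continuously differentiable curve *)

Section Curve.
Variables (R : realType) (m : nat).
Local Opaque derive.
Local Notation V := 'cV[R]_m.+1.
Local Notation U := (V * R^o)%type.
Local Notation e0 := (@unitv R m ord0).
Variables (h : U -> V) (alpha : R) (beta : 'I_m.+1 -> R).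
Hypothesis hg : cubic_germ h alpha beta.
Let sh := germ_smooth hg.

Local Notation limit_point := (limit_point m alpha).
Local Notation normalize := (normalize alpha beta).
Local Notation scaled_value := (scaled_value h).
Local Notation scaled_jacobian := (scaled_jacobian h).
Local Notation scaled_col := (scaled_col h).

Variables (r d : R) (W : R -> V).
Hypothesis r0 : 0 < r.
Hypothesis d0 : 0 < d.
Hypothesis WP : forall t, 0 < t < d ->
    [/\ `|W t - limit_point| < r, h (scaled_point t (W t)) = 0 &
     forall w, `|w - limit_point| < r ->
       `|w - W t| <= 2 * `|normalize (scaled_value t w)| /\
       forall q, `|q| <=
         2 * `|normalize (scaled_jacobian (scaled_point t w) t q)|].

Lemma near_domain t : 0 < t < d -> \forall s \near t, 0 < s < d.
Proof.
move=> td; have : nbhs t `]0, d[%classic.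
  by apply: open_nbhs_nbhs; split; [exact: interval_open|rewrite /= in_itv].
by apply: filterS => s; rewrite /= in_itv.
Qed.

Lemma near_domain0 : \forall s \near 0^'+, 0 < s < d.
Proof.
near=> s; apply/andP; split; near: s; [exact: nbhs_right_gt|exact: nbhs_right_lt].
Unshelve. all: by end_near. Qed.

(** The residual of the limit point tends to 0, and the residual bounds the distance to W t. *)
Lemma W_cvg0 : W t @[t --> 0^'+] --> limit_point.
Proof.
apply/cvgrPdist_le => e e_gt0; have [k k0 kP] := normalize_bounded alpha beta.
have e2k : 0 < e / (2 * k) by rewrite divr_gt0// mulr_gt0.
have [d1 d10 H] := scaled_value_limit hg e2k.
near=> t.
have td : 0 < t < d by near: t; exact: near_domain0.
have t1 : 0 < t < d1.
  case/andP: td => t0 _; rewrite t0.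
  by near: t; exact: nbhs_right_lt.
have [_ _ /(_ limit_point)] := WP td.
rewrite subrr normr0 => /(_ r0)[HW _]; apply: le_trans HW _.
have -> : e = 2 * (k * (e / (2 * k))) by field; rewrite gt_eqF.
rewrite ler_pM2l//; apply: le_trans (kP _) _.
by rewrite ler_pM2l// H.
Unshelve. all: by end_near. Qed.

Lemma pair_cvg (T : Type) (F : set_system T) {FF : Filter F} (f : T -> V)
    (g : T -> R^o) x a :
  f @ F --> x -> g @ F --> a -> (fun t => (f t, g t) : U) @ F --> ((x, a) : U).
Proof.
by move=> fx ga; exact: (@cvg_pair _ _ _ F (nbhs x) (nbhs a) FF _ _ f g fx ga).
Qed.

Lemma coord0_cvg (T : Type) (F : set_system T) {FF : Filter F} (f : T -> V) (x : V) :
  f @ F --> x -> f t ord0 0 @[t --> F] --> x ord0 0.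
Proof.
move=> fx; have c0 : (fun M : V => M ord0 0) @ x --> x ord0 0.
  exact: coord_continuous.
exact: (cvg_comp _ _ fx c0).
Qed.

Lemma transverse_cvg (T : Type) (F : set_system T) {FF : Filter F} (f : T -> V) (x : V) :
  f @ F --> x -> transverse (f t) @[t --> F] --> transverse x.
Proof.
move=> fx; rewrite /transverse; apply: (cvgB fx); apply: cvgZr_tmp.
exact: coord0_cvg.
Qed.

Lemma pow_cvg n (t : R) : s ^+ n @[s --> t] --> t ^+ n.
Proof. exact: exprn_continuous. Qed.

Lemma scaled_point_cvg (F : set_system R) {FF : Filter F} (f : R -> V) t x :
  F --> t -> f @ F --> x -> scaled_point s (f s) @[s --> F] --> scaled_point t x.
Proof.
move=> Ft fx; apply: pair_cvg.
  apply: cvgZ => //; apply: cvgD; [exact: cvg_cst|exact: transverse_cvg].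
apply: cvgM; last exact: coord0_cvg.
exact: (cvg_comp _ _ Ft (@pow_cvg 2 t)).
Qed.

(** The residual of W t at a nearby parameter s tends to 0, and it bounds the distance to W s. *)
Lemma W_continuous t : 0 < t < d -> W s @[s --> t] --> W t.
Proof.
move=> td; have tn0 : t != 0 by rewrite gt_eqF//; case/andP: td.
have [Wr hW _] := WP td.
have vc : scaled_value s (W t) @[s --> t] --> (0 : V).
  rewrite -(scaler0 _ (t ^+ 3)^-1) -hW; apply: cvgZ.
    by apply: cvgV; [rewrite expf_neq0|exact: pow_cvg].
  have pc : scaled_point s (W t) @[s --> t] --> scaled_point t (W t).
    by apply: (@scaled_point_cvg (nbhs t) _ (fun=> W t)); [exact: cvg_id|exact: cvg_cst].
  exact: (cvg_comp _ _ pc (smooth_continuous sh _)).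
apply/cvgrPdist_le => e e_gt0; have [k k0 kP] := normalize_bounded alpha beta.
have e2k : 0 < e / (2 * k) by rewrite divr_gt0// mulr_gt0.
have vs : \forall s \near t, `|scaled_value s (W t)| <= e / (2 * k).
  move: vc => /cvgrPdist_le/(_ _ e2k); apply: filterS => s.
  by rewrite sub0r normrN.
near=> s.
have sd : 0 < s < d by near: s; exact: near_domain.
have [_ _ /(_ _ Wr)[HW _]] := WP sd; apply: le_trans HW _.
have -> : e = 2 * (k * (e / (2 * k))) by field; rewrite gt_eqF.
rewrite ler_pM2l//; apply: le_trans (kP _) _; rewrite ler_pM2l//.
by near: s.
Unshelve. all: by end_near. Qed.

Definition curve (t : R) : U := if 0 < t then scaled_point t (W t) else 0.
(** The directions complementary to (e0, 0), scaled as in the chart. *)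
Definition chart_vector (t : R) (q : V) : U := (transverse q, t * q ord0 0).
Definition scaled_mx (p : U) (t : R) : 'M[R]_m.+1 :=
  \matrix_(i, j) scaled_col p t j i 0.
(** Solves for the complementary part of the tangent vector in the linearized equation. *)
Definition slope (t : R) : V := invmx (scaled_mx (curve t) t) *m
  (- (t ^+ 2)^-1 *: 'D_(e0, 0) h (curve t)).
Definition tangent (t : R) : U :=
  (e0, 0) + (if 0 < t then chart_vector t (slope t) else 0).

Lemma curve_gt0 t : 0 < t -> curve t = scaled_point t (W t).
Proof. by rewrite /curve => ->. Qed.

Lemma curve_cvg t : 0 < t < d -> curve s @[s --> t] --> curve t.
Proof.
move=> td; rewrite curve_gt0; last by case/andP: td.
have pc : scaled_point s (W s) @[s --> t] --> scaled_point t (W t).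
  by apply: scaled_point_cvg; [exact: cvg_id|exact: W_continuous].
apply: cvg_trans pc; apply: near_eq_cvg.
near=> s; rewrite curve_gt0//.
have /andP[] // : 0 < s < d by near: s; exact: near_domain.
Unshelve. all: by end_near. Qed.

Lemma chart_vectorD t q a w : chart_vector t (q + a *: w) = chart_vector t q + a *: chart_vector t w.
Proof.
apply/pair_equal_spec; split => /=; first exact: transverse_linear.
by rewrite !mxE mulrDr mulrCA.
Qed.

Lemma norm_chart_vector t q : 0 <= t -> `|chart_vector t q| <= (1 + t) * `|q|.
Proof.
move=> t0; rewrite prod_normE/= ge_max; apply/andP; split.
  by rewrite mulrDl mul1r (le_trans (norm_transverse q))// lerDl mulr_ge0.
rewrite normrM ger0_norm// mulrDl mul1r ler_wpDl// ler_wpM2l//.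
exact: mx_norm_entry.
Qed.

Lemma derive_chart_vector p t q : t != 0 ->
  'D_(chart_vector t q) h p = t ^+ 2 *: scaled_jacobian p t q.
Proof.
move=> t0; have := scaled_jacobianE hg p q t0.
have -> : (t *: transverse q, t ^+ 2 * q ord0 0) = t *: chart_vector t q :> U.
  by apply/pair_equal_spec; split => //=; rewrite expr2 -mulrA.
by rewrite smooth_deriveZ// exprS -scalerA => /(scalerI t0).
Qed.

Lemma scaled_mxE p t q : scaled_mx p t *m q = scaled_jacobian p t q.
Proof.
apply/matrixP => i j; rewrite ord1 mxE summxE; apply: eq_bigr => k _.
by rewrite !mxE mulrC.
Qed.

(** The lower bound of newton_solution at the solution itself. *)
Lemma coercive t q : 0 < t < d ->
  `|q| <= 2 * `|normalize (scaled_jacobian (curve t) t q)|.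
Proof.
move=> td; rewrite curve_gt0; last by case/andP: td.
by have [Wr _ /(_ _ Wr)[_]] := WP td; exact.
Qed.

Lemma scaled_mx_unit t : 0 < t < d -> scaled_mx (curve t) t \in unitmx.
Proof.
move=> td; rewrite -unitmx_tr -row_free_unit; apply: inj_row_free => v v0.
have : `|v^T| <= 0.
  apply: le_trans (coercive _ td) _.
  rewrite -scaled_mxE -[scaled_mx _ _]trmxK -trmx_mul v0 trmx0.
  have -> : normalize 0 = 0 by apply/matrixP => i j; rewrite !mxE mulr0.
  by rewrite normr0 mulr0.
by rewrite normr_le0 => /eqP/(congr1 trmx); rewrite trmxK trmx0.
Qed.

Lemma slopeE t : 0 < t < d -> scaled_jacobian (curve t) t (slope t) =
  - (t ^+ 2)^-1 *: 'D_(e0, 0) h (curve t).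
Proof. by move=> td; rewrite -scaled_mxE mulKVmx// scaled_mx_unit. Qed.

(** The tangent vector lies in the kernel of the derivative of h. *)
Lemma tangent_derive t : 0 < t < d -> 'D_(tangent t) h (curve t) = 0.
Proof.
move=> td; have t0 : 0 < t by case/andP: td.
have tn : t != 0 by rewrite gt_eqF.
rewrite /tangent t0 smooth_deriveD// derive_chart_vector// slopeE// scalerA mulrN.
by rewrite divff ?expf_neq0// scaleN1r subrr.
Qed.

Lemma curve_zero t : 0 < t < d -> h (curve t) = 0.
Proof.
by move=> td; rewrite curve_gt0; [have [] := WP td|case/andP: td].
Qed.

Lemma curve_entry0 t : 0 < t -> (curve t).1 ord0 0 = t.
Proof.
move=> t0; rewrite curve_gt0// /= mxE [X in _ * X]mxE transverse_entry eqxx addr0.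
by rewrite unitv_entry eqxx mulr1.
Qed.

(** The e0-coordinate of the state on the curve equals the curve parameter, so an increment of
    the curve has e0-part s - t and is complementary otherwise. *)
Lemma curve_increment s t : 0 < s -> 0 < t -> exists q,
  curve s - curve t = (s - t) *: (e0, 0) + chart_vector t q.
Proof.
move=> s0 t0; set D := curve s - curve t.
exists (D.1 + (D.2 / t - D.1 ord0 0) *: e0).
have D0 : D.1 ord0 0 = s - t.
  by rewrite /D /= mxE [X in _ + X]mxE !curve_entry0.
clearbody D; rewrite [LHS]surjective_pairing.
apply/pair_equal_spec; split => /=.
  have te0 : transverse e0 = 0 by rewrite -[e0]scale1r transverse_e0.
  by rewrite transverse_linear te0 scaler0 addr0 /transverse D0 [RHS]addrC subrK.
have E c : (D.1 + c *: e0) ord0 0 = D.1 ord0 0 + c.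
  by rewrite mxE [X in _ + X = _]mxE unitv_entry eqxx mulr1.
by rewrite scaler0 add0r E [X in t * X]addrC subrK mulrC divfK// gt_eqF.
Qed.

(** Both end points are zeros of h, so by Frechet differentiability the derivative of h at the
    increment is small; it only sees the complementary part z of the increment minus
    (s - t) times the tangent, and coercivity turns this into smallness of z. *)
Lemma curve_derivative t (e : R) : 0 < t < d -> 0 < e ->
  \forall s \near t, `|curve s - curve t - (s - t) *: tangent t| <= e * `|s - t|.
Proof.
move=> td e_gt0; have t0 : 0 < t by case/andP: td.
have [k k0 kP] := normalize_bounded alpha beta.
set T := `|tangent t| + 1; have T0 : 0 < T by rewrite ltr_wpDl.
(* e2 bounds the complementary part z relative to the increment D. The bound 2^-1 gives
   |D| <= 2 T |s - t|, and the other one turns this into the bound e |s - t|. *)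
pose e2 := Num.min 2^-1 (e / (2 * T)).
have e20 : 0 < e2 by rewrite lt_min invr_gt0 ltr0n divr_gt0// mulr_gt0.
(* C is the constant in the passage from the derivative of h along D to z. *)
pose C := (1 + t) * (2 * (k * (t ^+ 2)^-1)).
have C0 : 0 < C by rewrite !mulr_gt0// ?invr_gt0 ?exprn_gt0// addr_gt0.
have [b b0 bP] := smooth_frechet (curve t) sh (divr_gt0 e20 C0).
have cc := curve_cvg td.
near=> s.
have sd : 0 < s < d by near: s; exact: near_domain.
have s0 : 0 < s by case/andP: sd.
have sb : `|curve s - curve t| < b.
  rewrite distrC; near: s; move: cc => /cvgrPdist_lt; exact.
have := bP _ sb; have -> : curve t + (curve s - curve t) = curve s.
  by rewrite addrC subrK.
rewrite !curve_zero// subr0 sub0r normrN.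
have [q qE] := curve_increment s0 t0.
set D := curve s - curve t in qE *.
pose z := q + (- (s - t)) *: slope t.
have zE : D - (s - t) *: tangent t = chart_vector t z.
  rewrite qE /z chart_vectorD /tangent t0 scalerDr scaleNr.
  by rewrite opprD addrACA subrr add0r.
have DE : D = (s - t) *: tangent t + chart_vector t z by rewrite -zE addrC subrK.
clearbody D; have -> : 'D_D h (curve t) = t ^+ 2 *: scaled_jacobian (curve t) t z.
  rewrite [in LHS]DE smooth_deriveD// smooth_deriveZ// tangent_derive//.
  by rewrite scaler0 add0r derive_chart_vector// gt_eqF.
have t2 : 0 < t ^+ 2 by rewrite exprn_gt0.
rewrite normrZ (ger0_norm (ltW t2)) -ler_pdivlMl// => Jz.
have lz : `|chart_vector t z| <= e2 * `|D|.
  apply: le_trans (norm_chart_vector _ (ltW t0)) _.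
  have -> : e2 * `|D| = (1 + t) * (2 * (k * ((t ^+ 2)^-1 * (e2 / C * `|D|)))).
    have CC : C * (e2 / C) = e2 by rewrite mulrC divfK// gt_eqF.
    rewrite -[in LHS]CC; move: (e2 / C) => y.
    by rewrite /C; move: (t ^+ 2)^-1 => x; ring.
  rewrite ler_pM2l ?addr_gt0//; apply: le_trans (coercive _ td) _.
  rewrite ler_pM2l//; apply: le_trans (kP _) _.
  by rewrite ler_pM2l.
have DT : `|D| <= 2 * T * `|s - t|.
  have := ler_normD ((s - t) *: tangent t) (chart_vector t z); rewrite -DE normrZ => H1.
  have H2 : `|s - t| * `|tangent t| <= T * `|s - t|.
    by rewrite mulrC ler_wpM2r// lerDl.
  have H3 : e2 * `|D| <= 2^-1 * `|D|.
    by rewrite ler_wpM2r// ge_min lexx.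
  lra.
rewrite zE; apply: le_trans lz _; apply: le_trans (ler_wpM2l (ltW e20) DT) _.
rewrite mulrA ler_wpM2r// -ler_pdivlMr ?mulr_gt0//.
by rewrite ge_min lexx orbT.
Unshelve. all: by end_near. Qed.

(** Coercivity applied to slope t - q: the error made by the limit q in the linearized
    equation tends to 0. *)
Lemma slope_cvg (F : set_system R) {FF : Filter F} (c : 'I_m.+1 -> V) (a q : V) :
  (\forall t \near F, 0 < t < d) ->
  (t ^+ 2)^-1 *: 'D_(e0, 0) h (curve t) @[t --> F] --> a ->
  (forall j, scaled_col (curve t) t j @[t --> F] --> c j) ->
  \sum_j q j 0 *: c j = - a -> slope t @[t --> F] --> q.
Proof.
move=> Fd ac cc qE; have [k k0 kP] := normalize_bounded alpha beta.
pose err t := - ((t ^+ 2)^-1 *: 'D_(e0, 0) h (curve t)) -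
  scaled_jacobian (curve t) t q.
have ec : err t @[t --> F] --> (0 : V).
  rewrite -(subrr (- a)); apply: cvgB; first exact: cvgN.
  rewrite -qE; apply: cvg_bigsum => j; apply: cvgZ; first exact: cvg_cst.
  exact: cc.
apply/cvgrPdistC_le => e e_gt0.
have e2k : 0 < e / (2 * k) by rewrite divr_gt0// mulr_gt0.
have small : \forall t \near F, `|err t| <= e / (2 * k).
  by move: ec => /cvgrPdist_le/(_ _ e2k); apply: filterS => s; rewrite sub0r normrN.
apply: filterS2 Fd small => t td small.
apply: le_trans (coercive _ td) _.
have -> : scaled_jacobian (curve t) t (slope t - q) = err t.
  rewrite /err -scaleNr -slopeE// -!scaled_mxE mulmxBr//.
have -> : e = 2 * (k * (e / (2 * k))) by field; rewrite gt_eqF.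
by rewrite ler_pM2l//; apply: le_trans (kP _) _; rewrite ler_pM2l.
Qed.

Lemma chart_vector_cvg (F : set_system R) {FF : Filter F} (f : R -> V) t (x : V) :
  F --> t -> f @ F --> x -> chart_vector s (f s) @[s --> F] --> chart_vector t x.
Proof.
move=> Ft fx; apply: pair_cvg; first exact: transverse_cvg.
by apply: cvgM => //; exact: coord0_cvg.
Qed.

Lemma tangent_cvg t : 0 < t < d -> tangent s @[s --> t] --> tangent t.
Proof.
move=> td; have t0 : 0 < t by case/andP: td.
have tn : t != 0 by rewrite gt_eqF.
have Dc v : 'D_v h (curve s) @[s --> t] --> 'D_v h (curve t).
  exact: (cvg_comp _ _ (curve_cvg td)
    (smooth_continuous (smooth_derive sh v) (curve t))).
have Vc n : (s ^+ n)^-1 @[s --> t] --> (t ^+ n)^-1.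
  by apply: cvgV; [rewrite expf_neq0|exact: pow_cvg].
have sc : slope s @[s --> t] --> slope t.
  apply: (@slope_cvg (nbhs t) _ (fun j => scaled_col (curve t) t j)
    ((t ^+ 2)^-1 *: 'D_(e0, 0) h (curve t))).
  - exact: near_domain.
  - exact: (cvgZ (@Vc 2%N) (Dc _)).
  - move=> j; apply: cvgZ; last exact: Dc.
    rewrite /scaled_coef; case: ifP => _; last exact: Vc.
    exact: (@Vc 1%N).
  - by rewrite -scaleNr -slopeE.
have lc : (e0, 0) + chart_vector s (slope s) @[s --> t] --> (e0, 0) + chart_vector t (slope t).
  apply: cvgD; [exact: cvg_cst|apply: chart_vector_cvg; [exact: cvg_id|exact: sc]].
rewrite [X in _ --> X]/tangent t0; apply: cvg_trans lc; apply: near_eq_cvg.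
near=> s; rewrite /tangent.
have /andP[-> //] : 0 < s < d by near: s; exact: near_domain.
Unshelve. all: by end_near. Qed.

Lemma curve_state_limit j :
  (t ^+ 2)^-1 *: 'D_(unitv R j, 0) h (curve t) @[t --> 0^'+] -->
  (beta j - alpha) *: unitv R j.
Proof.
apply/cvgrPdistC_le => e e_gt0; have [b b0 bP] := state_col_limit hg j e_gt0.
near=> t.
have t0 : 0 < t by near: t; exact: nbhs_right_gt.
rewrite curve_gt0//; apply: bP.
  by rewrite t0; near: t; exact: nbhs_right_lt.
rewrite distrC; near: t; move: W_cvg0 => /cvgrPdist_lt; exact.
Unshelve. all: by end_near. Qed.

Lemma curve_col_limit j :
  scaled_col (curve t) t j @[t --> 0^'+] --> limit_coef alpha beta j *: unitv R j.
Proof.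
apply/cvgrPdistC_le => e e_gt0; have [b b0 bP] := scaled_col_limit hg j e_gt0.
near=> t.
have t0 : 0 < t by near: t; exact: nbhs_right_gt.
rewrite curve_gt0//; apply: bP.
  by rewrite t0; near: t; exact: nbhs_right_lt.
rewrite distrC; near: t; move: W_cvg0 => /cvgrPdist_lt; exact.
Unshelve. all: by end_near. Qed.

Lemma id_cvg0 : (s : R) @[s --> 0^'+] --> (0 : R).
Proof. exact: cvg_within. Qed.

Lemma chart_vector0_e0 a : chart_vector 0 (a *: e0) = 0.
Proof.
by apply/pair_equal_spec; split => /=; rewrite ?transverse_e0// mul0r.
Qed.

(** At t = 0 the slope tends to a multiple of e0, which the chart maps to 0, so the curve
    leaves the origin in the direction e0. *)
Lemma tangent_cvg0 : tangent s @[s --> 0^'+] --> tangent 0.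
Proof.
have sc : slope s @[s --> 0^'+] --> (- (beta ord0 - alpha)) *: e0.
  apply: (@slope_cvg (0 : R)^'+ _ (fun j => limit_coef alpha beta j *: unitv R j)
    ((beta ord0 - alpha) *: e0)).
  - exact: near_domain0.
  - exact: curve_state_limit.
  - exact: curve_col_limit.
  rewrite (bigD1 ord0)//= big1 ?addr0 => [|j j0].
    by rewrite mxE unitv_entry eqxx mulr1 /limit_coef eqxx scale1r scaleNr.
  by rewrite mxE unitv_entry (negbTE j0) mulr0 scale0r.
have lc : (e0, 0) + chart_vector s (slope s) @[s --> 0^'+] --> tangent 0.
  rewrite /tangent ltxx -(chart_vector0_e0 (- (beta ord0 - alpha))).
  apply: cvgD; [exact: cvg_cst|apply: chart_vector_cvg; [exact: id_cvg0|exact: sc]].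
apply: cvg_trans lc; apply: near_eq_cvg.
near=> s; rewrite /tangent.
have -> // : 0 < s by near: s; exact: nbhs_right_gt.
Unshelve. all: by end_near. Qed.

Lemma curve_derivative0 : s^-1 *: curve s @[s --> 0^'+] --> tangent 0.
Proof.
have lc : (e0, 0) + chart_vector s (W s) @[s --> 0^'+] --> tangent 0.
  rewrite /tangent ltxx -(chart_vector0_e0 (- alpha)).
  apply: cvgD; first exact: cvg_cst.
  by apply: chart_vector_cvg; [exact: id_cvg0|exact: W_cvg0].
apply: cvg_trans lc; apply: near_eq_cvg.
near=> s; have s0 : 0 < s by near: s; exact: nbhs_right_gt.
rewrite curve_gt0//; apply/pair_equal_spec; split => /=.
  by rewrite scalerA mulVf ?scale1r// gt_eqF.
by rewrite add0r /GRing.scale/= expr2 -mulrA mulKf// gt_eqF.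
Unshelve. all: by end_near. Qed.

Lemma C1_curve_branch : C1_curve d curve.
Proof.
exists tangent; split.
  apply/subspace_continuousP => t; rewrite /= in_itv/= => /andP[t0 td].
  move: t0; rewrite le_eqVlt => /predU1P[<-|t0]; last first.
    by apply: cvg_within_filter; apply: tangent_cvg; rewrite t0.
  apply/cvgrPdist_le => e e_gt0; have := tangent_cvg0.
  move=> /cvgrPdist_le/(_ _ e_gt0); rewrite !near_withinE.
  apply: filterS => s H; rewrite /= in_itv/= => /andP[s0 _].
  move: s0; rewrite le_eqVlt => /predU1P[<-|/H//].
  by rewrite subrr normr0 ltW.
move=> t; rewrite in_itv/= => /andP[t0 td].
move: t0; rewrite le_eqVlt => /predU1P[<-|t0].
  apply/cvgrPdist_le => e e_gt0; have := curve_derivative0.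
  move=> /cvgrPdist_le/(_ _ e_gt0); rewrite !near_withinE /= => H.
  apply: filterS H => s H sn; rewrite /= in_itv/= => /andP[s0 _].
  rewrite subr0 [curve 0]/curve ltxx subr0; apply: H.
  by rewrite lt_neqAle eq_sym sn.
apply: cvg_within_filter; apply/cvgrPdistC_le => e e_gt0.
have tdd : 0 < t < d by rewrite t0.
have := curve_derivative tdd e_gt0; rewrite near_withinE.
apply: filterS => s H sn; have st : s - t != 0 by rewrite subr_eq0.
rewrite -[tangent t](scalerK st) -scalerBr normrZ normfV.
by rewrite ler_pdivrMl ?normr_gt0// mulrC.
Qed.

End Curve.

Section BranchTheorem.
Variables (R : realType) (m : nat).
Local Opaque derive.
Local Notation V := 'cV[R]_m.+1.
Local Notation U := (V * R^o)%type.

(** Branch of zeros of a nondegenerate cubic germ. The last clause gives the leading term of the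
    derivative of h along the branch, from which hyperbolicity is read off. *)
Theorem cubic_germ_branch (h : U -> V) (alpha : R) (beta : 'I_m.+1 -> R) :
  cubic_germ h alpha beta -> (forall j, j != ord0 -> beta j != alpha) ->
  exists2 eps, 0 < eps & exists Y : R -> U, [/\ Y 0 = 0, C1_curve eps Y,
    forall t, 0 < t < eps -> (Y t).1 != 0 /\ h (Y t) = 0 &
    forall j, (t ^+ 2)^-1 *: 'D_(unitv R j, 0) h (Y t) @[t --> 0^'+] -->
      (beta j - alpha) *: unitv R j].
Proof.
move=> hg nd; have [r r0 [d d0 [W WP]]] := newton_solution hg nd.
exists d => //; exists (curve W); split.
- by rewrite /curve ltxx.
- exact: (C1_curve_branch hg r0 d0 WP).
- move=> t td; split; last exact: (curve_zero WP td).
  have t0 : 0 < t by case/andP: td.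
  apply/negP => /eqP/matrixP/(_ ord0 0); rewrite curve_entry0// mxE => tE.
  by move: t0; rewrite tE ltxx.
- move=> j; exact: (curve_state_limit hg r0 d0 WP).
Qed.

End BranchTheorem.

(** * Complex coordinates *)

Section ComplexCoordinates.
Variable R : realType.
Local Notation C := R[i].

Definition expi (x : R) : C := Complex (cos x) (sin x).

Lemma expi0 : expi 0 = 1.
Proof. by rewrite /expi cos0 sin0. Qed.

Lemma expiD x y : expi (x + y) = expi x * expi y.
Proof.
rewrite /expi cosD sinD; apply/eqP; rewrite eq_complex /= eqxx /=.
by rewrite addrC.
Qed.

Lemma expi_natmul x n : expi (n%:R * x) = expi x ^+ n.
Proof.
elim: n => [|n IH]; first by rewrite mul0r expi0 expr0.
by rewrite -add1n natrD mulrDl mul1r expiD IH exprS.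
Qed.

Lemma expi_pi : expi pi = -1.
Proof.
by rewrite /expi cospi sinpi; apply/eqP; rewrite eq_complex /= oppr0 !eqxx.
Qed.

Lemma conjc_expi x : conjc (expi x) = expi (- x).
Proof. by rewrite /expi cosN sinN. Qed.

Lemma expi_conj x : expi x * conjc (expi x) = 1.
Proof. by rewrite conjc_expi -expiD subrr expi0. Qed.

(** On a full turn the cosine equals 1 only at 0, by the half-angle formula. *)
Lemma expi_eq1 x : 0 <= x < pi *+ 2 -> expi x = 1 -> x = 0.
Proof.
move=> /andP[x0 x2]; rewrite /expi => /eqP; rewrite eq_complex/= => /andP[/eqP cx _].
apply/eqP; rewrite eq_le x0 andbT leNgt; apply/negP => xp.
have h : 0 < x / 2 < pi by rewrite divr_gt0//= ltr_pdivrMr// mulr_natr.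
have := sin_gt0_pi h; have : sin (x / 2) ^+ 2 = 0.
  move: cx; rewrite {1}[x]splitr; move: (x / 2) => y.
  rewrite cosD -!expr2 cos2sin2; lra.
by move/eqP; rewrite expf_eq0/= => /eqP ->; rewrite ltxx.
Qed.

Definition cplx (v : 'cV[R]_2) : C := Complex (v 0 0) (v 1 0).
Definition uncplx (c : C) : 'cV[R]_2 :=
  \col_i (if i == 0 then complex.Re c else complex.Im c).

Lemma cplxK v : uncplx (cplx v) = v.
Proof.
apply/matrixP => i j; rewrite ord1 mxE /=; case: i => [[|[|//]] i_lt] /=.
  by congr (v _ _); apply: val_inj.
by congr (v _ _); apply: val_inj.
Qed.

Lemma uncplxK c : cplx (uncplx c) = c.
Proof. by case: c => x y; rewrite /cplx !mxE. Qed.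

Lemma cplx_rot x v : cplx (Defs.rot x *m v) = expi x * cplx v.
Proof.
rewrite /cplx !mxE !big_ord_recl !big_ord0 !mxE /= /expi.
have -> : lift ord0 ord0 = 1 :> 'I_2 by apply: val_inj.
apply/eqP; rewrite eq_complex /= !addr0 mulNr; apply/andP; split => //.
by rewrite addrC.
Qed.

Local Notation tp x := (usubmx (x : 'cV[R]_(4 + 4))).
Local Notation bt x := (dsubmx (x : 'cV[R]_(4 + 4))).
Local Notation up x := (usubmx (x : 'cV[R]_(2 + 2))).
Local Notation dn x := (dsubmx (x : 'cV[R]_(2 + 2))).

(** The k-th of four complex coordinates on the eight-dimensional real space. In these coordinates
    C and D are diagonal, and Q, S, V permute coordinates up to sign and conjugation. *)
Definition zc (k : 'I_4) (x : 'cV[R]_8) : C :=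
  cplx (match val k with
        | 0 => up (tp x) | 1 => dn (tp x) | 2 => up (bt x) | _ => dn (bt x)
        end).
Definition zinv (c : 'I_4 -> C) : 'cV[R]_8 :=
  col_mx (col_mx (uncplx (c (inord 0))) (uncplx (c (inord 1))))
         (col_mx (uncplx (c (inord 2))) (uncplx (c (inord 3)))).

Lemma zinvK c k : zc k (zinv c) = c k.
Proof.
case: k => [[|[|[|[|//]]]] k_lt]; rewrite /zc /zinv /= ?col_mxKu ?col_mxKd ?col_mxKu
  ?col_mxKd uncplxK; congr c; apply: val_inj; by rewrite /= inordK.
Qed.

Lemma zc_inj x y : (forall k, zc k x = zc k y) -> x = y.
Proof.
move=> xy; have e k := congr1 uncplx (xy k).
have e0 := e (@Ordinal 4 0 isT); have e1 := e (@Ordinal 4 1 isT).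
have e2 := e (@Ordinal 4 2 isT); have e3 := e (@Ordinal 4 3 isT).
rewrite /zc /= !cplxK in e0 e1 e2 e3.
have E1 : tp x = tp y.
  by rewrite -[LHS](@vsubmxK _ 2 2 1) -[RHS](@vsubmxK _ 2 2 1) e0 e1.
have E2 : bt x = bt y.
  by rewrite -[LHS](@vsubmxK _ 2 2 1) -[RHS](@vsubmxK _ 2 2 1) e2 e3.
by rewrite -[x](@vsubmxK _ 4 4 1) -[y](@vsubmxK _ 4 4 1) E1 E2.
Qed.

Lemma cplxD u v : cplx (u + v) = cplx u + cplx v.
Proof. by rewrite /cplx !mxE. Qed.

Lemma cplxZ (a : R) v : cplx (a *: v) = Complex a 0 * cplx v.
Proof.
by rewrite /cplx !mxE; apply/eqP; rewrite eq_complex /= !mul0r subr0 addr0 !eqxx.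
Qed.

Lemma zcD k x y : zc k (x + y) = zc k x + zc k y.
Proof.
by case: k => [[|[|[|[|//]]]] k_lt]; rewrite /zc /= !linearD/= cplxD.
Qed.

Lemma zcZ k (a : R) x : zc k (a *: x) = Complex a 0 * zc k x.
Proof.
by case: k => [[|[|[|[|//]]]] k_lt]; rewrite /zc /= !linearZ/= cplxZ.
Qed.

Lemma zc0 k : zc k 0 = 0.
Proof. by rewrite -[0 in LHS](scale0r 0) zcZ mul0r. Qed.

Lemma zcN k x : zc k (- x) = - zc k x.
Proof. by apply/eqP; rewrite -addr_eq0 -zcD addNr zc0. Qed.

Lemma mx_ext (A B : 'M[R]_8) : (forall x : 'cV[R]_8, A *m x = B *m x) -> A = B.
Proof.
by move=> AB; apply/matrixP => i j; have /matrixP/(_ i 0) := AB (delta_mx j 0);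
   rewrite -!colE !mxE.
Qed.

Lemma zc_ext (A B : 'M[R]_8) : (forall k x, zc k (A *m x) = zc k (B *m x)) -> A = B.
Proof. by move=> AB; apply: mx_ext => x; apply: zc_inj => k. Qed.

Lemma tp_block A B D E (x : 'cV[R]_(4 + 4)) :
  tp (block_mx A B D E *m x) = A *m tp x + B *m bt x.
Proof. by rewrite -{1}[x](@vsubmxK _ 4 4 1) mul_block_col col_mxKu. Qed.

Lemma bt_block A B D E (x : 'cV[R]_(4 + 4)) :
  bt (block_mx A B D E *m x) = D *m tp x + E *m bt x.
Proof. by rewrite -{1}[x](@vsubmxK _ 4 4 1) mul_block_col col_mxKd. Qed.

Lemma up_block A B D E (x : 'cV[R]_(2 + 2)) :
  up (block_mx A B D E *m x) = A *m up x + B *m dn x.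
Proof. by rewrite -{1}[x](@vsubmxK _ 2 2 1) mul_block_col col_mxKu. Qed.

Lemma dn_block A B D E (x : 'cV[R]_(2 + 2)) :
  dn (block_mx A B D E *m x) = D *m up x + E *m dn x.
Proof. by rewrite -{1}[x](@vsubmxK _ 2 2 1) mul_block_col col_mxKd. Qed.

Lemma up_c_exp a n y : cplx (up (c_mx R a ^+ n *m y)) = expi (pi / a%:R) ^+ n * cplx (up y).
Proof.
elim: n y => [|n IH] y; first by rewrite !expr0 mul1mx mul1r.
rewrite exprS -mulmxA [up _]up_block mul0mx addr0 cplx_rot IH mulrA exprS//.
Qed.

Lemma dn_c_exp a n y : cplx (dn (c_mx R a ^+ n *m y)) = expi (pi / a%:R) ^+ n * cplx (dn y).
Proof.
elim: n y => [|n IH] y; first by rewrite !expr0 mul1mx mul1r.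
rewrite exprS -mulmxA [dn _]dn_block mul0mx add0r cplx_rot IH mulrA exprS//.
Qed.

Lemma up_q (y : 'cV[R]_4) : up (q_mx R *m y) = dn y.
Proof.
apply/matrixP => i j; rewrite ord1 !mxE !big_ord_recl big_ord0 !mxE.
by case: i => [[|[|//]] i_lt] /=; rewrite ?mul0r ?mul1r ?add0r ?addr0;
   congr (y _ _); apply: val_inj.
Qed.

Lemma dn_q (y : 'cV[R]_4) : dn (q_mx R *m y) = - up y.
Proof.
apply/matrixP => i j; rewrite ord1 !mxE !big_ord_recl big_ord0 !mxE.
by case: i => [[|[|//]] i_lt] /=; rewrite ?mul0r ?mulN1r ?add0r ?addr0;
   congr (- y _ _); apply: val_inj.
Qed.

Lemma up_s (y : 'cV[R]_4) : cplx (up (s_mx R *m y)) = - conjc (cplx (dn y)).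
Proof.
have E : forall i, up (s_mx R *m y) i 0 = if i == 0 then - dn y i 0 else dn y i 0.
  move=> i; rewrite !mxE !big_ord_recl big_ord0 !mxE.
  by case: i => [[|[|//]] i_lt] /=; rewrite ?mul0r ?mulN1r ?mul1r ?add0r ?addr0;
   [congr (- y _ _)|congr (y _ _)]; apply: val_inj.
by rewrite /cplx !E /=; apply/eqP; rewrite eq_complex /= opprK !eqxx.
Qed.

Lemma dn_s (y : 'cV[R]_4) : cplx (dn (s_mx R *m y)) = conjc (cplx (up y)).
Proof.
have E : forall i, dn (s_mx R *m y) i 0 = if i == 0 then up y i 0 else - up y i 0.
  move=> i; rewrite !mxE !big_ord_recl big_ord0 !mxE.
  by case: i => [[|[|//]] i_lt] /=; rewrite ?mul0r ?mulN1r ?mul1r ?add0r ?addr0;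
   [congr (y _ _)|congr (- y _ _)]; apply: val_inj.
by rewrite /cplx !E /=.
Qed.

Definition o0 := @Ordinal 4 0 isT.
Definition o1 := @Ordinal 4 1 isT.
Definition o2 := @Ordinal 4 2 isT.
Definition o3 := @Ordinal 4 3 isT.

Lemma ord4P (P : 'I_4 -> Prop) : P o0 -> P o1 -> P o2 -> P o3 -> forall k, P k.
Proof.
by move=> P0 P1 P2 P3 [[|[|[|[|//]]]] k_lt]; rewrite (bool_irrelevance k_lt isT).
Qed.

Lemma zc_C a rho k x : zc k (C_mx R a rho *m x) =
  expi (pi / a%:R) ^+ (if (k < 2)%N then 1 else rho) * zc k x.
Proof.
elim/ord4P: k; rewrite /zc /= /C_mx ?tp_block ?bt_block ?mul0mx ?addr0 ?add0r.
- by rewrite -[c_mx R a]expr1 up_c_exp.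
- by rewrite -[c_mx R a]expr1 dn_c_exp.
- by rewrite up_c_exp.
- by rewrite dn_c_exp.
Qed.

Lemma zc_D b k x : zc k (D_mx R b *m x) =
  (if odd k then expi (pi / b%:R) else conjc (expi (pi / b%:R))) * zc k x.
Proof.
elim/ord4P: k; rewrite /zc /= /D_mx ?tp_block ?bt_block ?mul0mx ?addr0 ?add0r.
- by rewrite [up _]up_block mul0mx addr0 cplx_rot /expi cosN sinN.
- by rewrite [dn _]dn_block mul0mx add0r cplx_rot.
- by rewrite [up _]up_block mul0mx addr0 cplx_rot /expi cosN sinN.
- by rewrite [dn _]dn_block mul0mx add0r cplx_rot.
Qed.

Lemma cplxN v : cplx (- v) = - cplx v.
Proof. by rewrite /cplx !mxE. Qed.

Lemma zc_Q x : [/\ zc o0 (Q_mx R *m x) = zc o1 x, zc o1 (Q_mx R *m x) = - zc o0 x,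
  zc o2 (Q_mx R *m x) = - zc o3 x & zc o3 (Q_mx R *m x) = zc o2 x].
Proof.
rewrite /zc /= /Q_mx ?tp_block ?bt_block ?mul0mx ?addr0 ?add0r !mulNmx !linearN /=.
by rewrite up_q dn_q cplxN; split=> //; rewrite ?cplxN ?up_q ?dn_q ?cplxN ?opprK.
Qed.

Lemma zc_S x : [/\ zc o0 (S_mx R *m x) = - conjc (zc o1 x),
  zc o1 (S_mx R *m x) = conjc (zc o0 x),
  zc o2 (S_mx R *m x) = - conjc (zc o3 x) & zc o3 (S_mx R *m x) = conjc (zc o2 x)].
Proof.
rewrite /zc /= /S_mx ?tp_block ?bt_block ?mul0mx ?addr0 ?add0r.
by rewrite !up_s !dn_s.
Qed.

Lemma zc_V x : [/\ zc o0 (V_mx R *m x) = zc o2 x, zc o1 (V_mx R *m x) = zc o3 x,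
  zc o2 (V_mx R *m x) = - conjc (zc o1 x) & zc o3 (V_mx R *m x) = conjc (zc o0 x)].
Proof.
rewrite /zc /= /V_mx ?tp_block ?bt_block ?mul0mx ?addr0 ?add0r mul1mx.
by rewrite up_s dn_s.
Qed.

End ComplexCoordinates.

(** * Eigenvalues and relations of the generators *)

Section GroupStructure.
Local Opaque expi.
Variables (R : realType) (a b rho : nat).
Hypothesis a_odd : odd a.
Hypothesis a_gt5 : (5 < a)%N.
Hypothesis b_odd : odd b.
Hypothesis b_gt1 : (1 < b)%N.
Hypothesis ab_coprime : coprime a b.
Hypothesis rho_odd : odd rho.
Hypothesis rho_sq : (a %| rho ^ 2 + 1)%N.

Local Notation C := (C_mx R a rho).
Local Notation D := (D_mx R b).
Local Notation Q := (Q_mx R).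
Local Notation S := (S_mx R).
Local Notation V := (V_mx R).

(** The eigenvalue of C on the first two complex coordinates; on the other two it is om ^+ rho. *)
Definition om : R[i] := expi (pi / a%:R).
(** The eigenvalue of D on the odd-numbered coordinates; on the others it is the inverse. *)
Definition et : R[i] := expi (pi / b%:R).

Lemma expi_root (N : nat) : (0 < N)%N -> expi (pi / N%:R : R) ^+ N = -1.
Proof.
by move=> N0; rewrite -expi_natmul mulrC divfK ?expi_pi// pnatr_eq0 -lt0n.
Qed.

Lemma expi_root2 (N : nat) : (0 < N)%N -> expi (pi / N%:R : R) ^+ (2 * N) = 1.
Proof. by move=> N0; rewrite mulnC exprM expi_root// sqrrN expr1n. Qed.

Lemma expi_root_dvd (N n : nat) : (0 < N)%N -> expi (pi / N%:R : R) ^+ n = 1 ->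
  (2 * N %| n)%N.
Proof.
move=> N0; rewrite {1}(divn_eq n (2 * N)) exprD mulnC exprM expi_root2// expr1n.
rewrite mul1r -expi_natmul => /expi_eq1.
have N0' : 0 < N%:R :> R by rewrite ltr0n.
have k2 : (n %% (2 * N) < 2 * N)%N by rewrite ltn_mod muln_gt0.
rewrite mulr_ge0 ?divr_ge0 ?pi_ge0 ?ler0n//= => H.
have : (n %% (2 * N))%:R * (pi / N%:R) = 0 :> R.
  apply: H; rewrite mulrA ltr_pdivrMr// mulrC.
  have -> : pi *+ 2 * N%:R = pi * (2 * N)%:R :> R by rewrite natrM mulrA -[pi *+ 2]mulr_natr.
  by rewrite ltr_pM2l ?pi_gt0// ltr_nat.
move/eqP; rewrite !mulf_eq0 invr_eq0 (gt_eqF N0') (gt_eqF (pi_gt0 R)) !orbF.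
by rewrite pnatr_eq0.
Qed.

Let a0 : (0 < a)%N. Proof. exact: leq_trans a_gt5. Qed.
Let b0 : (0 < b)%N. Proof. exact: leq_trans b_gt1. Qed.

Lemma om_a : om ^+ a = -1. Proof. exact: expi_root. Qed.
Lemma et_b : et ^+ b = -1. Proof. exact: expi_root. Qed.
Lemma om_conj : om * conjc om = 1. Proof. exact: expi_conj. Qed.
Lemma et_conj : et * conjc et = 1. Proof. exact: expi_conj. Qed.

Lemma om_dvd n : om ^+ n = 1 -> (a %| n)%N.
Proof. by move/(expi_root_dvd a0); apply: dvdn_trans; exact: dvdn_mull. Qed.

Lemma et_dvd n : et ^+ n = 1 -> (b %| n)%N.
Proof. by move/(expi_root_dvd b0); apply: dvdn_trans; exact: dvdn_mull. Qed.

(** Both a and 2 divide rho^2 + 1, so om ^+ (rho^2 + 1) is 1. This is why V, whose square is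
    antilinear, conjugates C to its power rho. *)
Lemma om_rho2 : om ^+ (rho * rho) = conjc om.
Proof.
have oN : om != 0.
  by apply/eqP => o0; have := om_conj; rewrite o0 mul0r => /eqP; rewrite eq_sym oner_eq0.
apply: (mulfI oN); rewrite om_conj -exprS.
have /dvdnP[k ->] : (2 * a %| (rho * rho).+1)%N.
  rewrite Gauss_dvd ?coprime2n//; apply/andP; split.
    by rewrite dvdn2 /= oddM rho_odd.
  by move: rho_sq; rewrite addn1 mulnn.
by rewrite mulnC exprM expi_root2// expr1n.
Qed.

(** The character of C on the k-th complex coordinate. *)
Definition omk (k : 'I_4) : R[i] := om ^+ (if (k < 2)%N then 1 else rho).
(** The character of D on the k-th complex coordinate. *)
Definition etk (k : 'I_4) : R[i] := if odd k then et else conjc et.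

Lemma omkE : (omk o0 = om) * (omk o1 = om) * (omk o2 = om ^+ rho) * (omk o3 = om ^+ rho).
Proof. by rewrite /omk /= expr1. Qed.

Lemma etkE : (etk o0 = conjc et) * (etk o1 = et) * (etk o2 = conjc et) * (etk o3 = et).
Proof. by []. Qed.

Lemma zc_Ck k x : zc k (C *m x) = omk k * zc k x.
Proof. exact: zc_C. Qed.

Lemma zc_Dk k x : zc k (D *m x) = etk k * zc k x.
Proof. exact: zc_D. Qed.

Lemma conjcM (z w : R[i]) : conjc (z * w) = conjc z * conjc w.
Proof. exact: rmorphM. Qed.

Lemma conjcN (z : R[i]) : conjc (- z) = - conjc z.
Proof. exact: rmorphN. Qed.

Lemma conjcX (z : R[i]) n : conjc (z ^+ n) = conjc z ^+ n.
Proof. exact: rmorphXn. Qed.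

Lemma zc_Cpow n k x : zc k (C ^+ n *m x) = omk k ^+ n * zc k x.
Proof.
elim: n x => [|n IH] x; first by rewrite !expr0 mul1mx mul1r.
by rewrite exprS -mulmxA zc_C IH mulrA -exprS.
Qed.

Lemma zc_Dpow n k x : zc k (D ^+ n *m x) = etk k ^+ n * zc k x.
Proof.
elim: n x => [|n IH] x; first by rewrite !expr0 mul1mx mul1r.
by rewrite exprS -mulmxA zc_D IH mulrA -exprS.
Qed.

Lemma omk_a k : omk k ^+ a = -1.
Proof.
rewrite /omk -exprM mulnC exprM om_a; case: ifP => _; first by rewrite expr1.
by rewrite -signr_odd rho_odd expr1.
Qed.

Lemma etk_b k : etk k ^+ b = -1.
Proof.
by rewrite /etk; case: ifP => _; rewrite -?conjcX et_b// rmorphN1.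
Qed.

Lemma omk_conj k : omk k * conjc (omk k) = 1.
Proof. by rewrite /omk conjcX -exprMn om_conj expr1n. Qed.

Lemma etk_conj k : etk k * conjc (etk k) = 1.
Proof.
by rewrite /etk; case: ifP => _; rewrite ?conjcK ?et_conj// mulrC et_conj.
Qed.

Lemma C_a : C ^+ a = -1.
Proof.
by apply: zc_ext => k x; rewrite zc_Cpow omk_a mulN1r mulNmx mul1mx zcN.
Qed.

Lemma D_b : D ^+ b = -1.
Proof.
by apply: zc_ext => k x; rewrite zc_Dpow etk_b mulN1r mulNmx mul1mx zcN.
Qed.

Lemma C_2a : C ^+ (2 * a) = 1.
Proof. by rewrite mulnC exprM C_a sqrrN expr1n. Qed.

Lemma D_2b : D ^+ (2 * b) = 1.
Proof. by rewrite mulnC exprM D_b sqrrN expr1n. Qed.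

Lemma DC : D * C = C * D.
Proof.
by apply: zc_ext => k x; rewrite -!mulmxA zc_Ck !zc_Dk zc_Ck mulrCA.
Qed.

Lemma QC : Q * C = C * Q.
Proof.
apply: zc_ext => k x; rewrite -!mulmxA zc_Ck.
have [q0 q1 q2 q3] := zc_Q (C *m x); have [p0 p1 p2 p3] := zc_Q x.
by elim/ord4P: k; rewrite ?(q0, q1, q2, q3, p0, p1, p2, p3) !zc_Ck ?mulrN.
Qed.

Lemma QD : Q * D = D ^+ (2 * b).-1 * Q.
Proof.
have E k : etk k ^+ (2 * b).-1 = conjc (etk k).
  have e0 : etk k != 0.
    by apply/eqP => o0; have := etk_conj k; rewrite o0 mul0r => /eqP; rewrite eq_sym oner_eq0.
  apply: (mulfI e0); rewrite etk_conj -exprS prednK ?muln_gt0//.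
  by rewrite mulnC exprM etk_b sqrrN expr1n.
apply: zc_ext => k x; rewrite -!mulmxA zc_Dpow E.
have [q0 q1 q2 q3] := zc_Q (D *m x); have [p0 p1 p2 p3] := zc_Q x.
by elim/ord4P: k; rewrite ?(q0, q1, q2, q3, p0, p1, p2, p3) !zc_Dk ?etkE ?conjcK ?mulrN.
Qed.

Lemma VC : V * C = C ^+ rho * V.
Proof.
apply: zc_ext => k x; rewrite -!mulmxA zc_Cpow.
have [q0 q1 q2 q3] := zc_V (C *m x); have [p0 p1 p2 p3] := zc_V x.
by elim/ord4P: k; rewrite ?(q0, q1, q2, q3, p0, p1, p2, p3) !zc_Ck ?conjcM ?omkE
   -?exprM ?om_rho2 ?mulrN.
Qed.

Lemma VD : V * D = D * V.
Proof.
apply: zc_ext => k x; rewrite -!mulmxA zc_Dk.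
have [q0 q1 q2 q3] := zc_V (D *m x); have [p0 p1 p2 p3] := zc_V x.
by elim/ord4P: k; rewrite ?(q0, q1, q2, q3, p0, p1, p2, p3) !zc_Dk ?conjcM ?etkE
   ?conjcK ?mulrN.
Qed.

Lemma QQ : Q ^+ 2 = -1.
Proof.
apply: zc_ext => k x; rewrite expr2 -!mulmxA mulNmx mul1mx zcN.
have [q0 q1 q2 q3] := zc_Q (Q *m x); have [p0 p1 p2 p3] := zc_Q x.
by elim/ord4P: k; rewrite ?(q0, q1, q2, q3, p0, p1, p2, p3).
Qed.

Lemma VV : V ^+ 2 = S.
Proof.
apply: zc_ext => k x; rewrite expr2 -!mulmxA.
have [q0 q1 q2 q3] := zc_V (V *m x); have [p0 p1 p2 p3] := zc_V x.
have [s0 s1 s2 s3] := zc_S x.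
by elim/ord4P: k; rewrite ?(q0, q1, q2, q3, p0, p1, p2, p3, s0, s1, s2, s3).
Qed.

Lemma SS : S ^+ 2 = -1.
Proof.
apply: zc_ext => k x; rewrite expr2 -!mulmxA mulNmx mul1mx zcN.
have [q0 q1 q2 q3] := zc_S (S *m x); have [p0 p1 p2 p3] := zc_S x.
by elim/ord4P: k; rewrite ?(q0, q1, q2, q3, p0, p1, p2, p3) ?conjcN ?conjcK.
Qed.

Lemma VQ : V * Q = - (Q * V).
Proof.
apply: zc_ext => k x; rewrite mulNmx zcN -!mulmxA.
have [q0 q1 q2 q3] := zc_V (Q *m x); have [p0 p1 p2 p3] := zc_Q (V *m x).
have [s0 s1 s2 s3] := zc_Q x; have [v0 v1 v2 v3] := zc_V x.
by elim/ord4P: k; rewrite ?(q0, q1, q2, q3, p0, p1, p2, p3) ?(s0, s1, s2, s3)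
  ?(v0, v1, v2, v3) ?conjcN ?opprK.
Qed.

End GroupStructure.

(** * Normal form of the group elements *)

Section GeneratedGroup.
Variables (R : realType) (n : nat) (A : set 'M[R]_n).

(** The smallest group exists as soon as some group of invertible matrices contains the generators. *)
Lemma generated_is_group (H0 : set 'M[R]_n) :
  is_mx_group H0 -> A `<=` H0 -> is_mx_group (generated_mx_group A).
Proof.
move=> gH0 AH0; split.
- by move=> H [[H1 _ _] _].
- move=> g h gG hG H HA; have [[_ HM _] _] := HA.
  by apply: HM; [exact: gG|exact: hG].
- move=> g gG; split.
    by have [_ _ /(_ g (gG H0 (conj gH0 AH0)))[]] := gH0.
  move=> H HA; have [[_ _ HV] _] := HA.
  by have [] := HV g (gG H HA).
Qed.

End GeneratedGroup.

Section NormalForm.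
Variables (R : realType) (a b rho : nat).
Hypothesis a_odd : odd a.
Hypothesis a_gt5 : (5 < a)%N.
Hypothesis b_odd : odd b.
Hypothesis b_gt1 : (1 < b)%N.
Hypothesis ab_coprime : coprime a b.
Hypothesis rho_odd : odd rho.
Hypothesis rho_sq : (a %| rho ^ 2 + 1)%N.

Local Notation C := (C_mx R a rho).
Local Notation D := (D_mx R b).
Local Notation Q := (Q_mx R).
Local Notation S := (S_mx R).
Local Notation V := (V_mx R).
Local Notation G := (@Gab R a b rho).

Let a0 : (0 < a)%N. Proof. exact: leq_trans a_gt5. Qed.
Let b0 : (0 < b)%N. Proof. exact: leq_trans b_gt1. Qed.

Definition normal_form m n i j : 'M[R]_8 := C ^+ m * D ^+ n * Q ^+ i * V ^+ j.

(** Moving x across a power of y when it acts on y as the k-th power. *)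
Lemma shift_pow (T : pzRingType) (x y : T) k n :
  x * y = y ^+ k * x -> x * y ^+ n = y ^+ (k * n) * x.
Proof.
move=> xy; elim: n => [|n IH]; first by rewrite muln0 !expr0 mulr1 mul1r.
by rewrite exprS mulrA xy -mulrA IH mulrA -exprD mulnS.
Qed.

Lemma DCn m : D * C ^+ m = C ^+ m * D.
Proof. exact: (commrX m (DC R a b rho)). Qed.

Lemma DnCm m n : D ^+ n * C ^+ m = C ^+ m * D ^+ n.
Proof. exact: (commr_sym (commrX n (commr_sym (DCn m)))). Qed.

Lemma QCn m : Q * C ^+ m = C ^+ m * Q.
Proof. exact: (commrX m (QC R a rho)). Qed.

Lemma VDn n : V * D ^+ n = D ^+ n * V.
Proof. exact: (commrX n (VD R b)). Qed.

Lemma QDn n : Q * D ^+ n = D ^+ ((2 * b).-1 * n) * Q.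
Proof. exact: (shift_pow n (QD R b_gt1)). Qed.

Lemma VCn m : V * C ^+ m = C ^+ (rho * m) * V.
Proof. exact: (shift_pow m (VC R a_odd a_gt5 rho_odd rho_sq)). Qed.

Lemma VQn i : V * Q ^+ i = C ^+ (a * i) * Q ^+ i * V.
Proof.
elim: i => [|i IH]; first by rewrite muln0 !expr0 mulr1 !mul1r.
rewrite exprSr mulrA IH -mulrA VQ mulrN mulnS exprD C_a// mulN1r.
by rewrite !mulNr !mulrA.
Qed.

(** All exponents are natural numbers: the generators have finite order, so inverses are powers. *)
Definition is_nf (g : 'M[R]_8) := exists m n i j, g = normal_form m n i j.

Lemma nf_mulC g : is_nf g -> is_nf (C * g).
Proof.
move=> [m [n [i [j ->]]]]; exists m.+1, n, i, j.
by rewrite /normal_form exprS !mulrA.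
Qed.

Lemma nf_mulD g : is_nf g -> is_nf (D * g).
Proof.
move=> [m [n [i [j ->]]]]; exists m, n.+1, i, j.
by rewrite /normal_form exprS !mulrA DCn.
Qed.

Lemma nf_mulQ g : is_nf g -> is_nf (Q * g).
Proof.
move=> [m [n [i [j ->]]]]; exists m, ((2 * b).-1 * n)%N, i.+1, j.
by rewrite /normal_form !mulrA QCn -[_ * Q * D ^+ n]mulrA QDn exprS !mulrA.
Qed.

Lemma nf_mulV g : is_nf g -> is_nf (V * g).
Proof.
move=> [m [n [i [j ->]]]]; exists (rho * m + a * i)%N, n, i, j.+1.
rewrite /normal_form !mulrA VCn -[_ * V * D ^+ n]mulrA VDn mulrA.
rewrite -[_ * V * Q ^+ i]mulrA VQn !mulrA exprD exprS.
by rewrite -[_ * D ^+ n * C ^+ _]mulrA DnCm !mulrA.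
Qed.

Lemma nf_mulX (x g : 'M[R]_8) k : (forall g, is_nf g -> is_nf (x * g)) ->
  is_nf g -> is_nf (x ^+ k * g).
Proof.
move=> H; elim: k => [|k IH] hg; first by rewrite expr0 mul1r.
by rewrite exprS -mulrA; apply: H; exact: IH.
Qed.

Lemma nf_mul g h : is_nf g -> is_nf h -> is_nf (g * h).
Proof.
move=> [m [n [i [j ->]]]] nh; rewrite /normal_form -!mulrA.
apply: (nf_mulX m nf_mulC); apply: (nf_mulX n nf_mulD).
by apply: (nf_mulX i nf_mulQ); apply: (nf_mulX j nf_mulV).
Qed.

Lemma nf_1 : is_nf 1.
Proof. by exists 0, 0, 0, 0; rewrite /normal_form !expr0 !mulr1. Qed.

Lemma unit_of_pow (T : unitRingType) (x : T) N : (0 < N)%N -> x ^+ N = 1 ->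
  x \is a GRing.unit /\ x^-1 = x ^+ N.-1.
Proof.
case: N => // N _ xN; have xl : x ^+ N * x = 1 by rewrite -exprSr.
have xr : x * x ^+ N = 1 by rewrite -exprS.
have ux : x \is a GRing.unit by apply/unitrP; exists (x ^+ N).
by split=> //=; apply: (mulrI ux); rewrite divrr// xr.
Qed.

Lemma V_8 : V ^+ 8 = 1.
Proof. by rewrite -[8%N]/(2 * (2 * 2))%N !exprM VV SS sqrrN expr1n. Qed.

Lemma Q_4 : Q ^+ 4 = 1.
Proof. by rewrite -[4%N]/(2 * 2)%N exprM QQ sqrrN expr1n. Qed.

Lemma unitC : C \is a GRing.unit /\ C^-1 = C ^+ (2 * a).-1.
Proof.
have N0 : (0 < 2 * a)%N by rewrite muln_gt0 a0.
exact: (@unit_of_pow _ C (2 * a) N0 (C_2a R a_gt5 rho_odd)).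
Qed.

Lemma unitD : D \is a GRing.unit /\ D^-1 = D ^+ (2 * b).-1.
Proof.
have N0 : (0 < 2 * b)%N by rewrite muln_gt0 b0.
exact: (@unit_of_pow _ D (2 * b) N0 (D_2b R b_gt1)).
Qed.

Lemma unitQ : Q \is a GRing.unit /\ Q^-1 = Q ^+ 3.
Proof. exact: (@unit_of_pow _ Q 4 isT Q_4). Qed.

Lemma unitV : V \is a GRing.unit /\ V^-1 = V ^+ 7.
Proof. exact: (@unit_of_pow _ V 8 isT V_8). Qed.

Lemma nf_inv g : is_nf g -> g \is a GRing.unit /\ is_nf g^-1.
Proof.
move=> [m [n [i [j ->]]]]; rewrite /normal_form.
have [uC iC] := unitC; have [uD iD] := unitD.
have [uQ iQ] := unitQ; have [uV iV] := unitV.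
have u1 : C ^+ m * D ^+ n \is a GRing.unit by rewrite unitrMl ?unitrX.
have u2 : C ^+ m * D ^+ n * Q ^+ i \is a GRing.unit by rewrite unitrMl ?unitrX.
split; first by rewrite unitrMl ?unitrX.
rewrite invrM ?unitrX// invrM ?unitrX// invrM ?unitrX//.
rewrite -!exprVn iC iD iQ iV -!exprM.
apply: (nf_mulX _ nf_mulV); apply: (nf_mulX _ nf_mulQ).
apply: (nf_mulX _ nf_mulD); rewrite -[X in is_nf X]mulr1.
exact: (nf_mulX _ nf_mulC nf_1).
Qed.

Lemma nf_group : is_mx_group [set g | is_nf g].
Proof.
split; [exact: nf_1|by move=> g h; exact: nf_mul|by move=> g; exact: nf_inv].
Qed.

Lemma nf_generators :
  [set g | g \in [:: C_mx R a rho; D_mx R b; Q_mx R; S_mx R; V_mx R]]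
    `<=` [set g | is_nf g].
Proof.
move=> g /=; rewrite !inE -VV => /orP[|/orP[|/orP[|/orP[|]]]] /eqP ->.
- by rewrite -[C]mulr1; exact: nf_mulC nf_1.
- by rewrite -[D]mulr1; exact: nf_mulD nf_1.
- by rewrite -[Q]mulr1; exact: nf_mulQ nf_1.
- by rewrite -[V ^+ 2]mulr1; exact: (nf_mulX _ nf_mulV nf_1).
- by rewrite -[V]mulr1; exact: nf_mulV nf_1.
Qed.

Lemma G_group : is_mx_group G.
Proof. exact: (generated_is_group nf_group nf_generators). Qed.

Lemma G_generator g :
  g \in [:: C_mx R a rho; D_mx R b; Q_mx R; S_mx R; V_mx R] -> G g.
Proof. by move=> gin H [_]; apply. Qed.

Lemma G_mul g h : G g -> G h -> G (g * h).
Proof. by have [_ + _] := G_group; apply. Qed.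

Lemma G_exp g k : G g -> G (g ^+ k).
Proof.
move=> Gg; elim: k => [|k IH]; first by have [] := G_group.
by rewrite exprS; exact: G_mul.
Qed.

Lemma G_C : G C. Proof. by apply: G_generator; rewrite !inE eqxx. Qed.
Lemma G_D : G D. Proof. by apply: G_generator; rewrite !inE eqxx ?orbT. Qed.
Lemma G_Q : G Q. Proof. by apply: G_generator; rewrite !inE eqxx ?orbT. Qed.
Lemma G_S : G S. Proof. by apply: G_generator; rewrite !inE eqxx ?orbT. Qed.
Lemma G_V : G V. Proof. by apply: G_generator; rewrite !inE eqxx ?orbT. Qed.

(** Q^2 and V^4 are both -1, which is C^a, so their higher powers are absorbed by C. *)
Lemma normal_form_reduced g : G g ->
  exists m n i j, [/\ (i < 2)%N, (j < 4)%N & g = normal_form m n i j].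
Proof.
move=> Gg; have [m [n [i [j ->]]]] : is_nf g.
  exact: (smallest_sub nf_group nf_generators Gg).
exists (m + a * (i %/ 2) + a * (j %/ 4))%N, n, (i %% 2)%N, (j %% 4)%N.
rewrite !ltn_mod; split=> //; rewrite /normal_form.
have Qi : Q ^+ i = C ^+ (a * (i %/ 2)) * Q ^+ (i %% 2).
  by rewrite {1}(divn_eq i 2) exprD mulnC exprM QQ [in RHS]exprM C_a.
have Vj : V ^+ j = C ^+ (a * (j %/ 4)) * V ^+ (j %% 4).
  rewrite {1}(divn_eq j 4) exprD mulnC exprM [in RHS]exprM C_a//.
  by rewrite -[4%N]/(2 * 2)%N exprM VV SS.
have QkC k l : Q ^+ k * C ^+ l = C ^+ l * Q ^+ k.
  exact: (commr_sym (commrX k (commr_sym (QCn l)))).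
rewrite Qi Vj !exprD !mulrA -[C ^+ m * _ * _]mulrA DnCm !mulrA.
rewrite -[_ * Q ^+ _ * C ^+ _]mulrA QkC !mulrA.
by rewrite -[_ * D ^+ n * C ^+ _]mulrA DnCm !mulrA.
Qed.

End NormalForm.

(** * Group elements with a nonzero fixed vector *)

Section Isotropy.
Variables (R : realType) (a b rho : nat).
Local Opaque expi.
Hypothesis a_odd : odd a.
Hypothesis a_gt5 : (5 < a)%N.
Hypothesis b_odd : odd b.
Hypothesis b_gt1 : (1 < b)%N.
Hypothesis ab_coprime : coprime a b.
Hypothesis rho_odd : odd rho.
Hypothesis rho_sq : (a %| rho ^ 2 + 1)%N.

Local Notation C := (C_mx R a rho).
Local Notation D := (D_mx R b).
Local Notation Q := (Q_mx R).
Local Notation S := (S_mx R).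
Local Notation V := (V_mx R).
Local Notation G := (@Gab R a b rho).
Local Notation om := (om R a).
Local Notation et := (et R b).
Local Notation omk := (omk R a rho).
Local Notation etk := (etk R b).

Let a0 : (0 < a)%N. Proof. exact: leq_trans a_gt5. Qed.
Let b0 : (0 < b)%N. Proof. exact: leq_trans b_gt1. Qed.

Lemma coprime_a_rho : coprime a rho.
Proof.
apply: coprime_dvdl rho_sq _; rewrite addn1 -mulnn coprime_sym.
by have := coprimenS (rho * rho); rewrite coprimeMl => /andP[].
Qed.

Lemma omk_dvd k n : omk k ^+ n = 1 -> (a %| n)%N.
Proof.
rewrite /omk -exprM => /(om_dvd a_gt5); case: ifP => _; first by rewrite mul1n.
by rewrite Gauss_dvdr// coprime_a_rho.
Qed.

Lemma etk_dvd k n : etk k ^+ n = 1 -> (b %| n)%N.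
Proof.
rewrite /etk; case: ifP => _; first exact: (et_dvd b_gt1).
by rewrite -conjcX => /(congr1 conjc); rewrite conjcK conjc1; exact: (et_dvd b_gt1).
Qed.

Lemma one_neq_opp1 : (1 : R[i]) != -1.
Proof. by rewrite -subr_eq0 opprK -(natrD _ 1 1) pnatr_eq0. Qed.

(** A primitive root of unity of order twice an odd number has no even power equal to -1. *)
Lemma even_power (z : R[i]) N n : odd N -> z ^+ N = -1 ->
  (forall l, z ^+ l = 1 -> (N %| l)%N) -> z ^+ (2 * n) != -1.
Proof.
move=> N_odd zN zd; apply/eqP => h.
have : z ^+ (4 * n) = 1 by rewrite -[4%N]/(2 * 2)%N -mulnA mulnC exprM h sqrrN expr1n.
move/zd; rewrite Gauss_dvdr ?(coprimeMr _ 2 2) ?coprimen2 ?N_odd//.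
move=> /dvdnP[d dE]; move: h; rewrite dE mulnA [(2 * d * N)%N]mulnC.
rewrite exprM zN exprM sqrrN !expr1n => /eqP; exact/negP/one_neq_opp1.
Qed.

Lemma omk_even k n : omk k ^+ (2 * n) != -1.
Proof.
by apply: (@even_power _ a) => //; [exact: omk_a|exact: omk_dvd].
Qed.

Lemma etk_even k n : etk k ^+ (2 * n) != -1.
Proof.
by apply: (@even_power _ b) => //; [exact: etk_b|exact: etk_dvd].
Qed.

Definition torus_weight m n k : R[i] := omk k ^+ m * etk k ^+ n.

Lemma zc_normal_form m n i j k x : zc k (normal_form R a b rho m n i j *m x) =
  torus_weight m n k * zc k (Q ^+ i *m (V ^+ j *m x)).
Proof.
by rewrite /normal_form -!mulmxA zc_Cpow zc_Dpow mulrA.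
Qed.

(** The four characters on a torus element are u v', u v, w v', w v, where u, w are powers of om
    and om ^+ rho and v is a power of et. Primes denote inverses, which are the conjugates.
    The inequalities are what excludes fixed vectors in fixed_reflection. *)
Lemma weight_torus m n : exists u u' w w' v v' : R[i],
  [/\ [/\ u * u' = 1, w * w' = 1 & v * v' = 1],
    [/\ conjc u = u', conjc w = w', conjc v = v' & conjc v' = v],
    [/\ u ^+ 2 != -1, w ^+ 2 != -1, v' ^+ 2 != -1 & v' ^+ 4 != -1] &
    [/\ torus_weight m n o0 = u * v', torus_weight m n o1 = u * v,
      torus_weight m n o2 = w * v' & torus_weight m n o3 = w * v]].
Proof.
exists (om ^+ m), (conjc (om ^+ m)), ((om ^+ rho) ^+ m), (conjc ((om ^+ rho) ^+ m)),
  (et ^+ n), (conjc (et ^+ n)).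
split.
- by split; rewrite ?conjcX -!exprMn ?om_conj ?et_conj ?expr1n.
- by rewrite !conjcK.
- split.
  + by have := omk_even o0 m; rewrite mulnC exprM omkE.
  + by have := omk_even o2 m; rewrite mulnC exprM omkE.
  + by have := etk_even o0 n; rewrite mulnC exprM etkE conjcX.
  + by have := etk_even o0 (n * 2); rewrite mulnC -mulnA exprM etkE conjcX.
- by rewrite /torus_weight !omkE !etkE !conjcX.
Qed.

(** A coordinate that is mapped to minus a multiple of itself vanishes unless that multiple is -1. *)
Lemma neg_weight_zero (z c : R[i]) : z = - (c * z) -> c != -1 -> z = 0.
Proof.
move=> zE c1; have : (1 + c) * z = 0 by rewrite mulrDl mul1r {1}zE addNr.
by move/eqP; rewrite mulf_eq0 addrC addr_eq0 (negbTE c1) => /eqP.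
Qed.

(** Going around the coordinates that a group element permutes multiplies a fixed coordinate by
    minus a character value (with the exponents of u, w, v at most 4 and even) unless the
    element is in the torus or in the torus times QS. These values are not -1 because a and b
    are odd. So only elements of the torus and of its coset of QS can fix a nonzero vector. *)
Lemma fixed_reflection (g : 'M[R]_8) (x : 'cV[R]_8) :
  G g -> x != 0 -> g *m x = x ->
  (exists m n, g = C ^+ m * D ^+ n) \/
  (exists m n, g = C ^+ m * D ^+ n * (Q * S)).
Proof.
move=> Gg xN gx.
have [m [n [i [j [i2 j4 gE]]]]] :=
  normal_form_reduced a_odd a_gt5 b_gt1 rho_odd rho_sq Gg.
have E k : zc k x = torus_weight m n k * zc k (Q ^+ i *m (V ^+ j *m x)).
  by rewrite -zc_normal_form -gE gx.
have [u [u' [w [w' [v [v' [[uu ww vv] [cu cw cv cv'] [u2 w2 v2 v4] [t0 t1 t2 t3]]]]]]]]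
  := weight_torus m n.
have E0 := E o0; have E1 := E o1; have E2 := E o2; have E3 := E o3.
rewrite t0 in E0; rewrite t1 in E1; rewrite t2 in E2; rewrite t3 in E3.
have absurd : zc o0 x = 0 -> zc o1 x = 0 -> zc o2 x = 0 -> zc o3 x = 0 -> False.
  move=> z0 z1 z2 z3; case/eqP: xN; apply: zc_inj => k.
  by rewrite zc0; elim/ord4P: k.
have [q0 q1 q2 q3] := zc_Q x; have [v0 v1 v2' v3] := zc_V x.
have [s0 s1 s2 s3] := zc_S x.
have [qv0 qv1 qv2 qv3] := zc_Q (V *m x).
have [vs0 vs1 vs2 vs3] := zc_V (S *m x).
have [qvs0 qvs1 qvs2 qvs3] := zc_Q (V *m (S *m x)).
have V3 : V ^+ 3 = V * S by rewrite -VV -exprS.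
move: gE; case: i i2 E E0 E1 E2 E3 => [|[|//]] _ E E0 E1 E2 E3;
  case: j j4 E E0 E1 E2 E3 => [|[|[|[|//]]]] _ E E0 E1 E2 E3 gE;
  rewrite ?expr0 ?expr1 ?mul1mx ?VV ?V3 -?mulmxA in E0 E1 E2 E3.
(* The cases are i = 0, 1 and, for each i, j = 0, 1, 2, 3. Only (0, 0) and (1, 2) allow fixed
   vectors; in the others one coordinate is traced back to itself and all of them vanish. *)
- by left; exists m, n; rewrite gE /normal_form !expr0 !mulr1.
- exfalso; rewrite v0 in E0; rewrite v1 in E1; rewrite v2' in E2; rewrite v3 in E3.
  move: absurd E0 E1 E2 E3; move: (zc o0 x) (zc o1 x) (zc o2 x) (zc o3 x).
  move=> Z0 Z1 Z2 Z3 absurd E0 E1 E2 E3.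
  have c1 : conjc Z1 = u' * v' * (w' * v' * Z0).
    by rewrite E1 E3 !conjcM cu cw cv conjcK.
  have z0 : Z0 = 0.
    apply: (@neg_weight_zero _ (v' ^+ 4)) => //; rewrite [LHS]E0 E2 c1.
    transitivity (- ((u * u') * (w * w') * v' ^+ 4 * Z0)); first by ring.
    by rewrite uu ww !mul1r.
  have z3 : Z3 = 0 by rewrite E3 z0 conjc0 mulr0.
  have z1 : Z1 = 0 by rewrite E1 z3 mulr0.
  by apply: absurd => //; rewrite E2 z1 conjc0 oppr0 mulr0.
- exfalso; rewrite s0 in E0; rewrite s1 in E1; rewrite s2 in E2; rewrite s3 in E3.
  move: absurd E0 E1 E2 E3; move: (zc o0 x) (zc o1 x) (zc o2 x) (zc o3 x).
  move=> Z0 Z1 Z2 Z3 absurd E0 E1 E2 E3.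
  have c1 : conjc Z1 = u' * v' * Z0 by rewrite E1 !conjcM cu cv conjcK.
  have c3 : conjc Z3 = w' * v' * Z2 by rewrite E3 !conjcM cw cv conjcK.
  have z0 : Z0 = 0.
    apply: (@neg_weight_zero _ (v' ^+ 2)) => //; rewrite [LHS]E0 c1.
    transitivity (- ((u * u') * v' ^+ 2 * Z0)); first by ring.
    by rewrite uu !mul1r.
  have z2 : Z2 = 0.
    apply: (@neg_weight_zero _ (v' ^+ 2)) => //; rewrite [LHS]E2 c3.
    transitivity (- ((w * w') * v' ^+ 2 * Z2)); first by ring.
    by rewrite ww !mul1r.
  by apply: absurd => //; rewrite ?E1 ?E3 ?z0 ?z2 conjc0 mulr0.
- exfalso; rewrite vs0 s2 in E0; rewrite vs1 s3 in E1; rewrite vs2 s1 in E2.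
  rewrite vs3 s0 in E3; rewrite ?(conjcN, conjcK) in E0 E1 E2 E3.
  move: absurd E0 E1 E2 E3; move: (zc o0 x) (zc o1 x) (zc o2 x) (zc o3 x).
  move=> Z0 Z1 Z2 Z3 absurd E0 E1 E2 E3.
  have c1 : conjc Z1 = u' * v' * Z2 by rewrite E1 !conjcM cu cv conjcK.
  have c3 : conjc Z3 = - (w' * v' * (u' * v' * Z2)).
    by rewrite E3 !(conjcM, conjcN) cw cv c1 mulrN.
  have z0 : Z0 = 0.
    apply: (@neg_weight_zero _ (v' ^+ 4)) => //; rewrite [LHS]E0 c3 E2.
    transitivity (- ((u * u') * (w * w') * v' ^+ 4 * Z0)); first by ring.
    by rewrite uu ww !mul1r.
  have z2 : Z2 = 0 by rewrite E2 z0 oppr0 mulr0.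
  have z1 : Z1 = 0 by rewrite E1 z2 conjc0 mulr0.
  by apply: absurd => //; rewrite E3 z1 oppr0 mulr0.
- exfalso; rewrite q0 in E0; rewrite q1 in E1; rewrite q2 in E2; rewrite q3 in E3.
  move: absurd E0 E1 E2 E3; move: (zc o0 x) (zc o1 x) (zc o2 x) (zc o3 x).
  move=> Z0 Z1 Z2 Z3 absurd E0 E1 E2 E3.
  have z0 : Z0 = 0.
    apply: (@neg_weight_zero _ (u ^+ 2)) => //; rewrite [LHS]E0 E1.
    transitivity (- ((v * v') * u ^+ 2 * Z0)); first by ring.
    by rewrite vv !mul1r.
  have z2 : Z2 = 0.
    apply: (@neg_weight_zero _ (w ^+ 2)) => //; rewrite [LHS]E2 E3.
    transitivity (- ((v * v') * w ^+ 2 * Z2)); first by ring.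
    by rewrite vv !mul1r.
  by apply: absurd => //; rewrite ?E1 ?E3 ?z0 ?z2 ?oppr0 mulr0.
- exfalso; rewrite qv0 v1 in E0; rewrite qv1 v0 in E1; rewrite qv2 v3 in E2.
  rewrite qv3 v2' in E3.
  move: absurd E0 E1 E2 E3; move: (zc o0 x) (zc o1 x) (zc o2 x) (zc o3 x).
  move=> Z0 Z1 Z2 Z3 absurd E0 E1 E2 E3.
  have c2 : conjc Z2 = - (w' * v * Z0).
    by rewrite E2 !(conjcM, conjcN) cw cv' conjcK mulrN.
  have c1 : conjc Z1 = u' * v' * (w' * v * Z0).
    by rewrite E1 !(conjcM, conjcN) cu cv c2 opprK.
  have z0 : Z0 = 0.
    apply: (@neg_weight_zero _ 1); last exact: one_neq_opp1; rewrite [LHS]E0 E3 c1.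
    transitivity (- ((u * u') * (w * w') * ((v * v') * (v * v')) * Z0)); first by ring.
    by rewrite uu ww vv !mul1r.
  have z2 : Z2 = 0 by rewrite E2 z0 conjc0 oppr0 mulr0.
  have z1 : Z1 = 0 by rewrite E1 z2 oppr0 mulr0.
  by apply: absurd => //; rewrite E3 z1 conjc0 oppr0 mulr0.
- by right; exists m, n; rewrite gE /normal_form VV expr1 mulrA.
- exfalso; rewrite qvs0 vs1 s3 in E0; rewrite qvs1 vs0 s2 in E1.
  rewrite qvs2 vs3 s0 in E2; rewrite qvs3 vs2 s1 in E3.
  rewrite ?(conjcN, conjcK, opprK) in E0 E1 E2 E3.
  move: absurd E0 E1 E2 E3; move: (zc o0 x) (zc o1 x) (zc o2 x) (zc o3 x).
  move=> Z0 Z1 Z2 Z3 absurd E0 E1 E2 E3.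
  have c1 : conjc Z1 = - (u' * v' * (w * v * Z0)).
    by rewrite E1 !(conjcM, conjcN) cu cv ?conjcK E3 !mulrN.
  have c2 : conjc Z2 = - (w' * v * (u' * v' * (w * v * Z0))).
    by rewrite E2 !(conjcM, conjcN) cw cv' c1 mulrN.
  have z0 : Z0 = 0.
    apply: (@neg_weight_zero _ 1); last exact: one_neq_opp1; rewrite [LHS]E0 c2.
    transitivity (- ((u * u') * (w * w') * ((v * v') * (v * v')) * Z0)); first by ring.
    by rewrite uu ww vv !mul1r.
  have z3 : Z3 = 0 by rewrite E3 z0 oppr0 mulr0.
  have z1 : Z1 = 0 by rewrite E1 z3 conjc0 mulr0.
  by apply: absurd => //; rewrite E2 z1 mulr0.
Qed.

End Isotropy.

(** * Isotropy subgroups *)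

Section IsotropyTypes.
Variables (R : realType) (a b rho : nat).
Local Opaque expi.
Hypothesis a_odd : odd a.
Hypothesis a_gt5 : (5 < a)%N.
Hypothesis b_odd : odd b.
Hypothesis b_gt1 : (1 < b)%N.
Hypothesis ab_coprime : coprime a b.
Hypothesis rho_odd : odd rho.
Hypothesis rho_sq : (a %| rho ^ 2 + 1)%N.

Local Notation C := (C_mx R a rho).
Local Notation D := (D_mx R b).
Local Notation Q := (Q_mx R).
Local Notation S := (S_mx R).
Local Notation V := (V_mx R).
Local Notation G := (@Gab R a b rho).
Local Notation om := (om R a).
Local Notation et := (et R b).
Local Notation omk := (omk R a rho).
Local Notation etk := (etk R b).

Let a0 : (0 < a)%N. Proof. exact: leq_trans a_gt5. Qed.
Let b0 : (0 < b)%N. Proof. exact: leq_trans b_gt1. Qed.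

Lemma product_power (z y : R[i]) m n N : y ^+ N = -1 -> z ^+ m * y ^+ n = 1 ->
  z ^+ (m * (2 * N)) = 1.
Proof.
move=> yN zy; have y2 : y ^+ (n * (2 * N)) = 1.
  by rewrite mulnCA mulnA mulnC exprM yN exprM sqrrN !expr1n.
by rewrite -[LHS]mulr1 -[X in _ * X = _]y2 (exprM z m) (exprM y n) -exprMn zy expr1n.
Qed.

(** If one coordinate is nonzero, the product of the two characters is 1 there; since a and b are
    coprime, a divides m and b divides n, and then the element is a sign, namely 1. *)
Lemma torus_fixed (m n : nat) (x : 'cV[R]_8) :
  x != 0 -> (C ^+ m * D ^+ n) *m x = x -> C ^+ m * D ^+ n = 1.
Proof.
move=> xN fx; have [k zk] : exists k, zc k x != 0.
  apply/existsP; rewrite -negb_forall; apply: contra xN => /forallP z0.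
  by apply/eqP; apply: zc_inj => k; rewrite zc0; apply/eqP.
have wk l : zc l ((C ^+ m * D ^+ n) *m x) = omk l ^+ m * etk l ^+ n * zc l x.
  by rewrite -mulmxA zc_Cpow zc_Dpow mulrA.
have t1 : omk k ^+ m * etk k ^+ n = 1.
  by apply: (mulIf zk); rewrite mul1r -wk fx.
have /dvdnP[d mE] : (a %| m)%N.
  have := product_power (etk_b R b_gt1 k) t1.
  move/(omk_dvd a_gt5 rho_sq).
  by rewrite Gauss_dvdl// coprimeMr coprimen2 a_odd.
have /dvdnP[e nE] : (b %| n)%N.
  have := t1; rewrite mulrC => /(product_power (omk_a R a_gt5 rho_odd k)).
  move/(etk_dvd b_gt1).
  by rewrite Gauss_dvdl// coprimeMr coprimen2 b_odd coprime_sym.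
have tl l : omk l ^+ m * etk l ^+ n = (-1) ^+ d * (-1) ^+ e.
  by rewrite mE nE [(d * a)%N]mulnC [(e * b)%N]mulnC !exprM omk_a// etk_b.
apply: zc_ext => l y; rewrite mul1mx -mulmxA zc_Cpow zc_Dpow mulrA tl -(tl k) t1.
by rewrite mul1r.
Qed.

Lemma zc_QS (x : 'cV[R]_8) :
  [/\ zc o0 ((Q * S) *m x) = conjc (zc o0 x), zc o1 ((Q * S) *m x) = conjc (zc o1 x),
      zc o2 ((Q * S) *m x) = - conjc (zc o2 x) &
      zc o3 ((Q * S) *m x) = - conjc (zc o3 x)].
Proof.
rewrite -mulmxA; have [q0 q1 q2 q3] := zc_Q (S *m x).
have [s0 s1 s2 s3] := zc_S x.
by split; rewrite ?(q0, q1, q2, q3) ?(s0, s1, s2, s3) ?opprK.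
Qed.

Lemma QSQS : (Q * S) * (Q * S) = 1.
Proof.
apply: zc_ext => k x; rewrite mul1mx -mulmxA.
have [q0 q1 q2 q3] := zc_QS ((Q * S) *m x); have [p0 p1 p2 p3] := zc_QS x.
by elim/ord4P: k; rewrite ?(q0, q1, q2, q3) ?(p0, p1, p2, p3) ?conjcN ?conjcK ?opprK.
Qed.

(** QS is antilinear in each coordinate, so it inverts the torus. *)
Lemma QS_torus (m n : nat) :
  C ^+ m * D ^+ n * (Q * S) * (C ^+ m * D ^+ n) = Q * S.
Proof.
apply: zc_ext => k x; rewrite -!mulmxA zc_Cpow zc_Dpow [Q *m (S *m _)]mulmxA.
have [q0 q1 q2 q3] := zc_QS (C ^+ m *m (D ^+ n *m x)).
rewrite [Q *m (S *m _)]mulmxA; have [p0 p1 p2 p3] := zc_QS x.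
have w1 l : omk l ^+ m * (etk l ^+ n * (conjc (omk l ^+ m) * conjc (etk l ^+ n))) = 1.
  have oo : omk l ^+ m * conjc (omk l ^+ m) = 1.
    by rewrite conjcX -exprMn omk_conj expr1n.
  have ee : etk l ^+ n * conjc (etk l ^+ n) = 1.
    by rewrite conjcX -exprMn etk_conj expr1n.
  by rewrite [X in _ * X]mulrCA ee mulr1.
elim/ord4P: k.
- by rewrite q0 p0 zc_Cpow zc_Dpow !conjcM -[RHS]mul1r -(w1 o0) !mulrA.
- by rewrite q1 p1 zc_Cpow zc_Dpow !conjcM -[RHS]mul1r -(w1 o1) !mulrA.
- by rewrite q2 p2 zc_Cpow zc_Dpow !conjcM !mulrN -[conjc _ in RHS]mul1r -(w1 o2) !mulrA.
- by rewrite q3 p3 zc_Cpow zc_Dpow !conjcM !mulrN -[conjc _ in RHS]mul1r -(w1 o3) !mulrA.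
Qed.

Lemma QS_V : V * (Q * S) = - ((Q * S) * V).
Proof.
apply: zc_ext => k x; rewrite mulNmx zcN -!mulmxA.
rewrite [Q *m (S *m (V *m x))]mulmxA [Q *m (S *m x)]mulmxA.
have [q0 q1 q2 q3] := zc_V ((Q * S) *m x); have [p0 p1 p2 p3] := zc_QS x.
have [s0 s1 s2 s3] := zc_QS (V *m x); have [v0 v1 v2 v3] := zc_V x.
by elim/ord4P: k; rewrite ?(q0, q1, q2, q3) ?(s0, s1, s2, s3) ?(p0, p1, p2, p3)
  ?(v0, v1, v2, v3) ?conjcN ?conjcK ?opprK.
Qed.

Definition reflection_group : set 'M[R]_8 := [set 1%:M; Q * S].
Local Notation K0 := reflection_group.

Lemma torus_mul m n m' n' : (C ^+ m * D ^+ n) * (C ^+ m' * D ^+ n') =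
  C ^+ (m + m') * D ^+ (n + n').
Proof. by rewrite -!mulrA [D ^+ n * _]mulrA DnCm !exprD !mulrA. Qed.

Lemma torus_inv m n :
  (C ^+ m * D ^+ n) * (C ^+ ((2 * a).-1 * m) * D ^+ ((2 * b).-1 * n)) = 1.
Proof.
rewrite torus_mul -!mulSn !prednK ?muln_gt0 ?a0 ?b0//.
by rewrite (exprM C (2 * a)) (exprM D (2 * b)) C_2a// D_2b// !expr1n mulr1.
Qed.

Lemma torus_sqrt (m n : nat) : exists (s : bool) m' n',
  C ^+ m * D ^+ n = (-1) ^+ s * ((C ^+ m' * D ^+ n') * (C ^+ m' * D ^+ n')).
Proof.
have half (x : 'M[R]_8) N k : odd N -> x ^+ N = -1 ->
    exists (s : bool) l, x ^+ k = (-1) ^+ s * x ^+ (l + l).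
  move=> N_odd xN; have [k_odd|k_even] := boolP (odd k).
    (* An odd exponent k becomes even on adding N, which costs the sign x ^+ N. *)
    exists true, (k + N)./2; rewrite addnn halfK oddD k_odd N_odd subn0.
    by rewrite exprD xN mulrN1 expr1 mulN1r opprK.
  by exists false, k./2; rewrite addnn halfK (negbTE k_even) subn0 mul1r.
have [s [l ->]] := half C a m a_odd (C_a R a_gt5 rho_odd).
have [s' [l' ->]] := half D b n b_odd (D_b R b_gt1).
exists (s (+) s'), l, l'; rewrite torus_mul signr_addb.
move: (C ^+ _) (D ^+ _) => X Y.
have XY : X * ((-1) ^+ s' * Y) = (-1) ^+ s' * (X * Y).
  by rewrite mulrA (commr_sign X s') mulrA.
by rewrite -[RHS]mulrA -XY [RHS]mulrA.
Qed.

(** Each torus element is up to sign a square in the torus, because a and b are odd, and QS inverts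
    the torus; hence a torus multiple of QS is a torus conjugate of QS or of -QS, and V
    conjugates QS to -QS. *)
Lemma reflection_conj m n : exists2 h, G h &
  C ^+ m * D ^+ n * (Q * S) = h * (Q * S) * h^-1.
Proof.
have [uV _] := unitV R.
have [s [m' [n' ->]]] := torus_sqrt m n; set T := C ^+ m' * D ^+ n'.
have GT : G T by apply: G_mul => //; apply: G_exp => //; [exact: G_C|exact: G_D].
have uT : T \is a GRing.unit.
  have [_ _ /(_ T GT)[]//] : is_mx_group G by exact: G_group.
have TT : T * (Q * S) * T^-1 = T * T * (Q * S).
  apply: (mulIr uT); rewrite mulrVK//.
  by rewrite -[in LHS](QS_torus m' n') -/T !mulrA.
case: s.
  exists (T * V); first by apply: G_mul => //; exact: G_V.
  have VK : V * (Q * S) * V^-1 = - (Q * S) by rewrite QS_V mulNr mulrK.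
  transitivity (T * (V * (Q * S) * V^-1) * T^-1); last by rewrite (invrM uT uV) !mulrA.
  by rewrite VK [in RHS]mulrN [in RHS]mulNr TT expr1 mulN1r mulNr.
by exists T => //; rewrite TT expr0 mul1r.
Qed.

Lemma isotropy_mul x g h : isotropy G x g -> isotropy G x h -> isotropy G x (g * h).
Proof.
move=> [Gg gx] [Gh hx]; split; last by rewrite -mulmxA hx gx.
by apply: G_mul.
Qed.

(** Two elements of the coset of QS fixing x differ by a torus element fixing x, which is 1. *)
Lemma isotropy_reflection (x : 'cV[R]_8) m n (g := C ^+ m * D ^+ n * (Q * S)) :
  x != 0 -> isotropy G x g -> isotropy G x = [set 1%:M; g].
Proof.
move=> xN ig; apply/seteqP; split => [h ih|h [->|->]//]; last first.
  by split; [have [] := G_group R a_odd a_gt5 b_gt1 rho_odd rho_sq|rewrite mul1mx].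
have [Gh hx] := ih.
have [[p [q hE]]|[p [q hE]]] :=
  fixed_reflection a_odd a_gt5 b_odd b_gt1 rho_odd rho_sq Gh xN hx.
  by left; rewrite hE; apply: (torus_fixed xN); rewrite -hE.
right; have [Ggh ghx] := isotropy_mul ih ig.
set T1 := C ^+ p * D ^+ q in hE; set T2 := C ^+ m * D ^+ n in g ig Ggh ghx *.
set T2' := C ^+ ((2 * a).-1 * m) * D ^+ ((2 * b).-1 * n).
have T22 : T2 * T2' = 1 by exact: torus_inv.
have T22' : T2' * T2 = 1.
  by rewrite /T2' /T2 torus_mul addnC [X in _ * D ^+ X]addnC -torus_mul torus_inv.
have QST : Q * S * T2 = T2' * (Q * S).
  have := QS_torus m n; rewrite -/T2 => H.
  by rewrite -[LHS]mul1r -T22' -mulrA [T2 * _]mulrA H.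
have hg : h * g = T1 * T2'.
  by rewrite hE /g -[LHS]mulrA [Q * S * (T2 * _)]mulrA QST -[T2' * _ * _]mulrA QSQS mulr1.
have : h * g = 1.
  rewrite hg /T1 /T2' torus_mul; apply: (torus_fixed xN).
  by rewrite -torus_mul -/T1 -/T2' -hg.
rewrite hg => T12; have TE : T1 = T2.
  by rewrite -[LHS]mulr1 -T22' mulrA T12 mul1r.
by rewrite /= hE TE.
Qed.

Lemma QS_neq1 : Q * S != 1.
Proof.
apply/eqP => /(congr1 (fun g : 'M[R]_8 => zc o2 (g *m zinv (fun=> 1)))).
have [_ _ -> _] := zc_QS (zinv (fun=> 1)).
by rewrite mul1mx !zinvK conjc1 => /esym/eqP; apply/negP/one_neq_opp1.
Qed.

Lemma neg1_neq1 : (-1 : 'M[R]_8) != 1.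
Proof.
apply/eqP => /(congr1 (fun g : 'M[R]_8 => zc o0 (g *m zinv (fun=> 1)))).
by rewrite mulNmx mul1mx zcN zinvK => /esym/eqP; apply/negP/one_neq_opp1.
Qed.

Lemma QS_neqN1 : Q * S != -1.
Proof.
apply/eqP => /(congr1 (fun g : 'M[R]_8 => zc o0 (g *m zinv (fun=> 1)))).
have [-> _ _ _] := zc_QS (zinv (fun=> 1)).
by rewrite mulNmx mul1mx zcN !zinvK conjc1 => /eqP; apply/negP/one_neq_opp1.
Qed.

Lemma G_QS : G (Q * S).
Proof. by apply: G_mul => //; [exact: G_Q|exact: G_S]. Qed.

Lemma G_N1 : G (-1).
Proof. by rewrite -(C_a R a_gt5 rho_odd); apply: G_exp => //; exact: G_C. Qed.

Lemma isotropy_fix (x : 'cV[R]_8) : x != 0 -> (Q * S) *m x = x -> isotropy G x = K0.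
Proof.
move=> xN fx; have E : C ^+ 0 * D ^+ 0 * (Q * S) = Q * S by rewrite !expr0 !mul1r.
rewrite /reflection_group -E; apply: isotropy_reflection => //.
by rewrite E; split; first exact: G_QS.
Qed.

Lemma isotropy_cases (x : 'cV[R]_8) : x != 0 -> isotropy G x = [set 1%:M] \/
  exists2 h, G h & isotropy G x = mx_conjugate h K0.
Proof.
move=> xN; have [triv|[g [ig gN]]] : (forall g, isotropy G x g -> g = 1) \/
    exists g, isotropy G x g /\ g <> 1.
- have [H|H] := pselect (exists g, isotropy G x g /\ g <> 1); first by right.
  by left=> g ig; apply: contrapT => gN; apply: H; exists g.
- left; apply/seteqP; split => [g /triv ->//|g ->].
  by split; [have [] := G_group R a_odd a_gt5 b_gt1 rho_odd rho_sq|rewrite mul1mx].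
right; have [Gg gx] := ig.
have [[m [n gE]]|[m [n gE]]] :=
  fixed_reflection a_odd a_gt5 b_odd b_gt1 rho_odd rho_sq Gg xN gx.
  by case: gN; rewrite gE; apply: (torus_fixed xN); rewrite -gE.
have [h Gh hE] := reflection_conj m n; exists h => //.
rewrite gE in ig; rewrite (isotropy_reflection xN ig).
have uh : h \is a GRing.unit.
  by have [_ _ /(_ h Gh)[]] := G_group R a_odd a_gt5 b_gt1 rho_odd rho_sq.
apply/seteqP; split => [k [->|->]|k [l [->|->] <-]].
- by exists 1%:M; [left|rewrite mulmx1 mulmxV].
- by exists (Q * S); [right|rewrite hE].
- by left; rewrite mulmx1 mulmxV.
- by right; rewrite /= hE.
Qed.

Lemma conjugate_comp (g h : 'M[R]_8) (K : set 'M[R]_8) : g \in unitmx -> h \in unitmx ->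
  mx_conjugate g (mx_conjugate h K) = mx_conjugate (g *m h) K.
Proof.
move=> ug uh; have E k : g *m (h *m k *m invmx h) *m invmx g =
    (g *m h) *m k *m invmx (g *m h).
  have -> : invmx (g *m h) = invmx h *m invmx g by exact: (invrM ug uh).
  by rewrite !mulmxA.
apply/seteqP; split => [k [l [l' Kl' <-] <-]|k [l Kl <-]].
  by exists l' => //; rewrite E.
by exists (h *m l *m invmx h); [exists l|rewrite E].
Qed.

Lemma G_unit g : G g -> g \in unitmx /\ G (invmx g).
Proof. by have [_ _] := G_group R a_odd a_gt5 b_gt1 rho_odd rho_sq; apply. Qed.

Lemma conjugacy_class_conj (h : 'M[R]_8) K : G h ->
  conjugacy_class G (mx_conjugate h K) = conjugacy_class G K.
Proof.
move=> Gh; have [uh Gh'] := G_unit Gh.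
apply/seteqP; split => [L [g Gg <-]|L [g Gg <-]]; have [ug _] := G_unit Gg.
  by exists (g *m h); [apply: G_mul|rewrite conjugate_comp].
have [uh' _] := G_unit Gh'.
exists (g *m invmx h); first by apply: G_mul.
by rewrite conjugate_comp ?unitmx_mul ?ug// mulmxKV.
Qed.

Lemma conjugate1 (K : set 'M[R]_8) : mx_conjugate 1%:M K = K.
Proof.
apply/seteqP; split => [k [l Kl <-]|k Kk].
  by rewrite mul1mx invmx1 mulmx1.
by exists k => //; rewrite mul1mx invmx1 mulmx1.
Qed.

Lemma class_self (K : set 'M[R]_8) : conjugacy_class G K K.
Proof.
by exists 1%:M; [have [] := G_group R a_odd a_gt5 b_gt1 rho_odd rho_sq|exact: conjugate1].
Qed.

Lemma unique_isotropy_type :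
  unique (nontrivial_isotropy_type G) (conjugacy_class G K0).
Proof.
split; last first.
  move=> tau [[x ->] nt]; have [x0|xN] := eqVneq x 0.
    have [_ []] := nt _ (class_self _); apply/seteqP; split => [g []//|g Gg].
    by split => //; rewrite x0 mulmx0.
  have [iE|[h Gh ->]] := isotropy_cases xN; last by rewrite conjugacy_class_conj.
  by have [] := nt _ (class_self _); rewrite iE.
split.
  pose x := zinv (fun k : 'I_4 => if k == o0 then 1 else 0 : R[i]).
  exists x; congr conjugacy_class; apply/esym/isotropy_fix.
    apply/eqP => /(congr1 (zc o0)); rewrite zc0 zinvK eqxx => /eqP.
    by rewrite oner_eq0.
  apply: zc_inj => k; have [p0 p1 p2 p3] := zc_QS x.
  by elim/ord4P: k; rewrite ?(p0, p1, p2, p3) !zinvK /= ?conjc0 ?conjc1 ?oppr0.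
move=> K [g Gg <-]; have [ug _] := G_unit Gg.
split.
  move=> /seteqP[/(_ (g *m (Q * S) *m invmx g))]; rewrite /= => H _.
  have /H/(congr1 (fun k => invmx g *m k *m g)) :
    (mx_conjugate g K0) (g *m (Q * S) *m invmx g) by exists (Q * S) => //; right.
  rewrite !mulmxA mulVmx// mul1mx mulmxKV// mulmx1 mulVmx// => /eqP.
  exact/negP/QS_neq1.
move=> /seteqP[_ /(_ _ G_N1)[k [->|->]]].
  by rewrite mulmx1 mulmxV// => /eqP; rewrite eq_sym; exact/negP/neg1_neq1.
move=> /(congr1 (fun k => invmx g *m k *m g)).
rewrite !mulmxA mulVmx// mul1mx mulmxKV// mulmxN mulNmx mulmx1 mulVmx// => /eqP.
exact/negP/QS_neqN1.
Qed.

End IsotropyTypes.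

(** * Weights of real trilinear maps *)

Section Weights.
Variable R : realType.
Local Notation C := R[i].
Local Notation ii := (Complex 0 1 : C).
Local Notation rc a := (Complex a 0 : C).

(** Linearity over the real numbers of a map between complex numbers, the scalars being
    embedded as Complex a 0. *)
Definition real_linear (L : C -> C) : Prop :=
  forall (a : R) x y, L (rc a * x + y) = rc a * L x + L y.

(** The two kinds of factors, a variable or its conjugate, in the monomials of a real multilinear map. *)
Definition cj (s : bool) (x : C) : C := if s then conjc x else x.
(** The coefficients of z and of its conjugate in a real linear map L; the sign true selects the conjugate. *)
Definition coef (s : bool) (L : C -> C) : C :=
  2^-1 * (L 1 + (if s then ii else - ii) * L ii).

Lemma coef2 s L : 2 * coef s L = L 1 + (if s then ii else - ii) * L ii.
Proof. by rewrite /coef mulrA mulfV ?mul1r// pnatr_eq0. Qed.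

Lemma ii2 : ii * ii = -1.
Proof. by apply/eqP; rewrite eq_complex /= !mul0r !mulr0 !mul1r sub0r addr0 oppr0 !eqxx. Qed.

Lemma complexE (x : C) : x = rc (complex.Im x) * ii + rc (complex.Re x) * 1.
Proof.
by case: x => x y; apply/eqP; rewrite eq_complex /= !mul0r !mulr0 !mulr1
  ?subr0 ?addr0 ?add0r !eqxx.
Qed.

Lemma conj_complexE (x : C) :
  conjc x = rc (complex.Re x) * 1 - rc (complex.Im x) * ii.
Proof.
by case: x => x y; apply/eqP; rewrite eq_complex /= !mul0r !mulr0 !mulr1
  ?subr0 ?oppr0 ?addr0 ?add0r !eqxx.
Qed.

Lemma real_linear0 L : real_linear L -> L 0 = 0.
Proof.
move=> lL; have := lL 1 0 0; rewrite mulr0 addr0.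
have -> : rc 1 = 1 by [].
by rewrite mul1r => /eqP; rewrite -[X in X == _]addr0 (inj_eq (addrI _)) => /eqP <-.
Qed.

Lemma coef_expand L x : real_linear L ->
  L x = coef false L * x + coef true L * conjc x.
Proof.
move=> lL; have -> : L x = rc (complex.Im x) * L ii + rc (complex.Re x) * L 1.
  rewrite [in LHS](complexE x) lL; congr (_ + _).
  by rewrite -[X in L X]addr0 lL (real_linear0 lL) addr0.
rewrite [X in _ = _ * X + _]complexE conj_complexE.
have := coef2 true L; have := coef2 false L; move: (coef true L) (coef false L) => c1 c2.
move: (rc (complex.Im x)) (rc (complex.Re x)) (L ii) (L 1) => p q u v E2 E1.
have h2 : (2 : C) != 0 by rewrite pnatr_eq0.
apply: (mulfI h2); rewrite [RHS]mulrDr !(mulrA 2) E1 E2.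
transitivity (2 * (q * v) - 2 * (ii * ii) * (p * u)); last by ring.
rewrite ii2; ring.
Qed.

(** Precomposition with a complex multiplication scales the linear coefficient by c and the
    antilinear one by its conjugate. *)
Lemma coef_scale s L c : real_linear L ->
  coef s (fun x => L (c * x)) = cj s c * coef s L.
Proof.
move=> lL; have h2 : (2 : C) != 0 by rewrite pnatr_eq0.
apply: (mulfI h2); rewrite coef2 mulr1 !(coef_expand _ lL) conjcM.
have -> : conjc ii = - ii by apply/eqP; rewrite eq_complex /= oppr0 !eqxx.
case: s => /=;
  move: (coef false L) (coef true L) (conjc c) => p q c'.
- transitivity (q * c' * (1 - ii * ii) + p * c * (1 + ii * ii)); first by ring.
  by rewrite ii2; ring.
- transitivity (p * c * (1 - ii * ii) + q * c' * (1 + ii * ii)); first by ring.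
  by rewrite ii2; ring.
Qed.

Lemma coef_mul s L c : coef s (fun x => c * L x) = c * coef s L.
Proof. by rewrite /coef; ring. Qed.

Lemma coef_linear s (F : C -> C -> C) : (forall y, real_linear (F^~ y)) ->
  real_linear (fun x => coef s (F x)).
Proof. by move=> lF a x y; rewrite /coef !lF; ring. Qed.

Lemma coef_ext s L L' : L =1 L' -> coef s L = coef s L'.
Proof. by move=> LL; rewrite /coef !LL. Qed.

(** The coefficients of the eight monomials in the arguments and their conjugates. *)
Definition coef3 (T : C -> C -> C -> C) s1 s2 s3 : C :=
  coef s1 (fun x => coef s2 (fun y => coef s3 (T x y))).

Section Trilinear.
Variable T : C -> C -> C -> C.
Hypothesis lin1 : forall y w, real_linear (fun x => T x y w).
Hypothesis lin2 : forall x w, real_linear (fun y => T x y w).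
Hypothesis lin3 : forall x y, real_linear (T x y).

Let lin2' s3 x : real_linear (fun y => coef s3 (T x y)).
Proof. by apply: (@coef_linear s3 (T x)) => w; exact: lin2. Qed.

Let lin1' s2 s3 : real_linear (fun x => coef s2 (fun y => coef s3 (T x y))).
Proof.
apply: (@coef_linear s2 (fun x y => coef s3 (T x y))) => y.
by apply: (@coef_linear s3 (T^~ y)) => w; exact: lin1.
Qed.

Lemma coef3_weight chi chi' xi s1 s2 s3 :
  (forall x y w, T (chi * x) (chi * y) (chi' * w) = xi * T x y w) ->
  cj s3 chi' * (cj s2 chi * (cj s1 chi * coef3 T s1 s2 s3)) = xi * coef3 T s1 s2 s3.
Proof.
move=> H; rewrite /coef3 -(coef_scale s1 chi (lin1' s2 s3)) -!coef_mul.
apply: coef_ext => x; rewrite -(coef_scale s2 chi (lin2' s3 _)) -!coef_mul.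
apply: coef_ext => y; rewrite -(coef_scale s3 chi' (lin3 _ _)) -coef_mul.
by apply: coef_ext => w; exact: H.
Qed.

Lemma coef3_expand x y w : (forall s1 s2 s3, coef3 T s1 s2 s3 = 0) -> T x y w = 0.
Proof.
move=> H.
have H1 s2 s3 x' : coef s2 (fun y => coef s3 (T x' y)) = 0.
  rewrite (coef_expand x' (lin1' s2 s3)) -[coef false _]/(coef3 T false s2 s3).
  by rewrite -[coef true _]/(coef3 T true s2 s3) !H !mul0r addr0.
have H2 s3 x' y' : coef s3 (T x' y') = 0.
  by rewrite (coef_expand y' (lin2' s3 x')) !H1 !mul0r addr0.
by rewrite (coef_expand w (lin3 x y)) !H2 !mul0r addr0.
Qed.

(** If T intertwines two pairs of diagonal actions, each of its eight coefficients survives only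
    when the character of its monomial agrees with that of the target for both actions. *)
Lemma weight_vanish (om et omj etj omk etk : C) x y w :
  (forall x y w, T (om * x) (om * y) (omj * w) = omk * T x y w) ->
  (forall x y w, T (et * x) (et * y) (etj * w) = etk * T x y w) ->
  (forall s1 s2 s3,
     cj s3 omj * (cj s2 om * cj s1 om) = omk ->
     cj s3 etj * (cj s2 et * cj s1 et) = etk -> False) ->
  T x y w = 0.
Proof.
move=> Hom Het no; apply: coef3_expand => s1 s2 s3.
have := coef3_weight s1 s2 s3 Hom; have := coef3_weight s1 s2 s3 Het.
move: (coef3 T s1 s2 s3) => c; rewrite !mulrA => E1 E2; apply/eqP/negPn/negP => c0.
have F1 := mulIf c0 E2; have F2 := mulIf c0 E1.
by apply: (no s1 s2 s3); rewrite mulrA; [exact: F1|exact: F2].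
Qed.

End Trilinear.
End Weights.

Section NoResonance.
Local Opaque expi.
Variables (R : realType) (a b rho : nat).
Hypothesis a_odd : odd a.
Hypothesis a_gt5 : (5 < a)%N.
Hypothesis b_odd : odd b.
Hypothesis b_gt1 : (1 < b)%N.
Hypothesis rho_sq : (a %| rho ^ 2 + 1)%N.

Let sg (s : bool) : int := if s then -1 else 1.
Let p0 (k : 'I_4) : int := if (k < 2)%N then 1 else 0.
Let p1 (k : 'I_4) : int := if (k < 2)%N then 0 else 1.
Let qq (k : 'I_4) : int := if odd k then 1 else -1.

Lemma cj_exprz (u : R[i]) s (z : int) : u * conjc u = 1 -> cj s (u ^ z) = u ^ (sg s * z).
Proof.
move=> uu; have u0 : u != 0.
  by apply/eqP => u0; move: uu; rewrite u0 mul0r => /eqP; rewrite eq_sym oner_eq0.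
have cu : conjc u = u^-1 by apply: (mulfI u0); rewrite uu mulfV.
case: s; rewrite /cj /sg ?mul1r// mulN1r -exprz_inv -cu.
case: z => n; rewrite /exprz ?conjcX//.
have conjcV (z : R[i]) : conjc z^-1 = (conjc z)^-1 by exact: fmorphV.
by rewrite conjcV conjcX.
Qed.

(** Equality of characters as a congruence between exponents; conjugation changes the sign. *)
Lemma weight_exponent (u : R[i]) s1 s2 s3 (x y z : int) : u * conjc u = 1 ->
  cj s3 (u ^ x) * (cj s2 (u ^ y) * cj s1 (u ^ y)) = u ^ z ->
  u ^ (sg s3 * x + (sg s2 * y + sg s1 * y) - z) = 1.
Proof.
move=> uu; have u0 : u != 0.
  by apply/eqP => u0; move: uu; rewrite u0 mul0r => /eqP; rewrite eq_sym oner_eq0.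
by rewrite !(cj_exprz _ _ uu) -!expfzDr// => E; rewrite expfzDr// E -invr_expz
  mulfV// expfz_neq0.
Qed.

Lemma dvdz_root (u : R[i]) N z : u * conjc u = 1 ->
  (forall n, u ^+ n = 1 -> (N %| n)%N) -> u ^ z = 1 -> (N%:Z %| z)%Z.
Proof.
move=> uu dv; have u0 : u != 0.
  by apply/eqP => u0; move: uu; rewrite u0 mul0r => /eqP; rewrite eq_sym oner_eq0.
case: z => n; rewrite ?NegzE.
  by rewrite -exprnP => /dv; rewrite dvdzE.
rewrite -exprnN => /eqP; rewrite invr_eq1 => /eqP /dv.
by rewrite dvdzE abszN.
Qed.

(** Multiplication with the conjugate c0 - c1 rho, using that rho^2 is -1 modulo a. *)
Lemma small_norm (c0 c1 : int) : (a%:Z %| c0 + c1 * rho%:Z)%Z ->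
  (a%:Z %| c0 ^+ 2 + c1 ^+ 2)%Z.
Proof.
move=> H; have -> : c0 ^+ 2 + c1 ^+ 2 = (c0 - c1 * rho%:Z) * (c0 + c1 * rho%:Z)
  + c1 ^+ 2 * (rho%:Z ^+ 2 + 1) by ring.
rewrite rpredD ?dvdz_mull//.
Qed.

Lemma odd_divisor (d : int) : d \in [:: 2; 4; 8; 10; 16] -> ~ (a%:Z %| d)%Z.
Proof.
have H (n : nat) : coprime a (2 ^ n) by rewrite coprimeXr// coprime_sym coprime2n.
rewrite !inE dvdzE => + ad.
have a2 : (a %| absz d * 1)%N -> coprime a (absz d) -> False.
  by move=> + cop; rewrite Gauss_dvdr// dvdn1 => /eqP a1; move: a_gt5; rewrite a1.
rewrite muln1 in a2; do !case/orP; move/eqP => dE; rewrite dE in a2, ad.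
- exact: a2 ad (H 1%N).
- exact: a2 ad (H 2%N).
- exact: a2 ad (H 3%N).
- have : (a %| 2 * 5)%N by [].
  rewrite Gauss_dvdr; last exact: (H 1%N).
  by move/(dvdn_leq (isT : 0 < 5)%N); rewrite leqNgt a_gt5.
- exact: a2 ad (H 4%N).
Qed.

Lemma odd_divisor2 (d : int) : d \in [:: 2; -2; 4; -4] -> ~ (b%:Z %| d)%Z.
Proof.
have H (n : nat) : coprime b (2 ^ n) by rewrite coprimeXr// coprime_sym coprime2n.
rewrite !inE dvdzE => + ad.
have a2 : (b %| absz d * 1)%N -> coprime b (absz d) -> False.
  by move=> + cop; rewrite Gauss_dvdr// dvdn1 => /eqP a1; move: b_gt1; rewrite a1.
rewrite muln1 in a2; do !case/orP; move/eqP => dE; rewrite dE in a2, ad.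
- exact: a2 ad (H 1%N).
- exact: a2 ad (H 1%N).
- exact: a2 ad (H 2%N).
- exact: a2 ad (H 2%N).
Qed.

(** The character of a monomial built from two copies of coordinate 0 and one of coordinate j agrees
    with that of coordinate k only for k = j. With exponents reduced to c0 + c1 rho, small_norm
    makes a divide c0^2 + c1^2, which for the occurring values is 0, 2, 4, 8, 10 or 16; as a is odd
    and larger than 5 it must be 0. The remaining coincidences are excluded by D, because there b
    would divide 2 or 4. *)
Lemma no_resonance (j k : 'I_4) s1 s2 s3 : j != k ->
  cj s3 (omk R a rho j) * (cj s2 (omk R a rho o0) * cj s1 (omk R a rho o0)) =
    omk R a rho k ->
  cj s3 (etk R b j) * (cj s2 (etk R b o0) * cj s1 (etk R b o0)) = etk R b k ->
  False.
Proof.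
move=> jk.
have wp := om_conj R a; have ep := et_conj R b.
have e0 : et R b != 0.
  by apply/eqP => u0; move: ep; rewrite u0 mul0r => /eqP; rewrite eq_sym oner_eq0.
have omE i : omk R a rho i = om R a ^ (p0 i + p1 i * rho%:Z).
  by rewrite /omk /p0 /p1; case: ifP => _; rewrite ?mul0r ?addr0 ?add0r ?mul1r ?expr1.
have etE i : etk R b i = et R b ^ qq i.
  by rewrite /etk /qq; case: ifP => _; rewrite ?expr1z// exprN1;
     apply: (mulfI e0); rewrite ep mulfV.
rewrite !omE !etE.
move=> /(weight_exponent wp) /(dvdz_root wp (om_dvd a_gt5)) Ha.
move=> /(weight_exponent ep) /(dvdz_root ep (et_dvd b_gt1)) Hb.
set c0 := sg s3 * p0 j + sg s2 + sg s1 - p0 k.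
set c1 := sg s3 * p1 j - p1 k.
have /small_norm Ha' : (a%:Z %| c0 + c1 * rho%:Z)%Z.
  by move: Ha; congr (_ %| _)%Z; rewrite /c0 /c1 {1 2}/p0 {1 2}/p1 /=; ring.
move: (odd_divisor) (odd_divisor2) => /(_ _ _ Ha') Na /(_ _ _ Hb) Nb.
by move: jk Na Nb; rewrite /c0 /c1 {c0 c1 Ha Hb Ha'}; move: j k; elim/ord4P => //; elim/ord4P => //;
  case: s1; case: s2; case: s3 => //= _ Na Nb; (exact: Na || exact: Nb).
Qed.

End NoResonance.

(** * Derivatives under bounded linear maps *)

Section Transport.
Variable R : realType.
Local Opaque derive.

(** Unbundled, so that it applies to the plain functions built from coordinates and pairs. *)
Definition bounded_linear (V W : normedModType R) (L : V -> W) : Prop :=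
  linear L /\ exists c, forall x, `|L x| <= c * `|x|.

Lemma linearfD (V W : lmodType R) (L : V -> W) x y : linear L -> L (x + y) = L x + L y.
Proof. by move=> lL; rewrite -[x in LHS]scale1r lL scale1r. Qed.

Lemma linearf0 (V W : lmodType R) (L : V -> W) : linear L -> L 0 = 0.
Proof.
move=> lL; have := linearfD 0 0 lL; rewrite addr0 => /eqP.
by rewrite -[X in X == _]addr0 (inj_eq (addrI _)) => /eqP.
Qed.

Lemma linearfZ (V W : lmodType R) (L : V -> W) a x : linear L -> L (a *: x) = a *: L x.
Proof. by move=> lL; rewrite -[a *: x]addr0 lL (linearf0 lL) addr0. Qed.

Lemma linearfB (V W : lmodType R) (L : V -> W) x y : linear L -> L (x - y) = L x - L y.
Proof. by move=> lL; rewrite -scaleN1r (linearfD _ _ lL) (linearfZ _ _ lL) scaleN1r. Qed.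

Lemma linearf_sum (V W : lmodType R) (L : V -> W) (I : Type) (r : seq I) (F : I -> V) :
  linear L -> L (\sum_(i <- r) F i) = \sum_(i <- r) L (F i).
Proof.
move=> lL; elim: r => [|i r IH]; first by rewrite !big_nil linearf0.
by rewrite !big_cons linearfD// IH.
Qed.

Section BoundedLinear.
Context {V W : normedModType R}.
Variable L : V -> W.
Hypothesis bL : bounded_linear L.

Lemma bounded_linear_pos : exists2 c, 0 < c & forall x, `|L x| <= c * `|x|.
Proof.
have [_ [c cP]] := bL; exists (`|c| + 1) => [|x]; first by rewrite ltr_wpDl.
apply: le_trans (cP x) _; rewrite ler_wpM2r//.
by apply: le_trans (ler_norm _) _; rewrite lerDl.
Qed.

Lemma bounded_linear_continuous : continuous L.
Proof.
move=> x; have [lL _] := bL; have [c c0 cP] := bounded_linear_pos.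
apply/cvgrPdist_lt => e e0; near=> y.
rewrite -(linearfB _ _ lL); apply: le_lt_trans (cP _) _; rewrite -ltr_pdivlMl//.
near: y; have H := @cvg_id _ (nbhs x); move/cvgrPdist_lt : H; apply.
by rewrite mulr_gt0// invr_gt0.
Unshelve. all: by end_near. Qed.

End BoundedLinear.

Lemma bounded_linear_mx n (W : normedModType R) (L : 'cV[R]_n -> W) :
  linear L -> bounded_linear L.
Proof.
move=> lL; split => //; exists (\sum_i `|L (delta_mx i 0)|) => x.
have -> : L x = L (\sum_i x i 0 *: delta_mx i 0).
  congr L; rewrite {1}[x]matrix_sum_delta; apply: eq_bigr => i _.
  by rewrite big_ord_recl big_ord0 addr0.
rewrite (linearf_sum _ _ lL) mulr_suml; apply: le_trans (ler_norm_sum _ _ _) _.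
apply: ler_sum => i _; rewrite (linearfZ _ _ lL) normrZ mulrC ler_wpM2l//.
exact: mx_norm_entry.
Qed.

Lemma bounded_linear_param n m (L : 'cV[R]_n -> 'cV[R]_m) : linear L ->
  bounded_linear (fun p : 'cV[R]_n * R^o => (L p.1, p.2) : 'cV[R]_m * R^o).
Proof.
move=> lL; have [c c0 cP] := bounded_linear_pos (bounded_linear_mx lL); split.
  by move=> a [x l] [y k]; apply/pair_equal_spec; split => //=; rewrite lL.
exists (c + 1) => p; rewrite prod_normE/= ge_max; apply/andP; split.
  apply: le_trans (cP _) _; apply: ler_pM => //; first exact: ltW.
    by rewrite lerDl.
  exact: norm_fst.
apply: le_trans (norm_snd p) _; rewrite ler_peMl// lerDr; exact: ltW.
Qed.

Section Chain.
Context {U1 U2 V1 V2 : normedModType R}.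
Variables (A : U1 -> U2) (L : V2 -> V1).
Hypotheses (bA : bounded_linear A) (bL : bounded_linear L).

(** Chain rule for a map sandwiched between bounded linear maps. *)
Lemma is_derive_transport (F1 : U2 -> V2) (F2 : U1 -> V1) p v :
  (forall q, F2 q = L (F1 (A q))) -> derivable F1 (A p) (A v) ->
  is_derive p v F2 (L ('D_(A v) F1 (A p))).
Proof.
move=> E /derivableP /is_deriveP H; apply/is_deriveP => e e0.
have [lA _] := bA; have [lL _] := bL; have [c c0 cP] := bounded_linear_pos bL.
have [d d0 dH] := H _ (divr_gt0 e0 c0); exists d => // h hd.
rewrite !E (linearfD _ _ lA) (linearfZ _ _ lA) -(linearfZ _ _ lL) -!(linearfB _ _ lL).
apply: le_trans (cP _) _; rewrite -ler_pdivlMl// mulrA [c^-1 * e]mulrC.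
exact: dH.
Qed.

(** All the iterated derivatives transform alike. Applied to a symmetry of f, this
    gives the equivariance of the derivatives of f; applied to the inclusion and the
    projection of a subspace, it gives the derivatives of the reduced map. *)
Lemma iter_derive_transport (F1 : U2 -> V2) (F2 : U1 -> V1) vs :
  smooth F1 -> (forall q, F2 q = L (F1 (A q))) ->
  iter_derive vs F2 = fun q => L (iter_derive (map A vs) F1 (A q)).
Proof.
move=> sF E; elim: vs => [|v vs IH]; first exact/funext.
apply/funext => q; rewrite /= IH; apply: derive_val.
apply: (@is_derive_transport (iter_derive (map A vs) F1)) => //.
by have [_] := sF (map A vs); exact.
Qed.

Lemma smooth_transport (F1 : U2 -> V2) (F2 : U1 -> V1) :
  smooth F1 -> (forall q, F2 q = L (F1 (A q))) -> smooth F2.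
Proof.
move=> sF E vs; rewrite (iter_derive_transport vs sF E).
have [cI dI] := sF (map A vs); split => [q|p v].
  have c1 := @bounded_linear_continuous _ _ _ bA q.
  have c2 := cI (A q).
  have c3 := @bounded_linear_continuous _ _ _ bL (iter_derive (map A vs) F1 (A q)).
  have c12 := cvg_comp _ _ c1 c2.
  exact: (cvg_comp _ _ c12 c3).
by have [] := @is_derive_transport (iter_derive (map A vs) F1) _ p v (fun q => erefl) (dI _ _).
Qed.

End Chain.

Lemma derive_lincomb (U V : normedModType R) (F G : U -> V) a q x :
  derivable F q x -> derivable G q x ->
  'D_x (fun p => a *: F p + G p) q = a *: 'D_x F q + 'D_x G q.
Proof.
move=> /derivableP dF /derivableP dG; apply: derive_val.
Qed.

Lemma bounded_linear_id (V : normedModType R) : bounded_linear (@id V).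
Proof. by split => //; exists 1 => x; rewrite mul1r. Qed.

End Transport.

(** * The fixed space and equivariant third derivatives *)

Section FixSpace.
Variable R : realType.
Local Notation ii := (Complex 0 1 : R[i]).

(** QS acts as the conjugation on the first two complex coordinates and as minus the conjugation
    on the other two, so its fixed vectors are real in the former and imaginary in the latter. *)
Definition fix_coord (j : 'I_4) (r : R) : R[i] :=
  if (j < 2)%N then Complex r 0 else Complex 0 r.
Definition fix_part (j : 'I_4) (z : R[i]) : R :=
  if (j < 2)%N then complex.Re z else complex.Im z.

Definition embed (y : 'cV[R]_4) : 'cV[R]_8 := zinv (fun j => fix_coord j (y j 0)).
Definition project (x : 'cV[R]_8) : 'cV[R]_4 := \col_j fix_part j (zc j x).

Lemma fix_partK j r : fix_part j (fix_coord j r) = r.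
Proof. by rewrite /fix_part /fix_coord; case: (j < 2)%N. Qed.

Lemma zc_embed j y : zc j (embed y) = fix_coord j (y j 0).
Proof. exact: zinvK. Qed.

Lemma embedK y : project (embed y) = y.
Proof. by apply/matrixP => j k; rewrite ord1 mxE zc_embed fix_partK. Qed.

Lemma embed_fixed y : (Q_mx R * S_mx R) *m embed y = embed y.
Proof.
apply: zc_inj => k; have [p0 p1 p2 p3] := zc_QS (embed y).
by elim/ord4P: k; rewrite ?(p0, p1, p2, p3) !zc_embed; apply/eqP;
   rewrite eq_complex /= ?oppr0 ?opprK !eqxx.
Qed.

Lemma projectK x : (Q_mx R * S_mx R) *m x = x -> embed (project x) = x.
Proof.
move=> fx; apply: zc_inj => k; rewrite zc_embed mxE.
have [p0 p1 p2 p3] := zc_QS x; rewrite fx in p0 p1 p2 p3.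
have Z (r : R) : r = - r -> r = 0 by lra.
have H (z : R[i]) : z = conjc z -> Complex (complex.Re z) 0 = z.
  by case: z => u v [] /= /Z ->.
have H' (z : R[i]) : z = - conjc z -> Complex 0 (complex.Im z) = z.
  by case: z => u v [] /= /Z ->.
by elim/ord4P: k; [exact: H p0|exact: H p1|exact: H' p2|exact: H' p3].
Qed.

Lemma zc_linear k : linear (fun x : 'cV[R]_8 => fix_part k (zc k x) : R^o).
Proof.
move=> a x y; rewrite zcD zcZ /fix_part; case: (k < 2)%N.
  by case: (zc k x) => u v; case: (zc k y) => u' v' /=; rewrite mul0r subr0.
by case: (zc k x) => u v; case: (zc k y) => u' v' /=; rewrite mul0r addr0.
Qed.

Lemma project_linear : linear project.
Proof.
by move=> a x y; apply/matrixP => j k; rewrite !mxE; exact: zc_linear.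
Qed.

Lemma embed_linear : linear embed.
Proof.
move=> a x y; apply: zc_inj => k; rewrite zcD zcZ !zc_embed !mxE /fix_coord.
by case: (k < 2)%N; apply/eqP; rewrite eq_complex /=; apply/andP; split; apply/eqP; ring.
Qed.

Definition line (j : 'I_4) (c : R[i]) : 'cV[R]_8 :=
  zinv (fun k => if k == j then c else 0).

Lemma zc_line j k c : zc k (line j c) = if k == j then c else 0.
Proof. exact: zinvK. Qed.

Lemma line_real_linear j (a : R) x y :
  line j (Complex a 0 * x + y) = a *: line j x + line j y.
Proof.
by apply: zc_inj => k; rewrite zcD zcZ !zc_line; case: eqP; rewrite ?mulr0 ?addr0.
Qed.

Lemma embed_unitv j : embed (unitv R j) = line j (fix_coord j 1).
Proof.
apply: zc_inj => k; rewrite zc_embed zc_line mxE andbT.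
by case: eqVneq => [->//|_]; rewrite /fix_coord; case: ifP.
Qed.

Lemma C_line a rho j c : C_mx R a rho *m line j c = line j (omk R a rho j * c).
Proof.
apply: zc_inj => k; rewrite zc_Ck !zc_line.
by case: eqVneq => [->//|_]; rewrite mulr0.
Qed.

Lemma D_line b j c : D_mx R b *m line j c = line j (etk R b j * c).
Proof.
apply: zc_inj => k; rewrite zc_Dk !zc_line.
by case: eqVneq => [->//|_]; rewrite mulr0.
Qed.

End FixSpace.

Section ThirdDerivative.
Variable R : realType.
Local Opaque derive expi.
Variables (a b rho : nat).
Hypothesis a_odd : odd a.
Hypothesis a_gt5 : (5 < a)%N.
Hypothesis b_odd : odd b.
Hypothesis b_gt1 : (1 < b)%N.
Hypothesis rho_odd : odd rho.
Hypothesis rho_sq : (a %| rho ^ 2 + 1)%N.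
Local Notation X := 'cV[R]_8.
Local Notation U := ('cV[R]_8 * R^o)%type.
Local Notation G := (@Gab R a b rho).

(** The trilinear third derivative T(x, y, w); a sixth of its restriction to the diagonal is the cubic
    Taylor polynomial in the state. *)
Definition cubic_part (f : U -> X) (x y w : X) : X :=
  'D_(x, 0) ('D_(y, 0) ('D_(w, 0) f)) (0, 0).

Variable f : U -> X.
Hypothesis sf : smooth f.
Hypothesis ef : forall g, G g -> forall (x : X) (l : R), f (g *m x, l) = g *m f (x, l).
Hypothesis lf : forall (l : R) (v : X), 'd (fun x => f (x, l)) (0 : X) v = l *: v.

Local Notation T := (cubic_part f).

Lemma pair_lincomb (s : R) (x y : X) : (s *: x + y, 0) = s *: (x, 0) + (y, 0) :> U.
Proof. by apply/pair_equal_spec; split; rewrite //= scaler0 addr0. Qed.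

Lemma derive_dir (F : U -> X) (s : R) (x y : X) p : smooth F ->
  'D_(s *: x + y, 0) F p = s *: 'D_(x, 0) F p + 'D_(y, 0) F p.
Proof. by move=> sF; rewrite pair_lincomb smooth_deriveD// smooth_deriveZ. Qed.

Lemma cubic_part_lin1 s x x' y w : T (s *: x + x') y w = s *: T x y w + T x' y w.
Proof. exact: (derive_dir s x x' (0, 0) (smooth_derive (smooth_derive sf (w, 0)) (y, 0))). Qed.

Lemma derive_dir_fun (F : U -> X) (s : R) (x y : X) : smooth F ->
  'D_(s *: x + y, 0) F = fun p => s *: 'D_(x, 0) F p + 'D_(y, 0) F p.
Proof. by move=> sF; apply/funext => p; exact: derive_dir. Qed.

Lemma cubic_part_lin2 s x y y' w : T x (s *: y + y') w = s *: T x y w + T x y' w.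
Proof.
apply: etrans (congr1 (fun H => 'D_(x, 0) H (0, 0))
  (derive_dir_fun s y y' (smooth_derive sf (w, 0)))) _.
apply: (@derive_lincomb R U X ('D_(y, 0) ('D_(w, 0) f)) ('D_(y', 0) ('D_(w, 0) f))).
  exact: (smooth_derivable (smooth_derive (smooth_derive sf (w, 0)) (y, 0))).
exact: (smooth_derivable (smooth_derive (smooth_derive sf (w, 0)) (y', 0))).
Qed.

Lemma cubic_part_lin3 s x y w w' : T x y (s *: w + w') = s *: T x y w + T x y w'.
Proof.
have E : 'D_(y, 0) (fun p => s *: 'D_(w, 0) f p + 'D_(w', 0) f p) =
  fun p => s *: 'D_(y, 0) ('D_(w, 0) f) p + 'D_(y, 0) ('D_(w', 0) f) p.
  apply/funext => p; apply: (@derive_lincomb R U X ('D_(w, 0) f) ('D_(w', 0) f)).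
    exact: (smooth_derivable (smooth_derive sf (w, 0))).
  exact: (smooth_derivable (smooth_derive sf (w', 0))).
apply: etrans (congr1 (fun H => 'D_(x, 0) H (0, 0))
  (etrans (congr1 (fun H => 'D_(y, 0) H) (derive_dir_fun s w w' sf)) E)) _.
apply: (@derive_lincomb R U X ('D_(y, 0) ('D_(w, 0) f)) ('D_(y, 0) ('D_(w', 0) f))).
  exact: (smooth_derivable (smooth_derive (smooth_derive sf (w, 0)) (y, 0))).
exact: (smooth_derivable (smooth_derive (smooth_derive sf (w', 0)) (y, 0))).
Qed.

(** Two computations of the iterated derivative of f composed with g: by transport through the
    inner map and through the outer one. *)
Lemma iter_derive_equivariant g (vs : seq U) q : G g ->
  iter_derive (map (fun p => (g *m p.1, p.2)) vs) f (g *m q.1, q.2) =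
  g *m iter_derive vs f q.
Proof.
move=> Gg; have lg : linear (fun z : X => g *m z).
  by move=> s u v; rewrite mulmxDr -scalemxAr.
have bA := bounded_linear_param lg; have bL := bounded_linear_mx lg.
have bI := @bounded_linear_id R X; have bI' := @bounded_linear_id R U.
pose F (p : U) := f (g *m p.1, p.2).
have E1 := @iter_derive_transport R _ _ _ _ _ _ bA bI f F vs sf (fun q => erefl).
have E2 := @iter_derive_transport R _ _ _ _ _ _ bI' bL f F vs sf
  (fun q => etrans (ef Gg q.1 q.2) (congr1 (fun p => g *m f p) (esym (surjective_pairing q)))).
by move: E2; rewrite E1 map_id => /(congr1 (fun H => H q)).
Qed.

Lemma cubic_part_equivariant g x y w : G g ->
  T (g *m x) (g *m y) (g *m w) = g *m T x y w.
Proof.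
move=> Gg; rewrite /cubic_part -{1}(mulmx0 1 g).
exact: (iter_derive_equivariant [:: (x, 0); (y, 0); (w, 0)] (0, 0) Gg).
Qed.

(** The third derivative is trilinear and intertwines the diagonal actions of C and D, whose
    characters do not resonate. *)
Lemma cubic_part_off_diagonal (j k : 'I_4) x y w : j != k ->
  zc k (T (line o0 x) (line o0 y) (line j w)) = 0.
Proof.
move=> jk; pose tau x y w := zc k (T (line o0 x) (line o0 y) (line j w)).
apply: (@weight_vanish R tau _ _ _ (omk R a rho o0) (etk R b o0) (omk R a rho j)
  (etk R b j) (omk R a rho k) (etk R b k)).
- by move=> y' w' s u v; rewrite /tau line_real_linear cubic_part_lin1 zcD zcZ.
- by move=> y' w' s u v; rewrite /tau line_real_linear cubic_part_lin2 zcD zcZ.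
- by move=> y' w' s u v; rewrite /tau line_real_linear cubic_part_lin3 zcD zcZ.
- move=> x' y' w'; rewrite /tau -!C_line.
  by rewrite (cubic_part_equivariant _ _ _ (@G_C R a b rho)) zc_Ck.
- move=> x' y' w'; rewrite /tau -!D_line.
  by rewrite (cubic_part_equivariant _ _ _ (@G_D R a b rho)) zc_Dk.
- by move=> s1 s2 s3; apply: no_resonance.
Qed.

End ThirdDerivative.

(** * Reduction to the fixed space *)

Section PartialDifferential.
Variables (R : realType) (n k : nat).
Local Opaque derive.
Local Notation U := ('cV[R]_n * R^o)%type.
Variable f : U -> 'cV[R]_k.
Hypothesis sf : smooth f.

Lemma partial_linear (x : 'cV[R]_n) (l : R^o) :
  linear (fun v : 'cV[R]_n => 'D_((v, 0) : U) f (x, l)).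
Proof.
move=> a u v; have -> : (a *: u + v, 0) = a *: (u, 0) + (v, 0) :> U.
  by apply/pair_equal_spec; split; rewrite //= scaler0 addr0.
by rewrite smooth_deriveD// smooth_deriveZ.
Qed.

(** The Frechet differential in the state variable is the directional derivative, by smooth_frechet. *)
Lemma partial_diff (x : 'cV[R]_n) (l : R^o) (v : 'cV[R]_n) :
  'd (fun y => f (y, l)) x v = 'D_((v, 0) : U) f (x, l).
Proof.
pose g (v : 'cV[R]_n) := 'D_((v, 0) : U) f (x, l).
pose gl : {linear 'cV[R]_n -> 'cV[R]_k} :=
  HB.pack g (GRing.isLinear.Build _ _ _ _ g (partial_linear x l)).
suff : 'd (fun y => f (y, l)) x = gl :> (_ -> _) by move=> ->.
apply: diff_unique.
  exact: (bounded_linear_continuous (bounded_linear_mx (partial_linear x l))).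
apply/eqaddoP => e e0; have [d d0 dH] := smooth_frechet (x, l) sf e0.
near=> h; have hd : `|h| < d.
  by near: h; have H := @cvg_id _ (nbhs (0 : 'cV[R]_n)); move/cvgr0Pnorm_lt : H; apply.
have hn : `|((h, 0) : U)| = `|h|.
  by rewrite prod_normE/= normr0; apply/max_idPl.
have := dH (h, 0); rewrite hn => /(_ hd).
have -> : (x, l) + (h, 0) = (h + x, l) :> U.
  by apply/pair_equal_spec; split; rewrite /= ?addr0// addrC.
by rewrite -addrA -opprD; exact.
Unshelve. all: by end_near. Qed.

End PartialDifferential.

Section Reduction.
Variable R : realType.
Local Opaque derive expi.
Variables (a b rho : nat).
Hypothesis a_odd : odd a.
Hypothesis a_gt5 : (5 < a)%N.
Hypothesis b_odd : odd b.
Hypothesis b_gt1 : (1 < b)%N.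
Hypothesis rho_odd : odd rho.
Hypothesis rho_sq : (a %| rho ^ 2 + 1)%N.
Local Notation X := 'cV[R]_8.
Local Notation U := ('cV[R]_8 * R^o)%type.
Local Notation U4 := ('cV[R]_4 * R^o)%type.
Local Notation G := (@Gab R a b rho).

(** Half of the diagonal entries of the third derivative in direction (e0, e0, -). *)
Definition beta (f : U -> X) (j : 'I_4) : R :=
  2^-1 * project (cubic_part f (embed (unitv R ord0)) (embed (unitv R ord0))
    (embed (unitv R j))) j 0.

Definition alpha (f : U -> X) : R := beta f ord0 / 3.

(** The restriction of f to the fixed space of QS, in real coordinates. *)
Definition reduced (f : U -> X) (p : U4) : 'cV[R]_4 := project (f (embed p.1, p.2)).

Variable f : U -> X.
Hypothesis sf : smooth f.
Hypothesis ef : forall g, G g -> forall (x : X) (l : R), f (g *m x, l) = g *m f (x, l).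
Hypothesis lf : forall (l : R) (v : X), 'd (fun x => f (x, l)) (0 : X) v = l *: v.

Lemma iter_derive_reduced (vs : seq U4) q : iter_derive vs (reduced f) q =
  project (iter_derive (map (fun p => (embed p.1, p.2)) vs) f (embed q.1, q.2)).
Proof.
have bA := bounded_linear_param (@embed_linear R).
have bL := bounded_linear_mx (@project_linear R).
by rewrite (iter_derive_transport bA bL vs sf (fun q => erefl)).
Qed.

Lemma smooth_reduced : smooth (reduced f).
Proof.
have bA := bounded_linear_param (@embed_linear R).
have bL := bounded_linear_mx (@project_linear R).
exact: (smooth_transport bA bL sf (fun q => erefl)).
Qed.

Lemma QS_fixed (x : X) l : (Q_mx R * S_mx R) *m x = x ->
  (Q_mx R * S_mx R) *m f (x, l) = f (x, l).
Proof.
by move=> fx; rewrite -(ef (@G_QS R a b rho a_odd a_gt5 b_gt1 rho_odd rho_sq)) fx.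
Qed.

Lemma embed_reduced p : embed (reduced f p) = f (embed p.1, p.2).
Proof. by apply/projectK/QS_fixed/embed_fixed. Qed.

Lemma equivariant_zero l : f (0, l) = 0.
Proof.
have := ef (@G_N1 R a b rho a_odd a_gt5 b_gt1 rho_odd rho_sq) 0 l.
by rewrite mulmx0 mulNmx mul1mx => /eqP; rewrite -addr_eq0 -mulr2n -scaler_nat
  scaler_eq0 pnatr_eq0/= => /eqP.
Qed.

(** As -1 belongs to the group, f is odd in the state, and so are its second derivatives. *)
Lemma quadratic_zero (v w : X) l : 'D_((v, 0) : U) ('D_((w, 0) : U) f) (0, l) = 0.
Proof.
have N (u : X) : (- u, 0) = -1 *: (u, 0) :> U.
  by apply/pair_equal_spec; split; rewrite /= ?scaler0 ?scaleN1r.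
pose F := 'D_((w, 0) : U) f; have sF : smooth F by exact: smooth_derive.
have E1 : 'D_((- w, 0) : U) f = - F.
  by apply/funext => p; rewrite N (smooth_deriveZ _ _ _ sf) scaleN1r.
have E2 : 'D_((- v, 0) : U) (- F) (0, l) = 'D_((v, 0) : U) F (0, l).
  have dF : derivable F (0, l) (- v, 0) by exact: (smooth_derivable sF).
  apply: etrans (deriveN dF) _.
  by rewrite N (smooth_deriveZ _ _ _ sF) scaleN1r opprK.
have Z (y z : X) : z = y -> z = - y -> y = 0.
  move=> -> /eqP.
  by rewrite -addr_eq0 -mulr2n -scaler_nat scaler_eq0 pnatr_eq0/= => /eqP.
have O : 'D_((-1 *m v, 0) : U) ('D_((-1 *m w, 0) : U) f) (-1 *m 0, l) =
    -1 *m 'D_((v, 0) : U) F (0, l).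
  exact: (iter_derive_equivariant sf ef [:: (v, 0); (w, 0)] (0, l)
    (@G_N1 R a b rho a_odd a_gt5 b_gt1 rho_odd rho_sq)).
rewrite mulmx0 !(mulNmx, mul1mx) in O; apply: (Z _ _ _ O).
exact: (@etrans _ _ _ _ (congr1 (fun H => 'D_((- v, 0) : U) H (0, l)) E1) E2).
Qed.

(** The entry j is beta j by definition; the others vanish for lack of resonance. *)
Lemma cubic_part_diagonal (j : 'I_4) :
  project (cubic_part f (embed (unitv R ord0)) (embed (unitv R ord0))
    (embed (unitv R j))) = (2 * beta f j) *: unitv R j.
Proof.
apply/matrixP => k i; rewrite ord1 [RHS]mxE unitv_entry.
have [->|kj] := eqVneq k j.
  by rewrite mulr1 /beta mulrA mulfV ?mul1r// pnatr_eq0.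
have E0 : ord0 = o0 :> 'I_4 by apply: val_inj.
rewrite mulr0 E0 !embed_unitv mxE.
rewrite (cubic_part_off_diagonal a_odd a_gt5 b_odd b_gt1 rho_sq sf ef) 1?eq_sym//.
by rewrite /fix_part; case: ifP.
Qed.

(** Equivariance under -1 removes the constant and quadratic terms, the normalization gives the linear
    term, and the weights make the cubic term diagonal at e0. *)
Theorem reduced_germ : cubic_germ (reduced f) (alpha f) (beta f).
Proof.
split.
- exact: smooth_reduced.
- move=> l; rewrite /reduced /= (linearf0 (@embed_linear R)) equivariant_zero.
  exact: (linearf0 (@project_linear R)).
- move=> l v; apply: etrans (iter_derive_reduced [:: (v, 0)] (0, l)) _; rewrite /=.
  rewrite (linearf0 (@embed_linear R)) -(partial_diff sf) lf.
  by rewrite (linearfZ _ _ (@project_linear R)) embedK.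
- move=> l v w; apply: etrans (iter_derive_reduced [:: (v, 0); (w, 0)] (0, l)) _; rewrite /=.
  rewrite (linearf0 (@embed_linear R)) quadratic_zero.
  exact: (linearf0 (@project_linear R)).
- move=> j; rewrite -cubic_part_diagonal /cubic_part.
  apply: etrans (iter_derive_reduced
    [:: (unitv R ord0, 0); (unitv R ord0, 0); (unitv R j, 0)] (0, 0)) _; rewrite /=.
  by rewrite (linearf0 (@embed_linear R)).
- by rewrite /alpha mulrC divfK// pnatr_eq0.
Qed.

End Reduction.

(** * The branch and its hyperbolicity *)

Section LinearImage.
Variable R : realType.

Lemma C1_curve_linear (V W : normedModType R) (L : V -> W) eps (Y : R -> V) :
  bounded_linear L -> C1_curve eps Y -> C1_curve eps (fun t => L (Y t)).
Proof.
move=> bL [dY [cY qY]]; have cL := bounded_linear_continuous bL.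
have [lL _] := bL; exists (fun t => L (dY t)); split.
  move=> t; exact: (cvg_comp _ _ (cY t) (cL _)).
move=> t tI.
have -> : (fun s => (s - t)^-1 *: (L (Y s) - L (Y t))) =
    L \o (fun s => (s - t)^-1 *: (Y s - Y t)).
  by apply/funext => s /=; rewrite (linearfZ _ _ lL) (linearfB _ _ lL).
exact: (cvg_comp _ _ (qY t tI) (cL _)).
Qed.

Lemma bounded_linear_comp (V W Z : normedModType R) (L : W -> Z) (M : V -> W) :
  bounded_linear L -> bounded_linear M -> bounded_linear (fun x => L (M x)).
Proof.
move=> bL bM; have [c c0 cP] := bounded_linear_pos bL.
have [k k0 kP] := bounded_linear_pos bM; have [[lL _] [lM _]] := (bL, bM).
split=> [a x y|]; first by rewrite lM lL.
exists (c * k) => x; apply: le_trans (cP _) _.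
by rewrite -mulrA ler_wpM2l// ltW.
Qed.

Lemma bounded_linear_fst (V W : normedModType R) :
  bounded_linear (fun p : V * W => p.1).
Proof.
split=> [a x y //|]; exists 1 => x.
by rewrite mul1r prod_normE le_max lexx.
Qed.

Lemma bounded_linear_snd (V W : normedModType R) :
  bounded_linear (fun p : V * W => p.2).
Proof.
split=> [a x y //|]; exists 1 => x.
by rewrite mul1r prod_normE le_max lexx orbT.
Qed.

End LinearImage.

Section SignForm.
Variables (R : realType) (n : nat).

(** The quadratic form of a nearly diagonal matrix becomes definite when its rows are multiplied by
    the signs of the diagonal entries. *)
Lemma sign_form (d : 'I_n -> R) (E : 'I_n -> 'I_n -> R) (c e : R) (u : 'I_n -> R) :
  (forall j, c <= `|d j|) ->
  (forall j k, `|E j k - d j *+ (j == k)| <= e) ->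
  (c - n%:R * e) * \sum_j u j ^+ 2 <=
    \sum_j Num.sg (d j) * (u j * \sum_k u k * E j k).
Proof.
move=> dc Ee.
have -> : \sum_j Num.sg (d j) * (u j * \sum_k u k * E j k) =
    \sum_j `|d j| * u j ^+ 2 +
    \sum_j \sum_k Num.sg (d j) * (u j * u k) * (E j k - d j *+ (j == k)).
  rewrite -big_split/=; apply: eq_bigr => j _.
  under [in RHS]eq_bigr do rewrite mulrBr.
  rewrite sumrB [X in _ - X](bigD1 j)//= [X in _ - (_ + X)]big1 => [|k kj]; last first.
    by rewrite eq_sym (negbTE kj) mulr0.
  rewrite eqxx mulr1n addr0 !mulr_sumr.
  have -> : Num.sg (d j) * (u j * u j) * d j = `|d j| * u j ^+ 2.
    by rewrite normrEsg expr2; ring.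
  rewrite addrCA subrr addr0; apply: eq_bigr => k _; ring.
have sq j k : `|u j * u k| <= 2^-1 * (u j ^+ 2 + u k ^+ 2).
  rewrite normrM ler_pdivlMl// -[u j ^+ 2]real_normK ?num_real//.
  rewrite -[u k ^+ 2]real_normK ?num_real//.
  have := sqr_ge0 (`|u j| - `|u k|); nra.
have S1 : c * \sum_j u j ^+ 2 <= \sum_j `|d j| * u j ^+ 2.
  by rewrite mulr_sumr; apply: ler_sum => j _; rewrite ler_wpM2r ?sqr_ge0.
have S2 : `|\sum_j \sum_k Num.sg (d j) * (u j * u k) * (E j k - d j *+ (j == k))| <=
    n%:R * e * \sum_j u j ^+ 2.
  apply: le_trans (ler_norm_sum _ _ _) _.
  have -> : n%:R * e * \sum_j u j ^+ 2 =
      \sum_(j < n) \sum_(k < n) 2^-1 * (u j ^+ 2 + u k ^+ 2) * e.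
    set N := \sum_j u j ^+ 2.
    have E1 j : \sum_(k < n) 2^-1 * (u j ^+ 2 + u k ^+ 2) * e =
        2^-1 * (u j ^+ 2 *+ n + N) * e.
      by rewrite -mulr_suml -mulr_sumr big_split/= sumr_const card_ord.
    rewrite (eq_bigr _ (fun j _ => E1 j)) -mulr_suml -mulr_sumr big_split/=.
    by rewrite sumr_const card_ord sumrMnl -/N -[N *+ n]mulr_natl; field.
  apply: ler_sum => j _; apply: le_trans (ler_norm_sum _ _ _) _.
  apply: ler_sum => k _; rewrite !normrM; apply: ler_pM => //.
    apply: le_trans (sq j k); rewrite -normrM normrM ler_piMl//.
    by rewrite normr_sg; case: (d j == 0).
move: S2; rewrite ler_norml => /andP[S2 _]; rewrite mulrBl; lra.
Qed.

End SignForm.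

Section HyperbolicBranch.
Variable R : realType.
Local Opaque derive expi.
Variables (a b rho : nat).
Hypothesis a_odd : odd a.
Hypothesis a_gt5 : (5 < a)%N.
Hypothesis b_odd : odd b.
Hypothesis b_gt1 : (1 < b)%N.
Hypothesis ab_coprime : coprime a b.
Hypothesis rho_odd : odd rho.
Hypothesis rho_sq : (a %| rho ^ 2 + 1)%N.
Local Notation X := 'cV[R]_8.
Local Notation U := ('cV[R]_8 * R^o)%type.
Local Notation U4 := ('cV[R]_4 * R^o)%type.
Local Notation G := (@Gab R a b rho).
Local Notation K0 := (@reflection_group R).

Variable f : U -> X.
Hypothesis sf : smooth f.
Hypothesis ef : forall g, G g -> forall (x : X) (l : R), f (g *m x, l) = g *m f (x, l).
Hypothesis lf : forall (l : R) (v : X), 'd (fun x => f (x, l)) (0 : X) v = l *: v.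
Local Notation h := (reduced f).

(** For an imaginary eigenvalue the sign-weighted forms at the real and the imaginary part of the
    eigenvector add up to 0, while sign_form bounds them below by a positive multiple
    of the squared length. *)
Lemma no_imaginary_eigenvalue (B : 'cV[R]_4 -> 'cV[R]_4) (d : 'I_4 -> R) (s c e m : R)
  (u v : 'cV[R]_4) : linear B -> 0 < s -> 4%:R * e < c -> (forall j, c <= `|d j|) ->
  (forall j k, `|(s *: B (unitv R k)) j 0 - d j *+ (j == k)| <= e) ->
  B u = - (m *: v) -> B v = m *: u -> u = 0 /\ v = 0.
Proof.
move=> lB s0 ec dc Ee Bu Bv.
have BE w j : s * B w j 0 = \sum_k w k 0 * (s *: B (unitv R k)) j 0.
  have -> : B w = B (\sum_i w i 0 *: unitv R i).
    congr B; rewrite {1}[w]matrix_sum_delta; apply: eq_bigr => i _.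
    by rewrite big_ord_recl big_ord0 addr0.
  rewrite (linearf_sum _ _ lB) summxE mulr_sumr; apply: eq_bigr => k _.
  by rewrite (linearfZ _ _ lB) !mxE mulrCA.
have H (w : 'cV[R]_4) := sign_form (fun j => w j 0) dc Ee.
have Z : \sum_j Num.sg (d j) * (u j 0 * \sum_k u k 0 * (s *: B (unitv R k)) j 0) +
    \sum_j Num.sg (d j) * (v j 0 * \sum_k v k 0 * (s *: B (unitv R k)) j 0) = 0.
  rewrite -big_split/= big1// => j _; rewrite -!BE Bu Bv !mxE; ring.
have sq0 (w : 'cV[R]_4) : 0 <= \sum_j w j 0 ^+ 2 by apply: sumr_ge0 => j _; exact: sqr_ge0.
have zero (w : 'cV[R]_4) : \sum_j w j 0 ^+ 2 = 0 -> w = 0.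
  move=> /eqP; rewrite psumr_eq0 => [/allP w0|j _]; last exact: sqr_ge0.
  apply/matrixP => j i; rewrite ord1 mxE; apply/eqP.
  by have := w0 j (mem_index_enum _); rewrite sqrf_eq0.
have := H u; have := H v; move: (sq0 u) (sq0 v) Z.
move: (\sum_j Num.sg _ * _) (\sum_j Num.sg (d j) * (v j 0 * _)) => p q.
have := zero u; have := zero v.
move: (\sum_j u j 0 ^+ 2) (\sum_j v j 0 ^+ 2) => su sv zv zu su0 sv0 Z Hv Hu.
have k0 : 0 < c - 4%:R * e by rewrite subr_gt0.
have : (c - 4%:R * e) * (su + sv) <= 0 by rewrite mulrDr; lra.
rewrite pmulr_rle0// => suv; split; [apply: zu|apply: zv]; lra.
Qed.

(** The diagonal entries are beta j - alpha, which for j = 0 is 2 alpha. *)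
Theorem hyperbolic_branch : alpha f != 0 ->
  (forall j, j != ord0 -> beta f j != alpha f) ->
  exists eps x l, zero_branch G f K0 eps x l /\ hyperbolic_within_Fix f K0 x l.
Proof.
move=> a0 ba; have hg := reduced_germ a_odd a_gt5 b_odd b_gt1 rho_odd rho_sq sf ef lf.
have [eps eps0 [Y [Y0 C1Y Yz YD]]] := cubic_germ_branch hg ba.
have bE := bounded_linear_mx (@embed_linear R).
exists eps, (fun t => embed (Y t).1), (fun t => (Y t).2); split.
  split => //.
  - have bL := bounded_linear_comp bE (bounded_linear_fst 'cV[R]_4 R^o).
    exact: (C1_curve_linear bL C1Y).
  - exact: (C1_curve_linear (bounded_linear_snd 'cV[R]_4 R^o) C1Y).
  - by rewrite Y0 /= (linearf0 (@embed_linear R)).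
  move=> t; rewrite in_itv/= => /Yz[y0 hy0].
  have x0 : embed (Y t).1 != 0.
    apply: contra y0 => /eqP E; rewrite -[(Y t).1]embedK E.
    by apply/eqP/(linearf0 (@project_linear R)).
  split => //.
    have := embed_reduced a_odd a_gt5 b_gt1 rho_odd rho_sq ef (Y t).
    by rewrite hy0 (linearf0 (@embed_linear R)) => <-.
  apply: (isotropy_fix a_odd a_gt5 b_odd b_gt1 ab_coprime rho_odd rho_sq x0).
  exact: embed_fixed.
pose d j := beta f j - alpha f.
have dn j : d j != 0.
  have [->|/ba] := eqVneq j ord0; last by rewrite subr_eq0.
  by rewrite /d (germ_beta0 hg) -[X in _ - X]mul1r -mulrBl mulf_neq0//; lra.
have [c c0 dc] : exists2 c, 0 < c & forall j, c <= `|d j|.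
  exists (Num.min (Num.min `|d o0| `|d o1|) (Num.min `|d o2| `|d o3|)).
    by rewrite !lt_min !normr_gt0 !dn.
  by elim/ord4P; rewrite !ge_min lexx ?orbT.
have e0 : 0 < c / 8 by rewrite divr_gt0.
(* Four entries with error c / 8 leave half of the lower bound c in sign_form. *)
have near_all : \forall t \near 0^'+, forall k,
    `|(t ^+ 2)^-1 *: 'D_((unitv R k, 0) : U4) h (Y t) - d k *: unitv R k| <= c / 8.
  by apply: filter_forall => k; move: (YD k) => /cvgrPdistC_le; apply.
near=> t => mu; move=> [u [v [fu fv uv Lu Lv]]]; apply/negP => /eqP mu0.
have t0 : 0 < t by near: t; exact: nbhs_right_gt.
have lD := partial_linear (smooth_reduced sf) (Y t).1 (Y t).2.
rewrite -surjective_pairing in lD.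
have fixE w : Fix K0 w -> embed (project w) = w.
  by move=> fw; apply: projectK; apply: fw; right.
have PD w : Fix K0 w -> project ('d (fun y => f (y, (Y t).2)) (embed (Y t).1) w) =
    'D_((project w, 0) : U4) h (Y t).
  move=> fw; rewrite (partial_diff sf).
  apply/esym; apply: etrans (iter_derive_reduced sf [:: (project w, 0)] (Y t)) _.
  by rewrite /= fixE.
have := @no_imaginary_eigenvalue _ d (t ^+ 2)^-1 c (c / 8) (complex.Im mu)
  (project u) (project v) lD.
case.
- by rewrite invr_gt0 exprn_gt0.
- lra.
- exact: dc.
- move=> j k; have : `|(t ^+ 2)^-1 *: 'D_((unitv R k, 0) : U4) h (Y t) - d k *: unitv R k| <= c / 8.
    by move: k; near: t; exact: near_all.
  move=> /(le_trans (mx_norm_entry _ j 0)); rewrite [X in `|X|]mxE [X in _ + X]mxE [X in _ - X]mxE.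
  rewrite unitv_entry; have [->|_] := eqVneq j k; first by rewrite mulr1.
  by rewrite mulr0.
- rewrite -PD// Lu mu0 scale0r sub0r -scaleNr.
  by rewrite (linearfZ _ _ (@project_linear R)) scaleNr.
- by rewrite -PD// Lv mu0 scale0r addr0 (linearfZ _ _ (@project_linear R)).
move=> pu pv; apply: uv; rewrite -(fixE u fu) -(fixE v fv) pu pv.
by rewrite (linearf0 (@embed_linear R)).
Unshelve. all: by end_near. Qed.

End HyperbolicBranch.

(** * The topology of smooth convergence on compact sets *)

Section FunctionSpace.
Variable R : realType.

(** The universal property of the topology of pointwise convergence. *)
Lemma continuous_ptws (S T : topologicalType) (I : Type) (g : S -> {ptws I -> T}) :
  (forall i, continuous (fun s => g s i)) -> continuous g.
Proof.
move=> H x; apply/cvg_sup => i; move: x.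
apply/(@continuousP _ (initial_topology (@^~ i))) => A [B oB <-].
have /continuousP HB := H i; exact: (HB B oB).
Qed.

Section Evaluation.
Context {U V : normedModType R}.

Lemma family_eval_continuous (p : U) :
  continuous (fun g : {family compact, U -> V} => g p).
Proof.
move=> g Q /nbhs_ballP[e /= e0 eQ].
have entE : entourage [set xy : V * V | ball xy.1 e xy.2].
  exact: (@entourage_ball _ _ (PosNum e0)).
have := @fam_nbhs U V (@compact U) [set p] _ g entE (@compact_set1 _ p).
by apply: filterS => h /(_ p erefl) /eQ.
Qed.

(** Each derivative at each point is a continuous function on the function space. *)
Lemma iter_derive_continuous vs (p : U) :
  continuous (fun f : Cinfty_space U V => iter_derive vs f p).
Proof.
move=> f; have c1 := @initial_continuous _ _ (@all_derivatives R U V) f.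
have c2 := @proj_continuous _ (fun _ : seq U => {family compact, U -> V}) vs
  (all_derivatives f).
have c3 := @family_eval_continuous p (all_derivatives f vs).
have c12 := cvg_comp _ _ c1 c2.
exact: (cvg_comp _ _ c12 c3).
Qed.

(** On a compact set every derivative of P is bounded, so all derivatives of f + s P depend on s
    uniformly there. *)
Lemma Cinfty_line_continuous (f P : U -> V) :
  smooth P ->
  (forall s vs p, iter_derive vs (fun p => f p + s *: P p) p =
     iter_derive vs f p + s *: iter_derive vs P p) ->
  continuous (fun s : R => (fun p => f p + s *: P p) : Cinfty_space U V).
Proof.
move=> sP E; apply: continuous_comp_initial; apply: continuous_ptws => vs s.
apply/fam_cvgP => A cA Q /uniform_nbhs [B [entB BQ]].
have [e /= e0 eB] : exists2 e : R, 0 < e & forall x y : V, `|x - y| < e -> B (x, y).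
  move: entB; rewrite -entourage_ballE => -[e /= e0 eB]; exists e => // x y xy.
  by apply: eB; rewrite /= -ball_normE.
have [M [_ MP]] := compact_bounded (continuous_compact
  (continuous_subspaceT (sP vs).1) cA).
pose N := `|M| + 1.
have NP y : A y -> `|iter_derive vs P y| <= N.
  by move=> Ay; apply: MP; [rewrite /N; apply: le_lt_trans (ler_norm _) _; rewrite ltrDl|exists y].
have N0 : 0 < N by rewrite /N ltr_wpDl.
apply: (@filterS _ (nbhs s) _ [set t | `|s - t| < e / N]).
  move=> t /= st; apply: BQ => y Ay; apply: eB.
  rewrite -[X in `|X - _|]/(iter_derive vs (fun p => f p + s *: P p) y).
  rewrite -[X in `|_ - X|]/(iter_derive vs (fun p => f p + t *: P p) y) !E.
  rewrite opprD addrACA subrr add0r -scalerBl normrZ.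
  apply: le_lt_trans (_ : _ <= `|s - t| * N) _; first by rewrite ler_wpM2l// NP.
  by rewrite -ltr_pdivlMr.
have H := @cvg_id _ (nbhs s); move/cvgrPdist_lt : H; apply.
by rewrite divr_gt0.
Qed.

End Evaluation.
End FunctionSpace.

(** * Smoothness of polynomial maps *)

Section SmoothClosure.
Variable R : realType.
Local Opaque derive.
Context {U V : normedModType R}.

Lemma iter_derive_lincomb (f g : U -> V) s vs : smooth f -> smooth g ->
  iter_derive vs (fun p => f p + s *: g p) =
  fun p => iter_derive vs f p + s *: iter_derive vs g p.
Proof.
move=> sf sg; elim: vs => //= v vs ->; apply/funext => p.
have /derivableP df := (sf vs).2 p v; have /derivableP dg := (sg vs).2 p v.
apply: derive_val; apply: is_deriveD; exact: is_deriveZ.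
Qed.

Lemma smooth_lincomb (f g : U -> V) s : smooth f -> smooth g ->
  smooth (fun p => f p + s *: g p).
Proof.
move=> sf sg vs; rewrite iter_derive_lincomb//; split=> [p|p v].
  have c1 := (sf vs).1 p; have c2 := (sg vs).1 p.
  by apply: cvgD => //; apply: cvgZr.
have /derivableP df := (sf vs).2 p v; have /derivableP dg := (sg vs).2 p v.
by have [] : is_derive p v (fun p => iter_derive vs f p + s *: iter_derive vs g p)
  ('D_v (iter_derive vs f) p + s *: 'D_v (iter_derive vs g) p)
  by apply: is_deriveD; exact: is_deriveZ.
Qed.

Lemma smooth_zero : smooth (fun _ : U => 0 : V).
Proof.
have E vs : iter_derive vs (fun _ : U => 0 : V) = fun=> 0.
  by elim: vs => //= v vs ->; apply/funext => p; rewrite -[fun=> 0]/(cst 0) derive_cst.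
by move=> vs; rewrite E; split=> [p|p v]; [exact: cst_continuous|exact: derivable_cst].
Qed.

Lemma smooth_sum n (f : 'I_n -> U -> V) : (forall i, smooth (f i)) ->
  smooth (fun p => \sum_i f i p).
Proof.
move=> sf; have -> : (fun p => \sum_i f i p) = \sum_i f i.
  by apply/funext => p; rewrite fct_sumE.
elim/big_ind: _ => // [|g h sg sh]; first exact: smooth_zero.
have -> : g + h = fun p => g p + 1 *: h p by apply/funext => p; rewrite scale1r.
exact: smooth_lincomb.
Qed.

End SmoothClosure.

Section Polynomials.
Variable R : realType.
Local Opaque derive.
Context {U : normedModType R}.

(** A class of scalar functions that is closed under directional derivatives, and hence consists of
    smooth functions. *)
Inductive polynomial : (U -> R^o) -> Prop :=
| poly_affine c (L : U -> R^o) : bounded_linear L -> polynomial (fun p => c + L p)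
| poly_add f g : polynomial f -> polynomial g -> polynomial (fun p => f p + g p)
| poly_mul f g : polynomial f -> polynomial g -> polynomial (fun p => f p * g p).

Lemma poly_const c : polynomial (fun=> c).
Proof.
have bz : bounded_linear (fun _ : U => 0 : R^o).
  split=> [k x y|]; first by rewrite scaler0 addr0.
  by exists 0 => x; rewrite normr0 mul0r.
have -> : (fun=> c) = (fun p : U => c + (fun _ : U => 0 : R^o) p).
  by apply/funext => p; rewrite addr0.
exact: poly_affine.
Qed.

Lemma poly_linear (L : U -> R^o) : bounded_linear L -> polynomial L.
Proof.
move=> bL; have -> : L = fun p => 0 + L p by apply/funext => p; rewrite add0r.
exact: poly_affine.
Qed.

Lemma poly_continuous f : polynomial f -> continuous f.
Proof.
elim=> [c L bL|g h _ cg _ ch|g h _ cg _ ch] p.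
- by apply: cvgD; [exact: cvg_cst|exact: bounded_linear_continuous].
- by apply: cvgD; [exact: cg|exact: ch].
- by apply: cvgM; [exact: cg|exact: ch].
Qed.

Lemma poly_derive f v : polynomial f ->
  exists2 f', polynomial f' & forall p, is_derive p v f (f' p).
Proof.
elim=> [c L bL|g h pg [g' pg' dg] ph [h' ph' dh]|g h pg [g' pg' dg] ph [h' ph' dh]].
- exists (fun=> L v) => [|p]; first exact: poly_const.
  apply/is_deriveP => e e0; exists 1 => // k _; have [lL _] := bL.
  rewrite (linearfD _ _ lL) (linearfZ _ _ lL) opprD addrACA subrr add0r.
  by rewrite addrAC addrK subrr normr0 mulr_ge0// ltW.
- exists (fun p => g' p + h' p) => [|p]; first exact: poly_add.
  by have ? := dg p; have ? := dh p; exact: is_deriveD.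
- exists (fun p => g p * h' p + h p * g' p) => [|p].
    by apply: poly_add; apply: poly_mul.
  by have ? := dg p; have ? := dh p; exact: is_deriveM.
Qed.

Lemma poly_smooth f : polynomial f -> smooth f.
Proof.
move=> pf vs; suff pI : polynomial (iter_derive vs f).
  split=> [|p v]; first exact: poly_continuous.
  by have [f' _ /(_ p)[]] := poly_derive v pI.
elim: vs => //= v vs IH; have [f' pf' df] := poly_derive v IH.
have -> : 'D_v (iter_derive vs f) = f'; last by [].
by apply/funext => p; apply: derive_val; exact: df.
Qed.

End Polynomials.

(** * An equivariant cubic vector field *)

Section CubicField.
Variable R : realType.
Local Opaque derive expi.
Local Notation X := 'cV[R]_8.
Local Notation U := ('cV[R]_8 * R^o)%type.
Local Notation ii := (Complex 0 1 : R[i]).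

Definition cube (z : R[i]) : R[i] := z * (z * conjc z).

Lemma cubeN z : cube (- z) = - cube z.
Proof. by rewrite /cube conjcN mulrNN mulNr. Qed.

Lemma cube_conj z : cube (conjc z) = conjc (cube z).
Proof. by rewrite /cube !conjcM conjcK [conjc z * z]mulrC. Qed.

Lemma cubeM w z : w * conjc w = 1 -> cube (w * z) = w * cube z.
Proof.
move=> w1; rewrite /cube conjcM; transitivity (w * z * ((w * conjc w) * (z * conjc z))).
  by move: (conjc w) (conjc z) => w' z'; ring.
by rewrite w1 mul1r -mulrA.
Qed.

(** The map with complex coordinates z |z|^2. It is equivariant because the generators act on
    each coordinate through unit complex numbers, conjugation and permutations. *)
Definition cubic_field (p : U) : X := zinv (fun k => cube (zc k p.1)).

Lemma zc_cubic_field k p : zc k (cubic_field p) = cube (zc k p.1).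
Proof. exact: zinvK. Qed.

Let re k (x : X) : R^o := complex.Re (zc k x).
Let im k (x : X) : R^o := complex.Im (zc k x).

Let re_linear k : bounded_linear (fun p : U => re k p.1).
Proof.
apply: bounded_linear_comp (bounded_linear_fst _ _); apply: bounded_linear_mx.
move=> a x y; rewrite /re zcD zcZ.
by case: (zc k x) => u v; case: (zc k y) => u' v' /=; rewrite mul0r subr0.
Qed.

Let im_linear k : bounded_linear (fun p : U => im k p.1).
Proof.
apply: bounded_linear_comp (bounded_linear_fst _ _); apply: bounded_linear_mx.
move=> a x y; rewrite /im zcD zcZ.
by case: (zc k x) => u v; case: (zc k y) => u' v' /=; rewrite mul0r addr0.
Qed.

Lemma cubic_field_smooth : smooth cubic_field.
Proof.
pose N k (p : U) : R^o := re k p.1 * re k p.1 + im k p.1 * im k p.1.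
have E : cubic_field = fun p => \sum_k (fun p => (re k p.1 * N k p) *: line k 1 +
    1 *: ((im k p.1 * N k p) *: line k ii)) p.
  apply/funext => p; apply: zc_inj => k.
  have zsum (F : 'I_4 -> X) : zc k (\sum_i F i) = \sum_i zc k (F i).
    by elim/big_rec2: _ => [|i x y _ <-]; rewrite ?zc0// zcD.
  rewrite zc_cubic_field zsum (bigD1 k)//= big1 => [|i ik].
    rewrite scale1r zcD !zcZ !zc_line eqxx addr0 /cube /N /re /im.
    case: (zc k p.1) => u v /=; apply/eqP; rewrite eq_complex /=.
    by apply/andP; split; apply/eqP; ring.
  by rewrite scale1r zcD !zcZ !zc_line eq_sym (negbTE ik) !mulr0 addr0.
have pN k : polynomial (N k).
  by apply: poly_add; apply: poly_mul; apply: poly_linear.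
have bs (w : X) : bounded_linear (fun r : R^o => r *: w).
  split=> [a x y|]; first by rewrite scalerDl scalerA.
  by exists `|w| => x; rewrite normrZ mulrC.
have sp (g : U -> R^o) (w : X) : polynomial g -> smooth (fun p => g p *: w).
  move=> /poly_smooth sg.
  exact: (smooth_transport (@bounded_linear_id R U) (bs w) sg (fun q => erefl)).
rewrite E; apply: smooth_sum => k; apply: smooth_lincomb; apply: sp;
  by apply: poly_mul => //; apply: poly_linear.
Qed.

Section Equivariance.
Variables (a b rho : nat).
Hypothesis a_odd : odd a.
Hypothesis a_gt5 : (5 < a)%N.
Hypothesis b_gt1 : (1 < b)%N.
Hypothesis rho_odd : odd rho.
Hypothesis rho_sq : (a %| rho ^ 2 + 1)%N.

(** The invertible matrices that commute with the field form a group, and it contains the generators. *)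
Lemma cubic_field_equivariant g : @Gab R a b rho g ->
  forall x l, cubic_field (g *m x, l) = g *m cubic_field (x, l).
Proof.
move=> Gg; pose H := [set g : 'M[R]_8 | g \in unitmx /\
  forall x l, cubic_field (g *m x, l) = g *m cubic_field (x, l)].
suff : H g by case.
have gH : is_mx_group H.
  split=> [|h k [uh Eh] [uk Ek]|h [uh Eh]].
  - by split=> [|x l]; rewrite ?unitmx1// !mul1mx.
  - by split=> [|x l]; rewrite ?unitmx_mul ?uh// -!mulmxA Eh Ek.
  - split=> //; split=> [|x l]; rewrite ?unitmx_inv//.
    by rewrite -[X in _ = _ *m cubic_field (X, l)](mulKVmx uh) Eh mulKmx.
apply: Gg; split => // h hin; split.
  have Gh : @Gab R a b rho h by exact: G_generator.
  by have [] := G_unit a_odd a_gt5 b_gt1 rho_odd rho_sq Gh.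
move=> x l; apply: zc_inj => k; rewrite zc_cubic_field /=.
move: hin; rewrite /= !inE => /or4P[/eqP ->|/eqP ->|/eqP ->|/orP[] /eqP ->].
- by rewrite !zc_Ck zc_cubic_field cubeM// omk_conj.
- by rewrite !zc_Dk zc_cubic_field cubeM// etk_conj.
- have [p0 p1 p2 p3] := zc_Q x.
  have [q0 q1 q2 q3] := zc_Q (cubic_field (x, l)).
  by elim/ord4P: k; rewrite ?(p0, p1, p2, p3, q0, q1, q2, q3) !zc_cubic_field ?cubeN.
- have [p0 p1 p2 p3] := zc_S x.
  have [q0 q1 q2 q3] := zc_S (cubic_field (x, l)).
  by elim/ord4P: k; rewrite ?(p0, p1, p2, p3, q0, q1, q2, q3) !zc_cubic_field ?cubeN ?cube_conj.
- have [p0 p1 p2 p3] := zc_V x.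
  have [q0 q1 q2 q3] := zc_V (cubic_field (x, l)).
  by elim/ord4P: k; rewrite ?(p0, p1, p2, p3, q0, q1, q2, q3) !zc_cubic_field ?cubeN ?cube_conj.
Qed.

End Equivariance.

Lemma cubic_field_scale s x l : cubic_field (s *: x, l) = s ^+ 3 *: cubic_field (x, l).
Proof.
apply: zc_inj => k; rewrite zcZ !zc_cubic_field /= zcZ /cube.
case: (zc k x) => u v; apply/eqP; rewrite eq_complex /=.
by apply/andP; split; apply/eqP; ring.
Qed.

Lemma cubic_field_linear0 v l : 'D_((v, 0) : U) cubic_field (0, l) = 0.
Proof.
apply: derive_val; apply/is_deriveP => e e0.
set w := cubic_field (v, l); have N0 : 0 < `|w| + 1 by rewrite ltr_wpDl.
exists (Num.min 1 (e / (`|w| + 1))) => [|h]; first by rewrite lt_min ltr01 divr_gt0.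
rewrite lt_min => /andP[h1 he].
have -> : (0, l) + h *: (v, 0) = (h *: v, l) :> U.
  by apply/pair_equal_spec; split; rewrite /= ?add0r// scaler0 addr0.
have z0 : cubic_field (0, l) = 0.
  by have := cubic_field_scale 0 0 l; rewrite scale0r expr0n scale0r.
rewrite cubic_field_scale z0 scaler0 !subr0 normrZ exprSr normrM mulrAC ler_wpM2r//.
rewrite expr2 normrM -mulrA; apply: le_trans (_ : _ <= 1 * (`|h| * `|w|)) _.
  by rewrite ler_wpM2r ?mulr_ge0// ltW.
rewrite mul1r; move: he; rewrite ltr_pdivlMr// => /ltW; apply: le_trans.
by rewrite ler_wpM2l// lerDl.
Qed.

End CubicField.

(** * Effect of the cubic field on the third derivatives *)

Section Perturbation.
Variable R : realType.
Local Opaque derive expi.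
Local Notation X := 'cV[R]_8.
Local Notation U := ('cV[R]_8 * R^o)%type.
Local Notation P := (@cubic_field R).

Lemma project_entry_bounded j : bounded_linear (fun x : X => project x j 0 : R^o).
Proof. by apply: bounded_linear_mx => a x y; rewrite project_linear !mxE. Qed.

(** Third derivatives depend linearly on the map. *)
Lemma beta_lincomb (f g : U -> X) s j : smooth f -> smooth g ->
  beta (fun p => f p + s *: g p) j = beta f j + s * beta g j.
Proof.
move=> sf sg; rewrite /beta.
set e := embed (unitv R ord0); set w := embed (unitv R j).
have -> : cubic_part (fun p => f p + s *: g p) e e w =
    cubic_part f e e w + s *: cubic_part g e e w.
  exact: (congr1 (fun H => H (0, 0))
    (iter_derive_lincomb s [:: (e, 0); (e, 0); (w, 0)] sf sg)).
have [lP _] := project_entry_bounded j.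
have E u v : project (s *: u + v) j 0 = s * project u j 0 + project v j 0 by exact: lP.
by rewrite addrC E mulrDr addrC mulrCA.
Qed.

Lemma cube_iter_derive :
  iter_derive ([:: 1; 1; 1] : seq R^o) (fun t : R^o => t ^+ 3 : R^o) 0 = 6.
Proof.
have D k (c : R) : 'D_1 (fun t : R^o => c * t ^+ k.+1 : R^o) =
    fun t => (c * k.+1%:R) * t ^+ k.
  apply/funext => t; apply: derive_val; have ? := is_derive_pow k t.
  by rewrite -mulrA; exact: is_deriveZ.
have -> : (fun t : R^o => t ^+ 3 : R^o) = fun t : R^o => 1 * t ^+ 3.
  by apply/funext => t; rewrite mul1r.
apply: etrans (congr1 (fun F : R^o -> R^o => 'D_1 ('D_1 F) 0) (D 2%N 1)) _.
apply: etrans (congr1 (fun F : R^o -> R^o => 'D_1 F 0) (D 1%N (1 * 3%:R))) _.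
apply: etrans (congr1 (fun F : R^o -> R^o => F 0) (D 0%N (1 * 3%:R * 2%:R))) _.
by rewrite expr0 mul1r !mulr1 -natrM.
Qed.

(** On the line through e0 the field is t |-> t^3 e0, whose third derivative is 6. *)
Lemma beta_cubic_field0 : beta P ord0 = 3.
Proof.
set e := embed (unitv R ord0).
have bA : bounded_linear (fun t : R^o => (t *: e, 0) : U).
  split=> [a x y|].
    by apply/pair_equal_spec; split; rewrite /= ?scaler0 ?addr0// scalerDl scalerA.
  exists `|e| => t; rewrite prod_normE/= normr0 max_l// normrZ mulrC//.
have E t : t ^+ 3 = project (P (t *: e, 0)) ord0 0.
  rewrite cubic_field_scale (linearfZ _ _ (@project_linear R)) !mxE.
  rewrite zc_cubic_field /= zc_embed unitv_entry eqxx /fix_coord /fix_part /=.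
  by rewrite /cube /=; ring.
have := iter_derive_transport bA (project_entry_bounded ord0) ([:: 1; 1; 1] : seq R^o)
  (@cubic_field_smooth R) E.
move=> /(congr1 (fun H => H 0)); rewrite cube_iter_derive /= !scale1r scale0r => H.
by rewrite /beta /cubic_part -/e -H; lra.
Qed.

(** The coordinate j of the field depends only on the coordinate j of the argument, so its
    derivative along e0 vanishes. *)
Lemma beta_cubic_field j : j != ord0 -> beta P j = 0.
Proof.
move=> j0; set e := embed (unitv R ord0); set w := embed (unitv R j).
have bI := @bounded_linear_id R U; have bI' := @bounded_linear_id R (R^o).
pose g (p : U) : R^o := project (P p) j 0.
have sg : smooth g.
  exact: (smooth_transport bI (project_entry_bounded j) (@cubic_field_smooth R) (fun q => erefl)).
(* The projection to the j-th complex line does not change g and maps e to 0. *)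
have ll : linear (fun x : X => line j (zc j x)).
  by move=> a x y; rewrite zcD zcZ line_real_linear.
have bA := bounded_linear_param ll.
have gA q : g q = id (g (line j (zc j q.1), q.2)).
  by rewrite /g !mxE !zc_cubic_field /= zc_line eqxx.
have E1 := iter_derive_transport bI (project_entry_bounded j) [:: (e, 0); (e, 0); (w, 0)]
  (@cubic_field_smooth R) (fun q => erefl).
have E2 := iter_derive_transport bA bI' [:: (e, 0); (e, 0); (w, 0)] sg gA.
have ze : line j (zc j e) = 0.
  apply: zc_inj => k; rewrite zc_line zc0 /e zc_embed unitv_entry (negbTE j0).
  by rewrite /fix_coord; case: (k == j); case: (j < 2)%N.
rewrite /beta /cubic_part -/e -/w.
have : iter_derive [:: (e, 0); (e, 0); (w, 0)] g (0, 0) = 0.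
  rewrite E2 /= ze; exact: derive0.
by rewrite E1 /= => ->; rewrite mulr0.
Qed.

End Perturbation.

(** * Genericity *)

Section Generic.
Variable R : realType.
Local Opaque derive expi.
Local Notation X := 'cV[R]_8.
Local Notation U := ('cV[R]_8 * R^o)%type.
Local Notation P := (@cubic_field R).
Variables (a b rho : nat).
Hypothesis a_odd : odd a.
Hypothesis a_gt5 : (5 < a)%N.
Hypothesis b_odd : odd b.
Hypothesis b_gt1 : (1 < b)%N.
Hypothesis ab_coprime : coprime a b.
Hypothesis rho_odd : odd rho.
Hypothesis rho_sq : (a %| rho ^ 2 + 1)%N.
Local Notation G := (@Gab R a b rho).

(** Its nonvanishing is the nondegeneracy condition of hyperbolic_branch. *)
Definition discriminant (f : U -> X) : R :=
  alpha f * ((beta f o1 - alpha f) * ((beta f o2 - alpha f) * (beta f o3 - alpha f))).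

Lemma beta_continuous j : continuous (fun f : Cinfty_space U X => beta f j : R^o).
Proof.
move=> f; have c1 := @iter_derive_continuous R U X [:: (embed (unitv R ord0), 0);
  (embed (unitv R ord0), 0); (embed (unitv R j), 0)] (0, 0) f.
have bL : bounded_linear (fun x : X => 2^-1 * project x j 0 : R^o).
  apply: bounded_linear_mx => s x y; have [lP _] := project_entry_bounded R j.
  have E : project (s *: x + y) j 0 = s * project x j 0 + project y j 0 by exact: lP.
  by rewrite E mulrDr mulrCA.
have c2 := @bounded_linear_continuous _ _ _ _ bL
  (cubic_part f (embed (unitv R ord0)) (embed (unitv R ord0)) (embed (unitv R j))).
exact: (cvg_comp _ _ c1 c2).
Qed.

Lemma discriminant_continuous :
  continuous (fun f : Cinfty_space U X => discriminant f : R^o).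
Proof.
move=> f; have cb j := @beta_continuous j f.
have bL : bounded_linear (fun r : R^o => r / 3 : R^o).
  split=> [s x y|]; first by rewrite mulrDl -mulrA.
  by exists `|3^-1| => x; rewrite normrM mulrC.
have ca : continuous_at f (fun f : Cinfty_space U X => alpha f : R^o).
  exact: (cvg_comp _ _ (cb ord0) (@bounded_linear_continuous _ _ _ _ bL _)).
have cd j : continuous_at f (fun f : Cinfty_space U X => beta f j - alpha f : R^o).
  exact: (cvgB (cb j) ca).
exact: (cvgM ca (cvgM (cd o1) (cvgM (cd o2) (cd o3)))).
Qed.

Definition nondegenerate : set (V0 G) := [set phi | discriminant (set_val phi) != 0].

Lemma open_nondegenerate : open nondegenerate.
Proof.
have c : continuous (fun phi : V0 G => discriminant (set_val phi) : R^o).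
  move=> phi; have c1 := @initial_continuous _ _ (@set_val _ (V0 G)) phi.
  exact: (cvg_comp _ _ c1 (@discriminant_continuous (set_val phi))).
have -> : nondegenerate = (fun phi : V0 G => discriminant (set_val phi) : R^o) @^-1` (~` [set 0]).
  by apply/seteqP; split => phi /=; [move/eqP|move=> ?; apply/eqP].
apply: open_comp; first by move=> phi _; exact: c.
by rewrite openC; exact: closed_eq.
Qed.

(** The field is equivariant and its derivative vanishes at the trivial zeros. *)
Lemma V0_line (f : Cinfty_space U X) s : V0 G f ->
  V0 G (fun p => f p + s *: P p).
Proof.
move=> [sf ef lf]; have sP := @cubic_field_smooth R.
have sg := smooth_lincomb s sf sP; split; first exact: sg.
  move=> g Gg x l; have := cubic_field_equivariant a_odd a_gt5 b_gt1 rho_odd rho_sq Gg x l.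
  by rewrite (ef g Gg x l) => ->; rewrite mulmxDr scalemxAr.
move=> l v; apply: etrans (partial_diff sg 0 l v) _.
apply: etrans (congr1 (fun H => H (0, l)) (iter_derive_lincomb s [:: (v, 0)] sf sP)) _.
rewrite -[RHS]lf (partial_diff sf) -[RHS]addr0; congr (_ + _).
apply: etrans (congr1 (fun w => s *: w) (cubic_field_linear0 v l)) _.
exact: scaler0.
Qed.

(** Adding s times the cubic field shifts alpha by s and leaves beta j unchanged for j > 0, so the
    discriminant vanishes for at most four values of s. *)
Lemma dense_nondegenerate : dense nondegenerate.
Proof.
move=> O [phi Ophi] oO; set f := set_val phi.
have fV : V0 G f by exact: set_valP.
have [sf ef lf] := fV; have sP := @cubic_field_smooth R.
pose g (s : R) : V0 G := exist _ (fun p => f p + s *: P p) (mem_set (V0_line s fV)).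
have cg : continuous g.
  apply: continuous_comp_initial.
  apply: (Cinfty_line_continuous sP) => s vs p.
  exact: (congr1 (fun H => H p) (iter_derive_lincomb s vs sf sP)).
have g0 : g 0 = phi.
  by apply: val_inj => /=; apply/funext => p; rewrite scale0r addr0.
have [e /= e0 eO] : exists2 e : R, 0 < e & forall s, `|s| < e -> O (g s).
  have : nbhs (0 : R) (g @^-1` O).
    by apply: cg; rewrite g0; exact: open_nbhs_nbhs.
  move=> /nbhs_ballP[e /= e0 eO]; exists e => // s se; apply: eO.
  by rewrite -ball_normE /= sub0r normrN.
have avoid (c : R) : \forall s \near 0^', s != c.
  have [->|c0] := eqVneq c 0; first exact: nbhs_dnbhs_neq.
  near=> s; apply/eqP => sc.
  have : `|s| < `|c| by near: s; apply: dnbhs0_lt; rewrite normr_gt0.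
  by rewrite sc ltxx.
near (0 : R)^' => s.
exists (g s); split.
  by apply: eO; near: s; exact: dnbhs0_lt.
have bE j : beta (set_val (g s)) j = beta f j + s * beta P j.
  exact: (beta_lincomb s j sf sP).
have aE : alpha (set_val (g s)) = alpha f + s.
  by rewrite /alpha bE beta_cubic_field0 mulrDl mulfK// pnatr_eq0.
have bj j : j != ord0 -> s != beta f j - alpha f ->
    beta (set_val (g s)) j - alpha (set_val (g s)) != 0.
  move=> j0 sj; rewrite bE aE beta_cubic_field// mulr0 addr0 opprD addrA.
  by rewrite subr_eq0 eq_sym.
have da : alpha (set_val (g s)) != 0.
  by rewrite aE addrC -[alpha f]opprK subr_eq0; near: s; exact: avoid.
have d1 : s != beta f o1 - alpha f by near: s; exact: avoid.
have d2 : s != beta f o2 - alpha f by near: s; exact: avoid.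
have d3 : s != beta f o3 - alpha f by near: s; exact: avoid.
exact: (mulf_neq0 da (mulf_neq0 (bj o1 isT d1) (mulf_neq0 (bj o2 isT d2) (bj o3 isT d3)))).
Unshelve. all: by end_near. Qed.

Theorem generic_branching :
  generically_hyperbolic_branching G (conjugacy_class G (@reflection_group R)).
Proof.
exists nondegenerate; split; [exact: open_nondegenerate|exact: dense_nondegenerate|].
move=> phi; rewrite /nondegenerate /discriminant /=.
have mn (x y : R) : x * y != 0 -> x != 0 /\ y != 0 by rewrite mulf_eq0 negb_or => /andP.
move=> /mn[a0 /mn[+ /mn[]]]; rewrite !subr_eq0 => b1 b2 b3.
have [sf ef lf] : V0 G (set_val phi) by exact: set_valP.
have [|eps [x [l [zb hy]]]] :=
  hyperbolic_branch a_odd a_gt5 b_odd b_gt1 ab_coprime rho_odd rho_sq sf ef lf a0.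
  by elim/ord4P.
exists (@reflection_group R), eps, x, l; split => //.
exact: (class_self a_odd a_gt5 b_gt1 rho_odd rho_sq).
Qed.

End Generic.

(** * Arithmetic of the parameters *)

Section Hypotheses.

Lemma AA_odd a : AA a -> odd a.
Proof.
move=> [s [_ /allP sP ->]]; rewrite big_seq; apply: (big_ind odd) => // [m n|[p e] /sP /=].
  by rewrite oddM => -> ->.
move=> /and3P[_ /eqP p4 _]; rewrite oddX; apply/orP; right.
by rewrite (divn_eq p 4) p4 oddD oddM /= andbF.
Qed.

Lemma root_dvd a rho : odd_root_of_m1 a rho -> odd rho /\ (a %| rho ^ 2 + 1)%N.
Proof.
move=> [ro _ /eqP]; rewrite eqz_mod_dvd opprK => H; split => //.
Qed.

End Hypotheses.

Theorem mainTheorem7 (R : realType) (a b rho : nat)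
    (ha : AA a) (ha5 : (5 < a)%N)
    (hb1 : b <> 1%N) (hbodd : odd b) (hab : gcdn a b = 1%N)
    (hrho : odd_root_of_m1 a rho) :
  exists tau : set (set 'M[R]_8),
    unique (nontrivial_isotropy_type (@Gab R a b rho)) tau /\
    generically_symmetry_breaking (@Gab R a b rho) tau /\
    generically_hyperbolic_branching (@Gab R a b rho) tau.
Proof.
have a_odd := AA_odd ha; have [rho_odd rho_sq] := root_dvd hrho.
have b_gt1 : (1 < b)%N by case: b hb1 hbodd {hab} => [|[]].
have ab : coprime a b by rewrite /coprime hab.
exists (conjugacy_class (@Gab R a b rho) (@reflection_group R)); split.
  exact: unique_isotropy_type.
have gb := generic_branching R a_odd ha5 hbodd b_gt1 ab rho_odd rho_sq.
split => //; have [N [oN dN NP]] := gb; exists N; split => // phi /NP.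
by move=> [K [eps [x [l [tK zb _]]]]]; exists K, eps, x, l.
Qed.
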